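(* Let $f \in \mathcal{M}^{-1}(L_c)$ and $c_0 >1$. Then the modified Lambert transform $$g(x)= \int_0^\infty \frac{f(t)\, dt}{t(e^{x/t} -1)}, \quad x > 0,$$ maps $\mathcal{M}^{-1}(L_c)$ bijectively onto the space $\mathcal{M}_{1/2,\,1/2 -c_0}^{-1}(L_c)$, and for all $x >0$ the following inversion formula holds: $$f(x)= \lim_{k\to \infty} \left(-x\frac{d}{dx} \right)\prod_{j=1}^k \left(1- \frac{x}{j}\frac{d}{dx}\right)\sum_{n=1}^\infty \mu(n) g(xkn).$$ Analogously, the Widder-Lambert type transformation $$g(x)= \int_0^\infty \frac{f(t)\, dt}{t(e^{x/t} +1)}, \quad x > 0,$$ is a bijective map between the spaces $\mathcal{M}^{-1}(L_c)$ and $\mathcal{M}_{1/2,\,1/2 -c_0}^{-1}(L_c)$, and for all $x >0$ the following inversion formula holds: $$f(x)= \lim_{k\to \infty} \left(-x\frac{d}{dx} \right)\prod_{j=1}^k \left(1- \frac{x}{j}\frac{d}{dx}\right) \sum_{m=0}^\infty\sum_{n=1}^\infty 2^m \mu(n) g\left(xkn 2^m\right).$$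
   Context: Here $c=\{s\in\mathbb{C}:\operatorname{Re}s=c_0\}$ is a vertical line, $c_0\in\mathbb{R}$ fixed. $\mathcal{M}^{-1}(L_c)$ denotes the Banach space of functions $f(x)$, $x\in\mathbb{R}_+=(0,\infty)$, representable as inverse Mellin transforms $$f(x)=\frac{1}{2\pi i}\int_c f^{*}(s)x^{-s}\,ds,\qquad f^*\in L_1(c),$$ with norm $\|f\|_{\mathcal{M}^{-1}(L_c)}=\frac{1}{2\pi}\int_{-\infty}^{+\infty}|f^{*}(c_0+it)|\,dt$. For $c_1,c_2\in\mathbb{R}$ with $2\,\mathrm{sign}\,c_1+\mathrm{sign}\,c_2\ge 0$, $\mathcal{M}^{-1}_{c_1,c_2}(L_c)$ denotes the Banach space of functions $f(x)$, $x\in\mathbb{R}_+$, representable in the same form $f(x)=\frac{1}{2\pi i}\int_c f^{*}(s)x^{-s}ds$ where $s^{c_2}e^{\pi c_1|s|}f^*(s)\in L_1(c)$, with norm $\frac{1}{2\pi}\int_c e^{\pi c_1|s|}|s^{c_2}f^*(s)\,ds|$. $\mu$ is the M\''obius function. The product of differential operators denotes their composition (the operators commute), applied to the function of $x$ standing to their right. *)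

(* Defs.v *)
From HB Require Import structures.
From mathcomp Require Import all_boot all_order all_algebra.
From mathcomp Require Import all_classical all_reals all_analysis.
From mathcomp Require Import complex.

Set Implicit Arguments.
Unset Strict Implicit.
Unset Printing Implicit Defensive.

Import Order.TTheory GRing.Theory Num.Theory.
Import numFieldNormedType.Exports.

Local Open Scope classical_set_scope.
Local Open Scope complex_scope.
Local Open Scope ring_scope.

Section ComplexValued.
Context {R : realType}.
Implicit Types (D : set R) (F : R -> R[i]) (z w : R[i]) (x t : R).

(* Integrals and derivatives of complex-valued functions of a real variable are
   taken componentwise.  Limits of complex sequences are limits for the
   topology of the normed field R[i], which the library attaches to R[i]^o. *)

Definition cintegrable D F : Prop :=
  (@lebesgue_measure R).-integrable D (EFin \o (fun t => complex.Re (F t))) /\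
  (@lebesgue_measure R).-integrable D (EFin \o (fun t => complex.Im (F t))).

Definition cintegral D F : R[i] :=
  (\int[@lebesgue_measure R]_(t in D) complex.Re (F t)) +i*
  (\int[@lebesgue_measure R]_(t in D) complex.Im (F t)).

Definition cderivable F x : Prop :=
  derivable (fun t => complex.Re (F t)) x 1 /\
  derivable (fun t => complex.Im (F t)) x 1.

Definition cderive F x : R[i] :=
  (derive1 (fun t => complex.Re (F t)) x) +i*
  (derive1 (fun t => complex.Im (F t)) x).

Definition derivable_upto_Rpos (n : nat) F : Prop :=
  forall (i : nat) x, (i < n)%N -> 0 < x -> cderivable (iter i cderive F) x.

Definition cexp z : R[i] :=
  (expR (complex.Re z))%:C * (cos (complex.Im z) +i* sin (complex.Im z)).

Definition cabs z : R := ComplexField.Normc.normc z.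

(* Principal argument, in ]-pi, pi]; the value at 0 is junk. *)
Definition carg z : R :=
  let a := acos (complex.Re z / cabs z) in
  if 0 <= complex.Im z then a else - a.

Definition clog z : R[i] := ln (cabs z) +i* carg z.

Definition cpow z w : R[i] := cexp (w * clog z).

(* A function on R_+ = ]0, +oo[ is encoded by its extension by 0 to R, so that
   Leibniz equality of encodings is equality of functions on R_+. *)
Definition on_Rpos F : R -> R[i] := fun x => if 0 < x then F x else 0.

End ComplexValued.

Section Spaces.
Context {R : realType}.
Variable c0 : R.
Implicit Types h fs : R[i] -> R[i].

Definition L1_line h : Prop := cintegrable setT (fun t : R => h (c0 +i* t)).

(* s = c0 + i t, ds = i dt. *)
Definition line_integral h : R[i] :=
  (0 +i* 1) * cintegral setT (fun t : R => h (c0 +i* t)).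

Definition inverse_mellin fs (x : R) : R[i] :=
  (2 * pi%:C * (0 +i* 1))^-1 * line_integral (fun s => fs s * cpow x%:C (- s)).

Definition mellin_inv : set (R -> R[i]) :=
  [set f | exists2 fs, L1_line fs & f = on_Rpos (inverse_mellin fs)].

(* Meant for 2 * sgr c1 + sgr c2 >= 0. *)
Definition mellin_inv_weighted (c1 c2 : R) : set (R -> R[i]) :=
  [set f | exists2 fs,
     L1_line (fun s => cpow s c2%:C * (expR (pi * c1 * cabs s))%:C * fs s)
   & f = on_Rpos (inverse_mellin fs)].

End Spaces.

Section Transforms.
Context {R : realType}.
Implicit Types (f g F : R -> R[i]) (x t : R) (k m n : nat).

Definition lambert_integrand f x : R -> R[i] :=
  fun t => f t / (t * (expR (x / t) - 1))%:C.

Definition widder_lambert_integrand f x : R -> R[i] :=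
  fun t => f t / (t * (expR (x / t) + 1))%:C.

Definition lambert f : R -> R[i] :=
  on_Rpos (fun x => cintegral `]0, +oo[ (lambert_integrand f x)).

Definition widder_lambert f : R -> R[i] :=
  on_Rpos (fun x => cintegral `]0, +oo[ (widder_lambert_integrand f x)).

Definition moebius n : int :=
  if (0 < n)%N && all (fun p => logn p n == 1%N) (primes n)
  then (-1) ^+ size (primes n) else 0.

Definition euler_factor (j : nat) F : R -> R[i] :=
  fun x => F x - (x / j%:R)%:C * cderive F x.

(* (- x d/dx) \prod_(j = 1)^k (1 - (x / j) d/dx), the product being the
   composition euler_factor 1 \o ... \o euler_factor k. *)
Definition euler_op k F : R -> R[i] :=
  fun x => - x%:C * cderive (foldr euler_factor F (iota 1 k)) x.

Definition lambert_term g k x n : R[i]^o :=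
  (moebius n)%:~R * g (x * k%:R * n%:R).

Definition lambert_series g k x : R[i]^o :=
  \big[+%R/0]_(1 <= n <oo) lambert_term g k x n.

Definition widder_term g k x m n : R[i]^o :=
  2 ^+ m * (moebius n)%:~R * g (x * k%:R * n%:R * 2 ^+ m).

Definition widder_inner g k x m : R[i]^o :=
  \big[+%R/0]_(1 <= n <oo) widder_term g k x m n.

Definition widder_series g k x : R[i]^o :=
  \big[+%R/0]_(0 <= m <oo) widder_inner g k x m.

End Transforms.

(* Main.v *)
Require Import Defs.
From HB Require Import structures.
From mathcomp Require Import all_boot all_order all_algebra.
From mathcomp Require Import all_classical all_reals all_analysis.
From mathcomp Require Import measurable_realfun.
From mathcomp Require Import complex.
From mathcomp Require Import ring lra.
Set Implicit Arguments.
Unset Strict Implicit.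
Unset Printing Implicit Defensive.
Import Order.TTheory GRing.Theory Num.Theory.
Import numFieldNormedType.Exports.
Local Open Scope classical_set_scope.
Local Open Scope complex_scope.
Local Open Scope ring_scope.

(** Both transforms act on an inverse Mellin integral
      f(x) = (2 pi i)^-1 \int_c p(s) x^-s ds
    by multiplying its density p. For the Lambert transform the multiplier is the
    Mellin transform of the kernel: expanding 1 / (e^y - 1) in a geometric series
    gives Gamma(s) zeta(s) ([mellin_lambert], [lambert_mellin]). The Widder kernel
    is a difference of two Lambert kernels, 1 / (e^y + 1) = 1 / (e^y - 1) -
    2 / (e^(2 y) - 1), so its multiplier has the extra factor 1 - 2^(1 - s)
    ([widder_mellin]). On a line of abscissa c0 > 1 that factor, zeta and their
    inverses are bounded.

    Image. Everything is thus decided by the size of Gamma on the line. Euler's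
    limit formula writes |Gamma(c + i t)| as |Gamma(c)| divided by the product
    over n >= 0 of (1 + t^2 / (c + n)^2)^(1/2). The logarithm of the factors is
    convex in n, so the midpoint and trapezoid rules compare its sum with an
    explicit integral from above and from below. Both bounds amount to
    |s|^(c - 1/2) e^(- pi |s| / 2) up to constants ([stirling_line]), that is, to
    the inverse of the weight of the target space. Multiplication by the
    multiplier is therefore a bijection between the two spaces of densities
    ([multiplier_bij]).

    Inversion. A dilation of the variable by n multiplies the density by n^-s,
    so that the Moebius sum divides by zeta ([moebius_dilations], where
    \sum mu(n) n^-s = 1 / zeta(s) comes from the hyperbola estimate
    [moebius_zeta_error]); for the Widder transform the sum over m of
    (2^(1 - s))^m divides by 1 - 2^(1 - s), its partial sums being telescopic
    ([widder_layers_sum]). What is left is Gamma(s) k^-s p(s)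
    ([gamma_dilate]). Applying - x d/dx multiplies the density by s, so the
    operator of order k divides by the k-th approximant in Euler's limit formula
    ([euler_op_mellin_line]), and there remains the ratio of Gamma to its
    approximant. It tends to 1 pointwise, and it is uniformly bounded because the
    approximants decrease in modulus, relative to the real axis, as k grows
    ([Gamma_ratio_le]); dominated convergence concludes ([euler_inversion]).

    Injectivity. Distinct densities could a priori represent the same function,
    but the inversion formula computes f from its transform. *)

(** * Complex numbers over the real field *)

Section ComplexModulus.
Context {R : realType}.
Implicit Types (z w : R[i]) (r : R).

Lemma cabs_normE z : `|z| = (cabs z)%:C. Proof. by []. Qed.

Lemma cabs_ge0 z : 0 <= cabs z.
Proof. by case: z => a b; rewrite sqrtr_ge0. Qed.

Lemma cabsM z w : cabs (z * w) = cabs z * cabs w.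
Proof. exact: ComplexField.Normc.normcM. Qed.

Lemma cabsV z : cabs z^-1 = (cabs z)^-1.
Proof. exact: ComplexField.Normc.normcV. Qed.

Lemma cabs0 : cabs (0 : R[i]) = 0.
Proof. exact: ComplexField.Normc.normc0. Qed.

Lemma cabs1 : cabs (1 : R[i]) = 1.
Proof. exact: ComplexField.Normc.normc1. Qed.

Lemma cabsD z w : cabs (z + w) <= cabs z + cabs w.
Proof. by rewrite -lecR rmorphD /= -!cabs_normE ler_normD. Qed.

Lemma cabsN z : cabs (- z) = cabs z.
Proof. by case: z => a b /=; rewrite !sqrrN. Qed.

Lemma cabsB z w : cabs (z - w) = cabs (w - z).
Proof. by rewrite -cabsN opprB. Qed.

Lemma cabs_eq0 z : (cabs z == 0) = (z == 0).
Proof.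
by apply/eqP/eqP => [/ComplexField.Normc.eq0_normc //|->]; exact: cabs0.
Qed.

Lemma cabs_gt0 z : (0 < cabs z) = (z != 0).
Proof. by rewrite lt_def cabs_eq0 cabs_ge0 andbT. Qed.

Lemma cabs_real r : cabs r%:C = `|r|.
Proof. by rewrite /cabs /= expr0n addr0 sqrtr_sqr. Qed.

Lemma cabs_sqr z : cabs z ^+ 2 = complex.Re z ^+ 2 + complex.Im z ^+ 2.
Proof. by case: z => a b /=; rewrite sqr_sqrtr // addr_ge0 // sqr_ge0. Qed.

Lemma normr_Re_le z : `|complex.Re z| <= cabs z.
Proof.
rewrite -(@ler_pXn2r _ 2) ?nnegrE ?cabs_ge0 //.
by rewrite cabs_sqr real_normK ?num_real // lerDl sqr_ge0.
Qed.

Lemma normr_Im_le z : `|complex.Im z| <= cabs z.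
Proof.
rewrite -(@ler_pXn2r _ 2) ?nnegrE ?cabs_ge0 //.
by rewrite cabs_sqr real_normK ?num_real // lerDr sqr_ge0.
Qed.

Lemma cabs_le_ReIm z : cabs z <= `|complex.Re z| + `|complex.Im z|.
Proof.
rewrite -(@ler_pXn2r _ 2) ?nnegrE ?cabs_ge0 ?addr_ge0 //.
rewrite cabs_sqr sqrrD !real_normK ?num_real // addrAC lerDl.
by rewrite mulrn_wge0 // mulr_ge0.
Qed.

Lemma cabs_sum_le (I : Type) (r : seq I) (P : pred I) (F : I -> R[i]) :
  cabs (\sum_(i <- r | P i) F i) <= \sum_(i <- r | P i) cabs (F i).
Proof.
elim/big_ind2 : _ => // [|x1 x2 y1 y2 h1 h2]; first by rewrite cabs0.
by rewrite (le_trans (cabsD _ _)) // lerD.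
Qed.

Lemma cabs_nat n : cabs (n%:R : R[i]) = n%:R.
Proof. by rewrite -(rmorph_nat (real_complex R)) cabs_real normr_nat. Qed.

Lemma cReD z w : complex.Re (z + w) = complex.Re z + complex.Re w.
Proof. by case: z w => ? ? []. Qed.
Lemma cImD z w : complex.Im (z + w) = complex.Im z + complex.Im w.
Proof. by case: z w => ? ? []. Qed.
Lemma cReN z : complex.Re (- z) = - complex.Re z. Proof. by case: z. Qed.
Lemma cImN z : complex.Im (- z) = - complex.Im z. Proof. by case: z. Qed.
Lemma cReM z w : complex.Re (z * w) =
  complex.Re z * complex.Re w - complex.Im z * complex.Im w.
Proof. by case: z w => ? ? []. Qed.
Lemma cImM z w : complex.Im (z * w) =
  complex.Re z * complex.Im w + complex.Im z * complex.Re w.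
Proof. by case: z w => ? ? []. Qed.

Lemma complex_ext z w :
  complex.Re z = complex.Re w -> complex.Im z = complex.Im w -> z = w.
Proof. by case: z w => ? ? [? ?] /= -> ->. Qed.

Lemma cRe_real r : complex.Re r%:C = r. Proof. by []. Qed.
Lemma cIm_real r : complex.Im r%:C = 0. Proof. by []. Qed.

Lemma cRe_natr n : complex.Re (n%:R : R[i]) = n%:R.
Proof. by rewrite -(rmorph_nat (real_complex R)). Qed.

Lemma cIm_natr n : complex.Im (n%:R : R[i]) = 0.
Proof. by rewrite -(rmorph_nat (real_complex R)). Qed.

End ComplexModulus.

(** * Limits of complex sequences *)

Section ComplexLimits.
Context {R : realType}.
Implicit Types (u v : nat -> R[i]) (a b l : R[i]).

(** Convergence in the norm topology of the complex field, which is carried by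
    the regular module R[i]^o and not by R[i] itself. *)
Definition ccvg u l : Prop := (u : nat -> R[i]^o) @ \oo --> (l : R[i]^o).

Lemma cvg_seqMl (u : nat -> R) (k l : R) :
  u @ \oo --> l -> (fun n => k * u n) @ \oo --> k * l.
Proof. exact: cvgMl_tmp. Qed.

Lemma cvg_seqMr (u : nat -> R) (k l : R) :
  u @ \oo --> l -> (fun n => u n * k) @ \oo --> l * k.
Proof. exact: cvgMr_tmp. Qed.

Lemma ler_cvg_seq N (u v : nat -> R) (a b : R) :
  u @ \oo --> a -> v @ \oo --> b ->
  (forall n, (N <= n)%N -> u n <= v n) -> a <= b.
Proof. by move=> ua vb uv; apply: (ler_cvg_to ua vb); exists N. Qed.

Lemma cvg_seq_le (u : nat -> R) (a b : R) :
  u @ \oo --> a -> (forall n, u n <= b) -> a <= b.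
Proof.
move=> ua ub.
have ub' : (fun=> b : R) @ \oo --> b by exact: cvg_cst.
by apply: (ler_cvg_to ua ub'); exact: nearW.
Qed.

Lemma ge0_cvg0P (e : nat -> R) : (forall n, 0 <= e n) ->
  (e @ \oo --> (0 : R)) <->
  (forall d, 0 < d -> exists N, forall n, (N <= n)%N -> e n < d).
Proof.
move=> e0; split=> [/cvgrPdist_lt h d /h[N _ hN]|h].
  exists N => n /hN /=.
  by rewrite sub0r normrN ger0_norm.
apply/cvgrPdist_lt => d /h[N hN]; exists N => // n /= /hN.
by rewrite sub0r normrN ger0_norm.
Qed.

Lemma ccvgP u l : ccvg u l <-> (fun n => cabs (u n - l)) @ \oo --> (0 : R).
Proof.
rewrite ge0_cvg0P => [|n]; last exact: cabs_ge0.
split=> [/cvgrPdist_lt h e e0|h].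
  have [|N _ hN] := h (e%:C); first by rewrite ltcR.
  by exists N => n /hN /=; rewrite cabs_normE ltcR cabsB.
apply/cvgrPdist_lt => e; rewrite lt_def => /andP[e0]; rewrite lecE => /andP[ie re].
have eE : e = (complex.Re e)%:C by apply: complex_ext => //=; exact/eqP.
have re0 : 0 < complex.Re e.
  by rewrite lt_def re andbT; apply: contra e0 => /eqP h0; rewrite eE h0.
have [N hN] := h _ re0; exists N => // n /hN.
by rewrite cabs_normE eE ltcR cabsB.
Qed.

Lemma ccvg_ReIm u l : ccvg u l <->
  ((fun n => complex.Re (u n)) @ \oo --> complex.Re l /\
   (fun n => complex.Im (u n)) @ \oo --> complex.Im l).
Proof.
rewrite ccvgP ge0_cvg0P => [|n]; last exact: cabs_ge0.
split=> [h|[/cvgrPdist_lt hr /cvgrPdist_lt hi]].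
  split; apply/cvgrPdist_lt => e /h[N hN]; exists N => // n /hN;
    rewrite cabsB; apply: le_lt_trans.
    by apply: le_trans (normr_Re_le _); rewrite cReD cReN.
  by apply: le_trans (normr_Im_le _); rewrite cImD cImN.
move=> e e0; have e20 : 0 < e / 2 by rewrite divr_gt0.
have [N1 _ h1] := hr _ e20; have [N2 _ h2] := hi _ e20.
exists (maxn N1 N2) => n; rewrite geq_max => /andP[n1 n2]; rewrite cabsB.
apply: le_lt_trans (cabs_le_ReIm _) _.
by rewrite cReD cReN cImD cImN (splitr e) ltrD //; [exact: h1|exact: h2].
Qed.

Lemma ccvg_cst l : ccvg (fun=> l) l.
Proof. exact: (@cvg_cst R[i]^o). Qed.

Lemma ccvgM u v a b : ccvg u a -> ccvg v b -> ccvg (fun n => u n * v n) (a * b).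
Proof. exact: (@cvgM R[i] nat \oo _ u v a b). Qed.

Arguments ccvg_cst l : clear implicits.
Arguments ccvgM {u v a b} _ _.

Lemma ccvgZ u a l : ccvg u l -> ccvg (fun n => a * u n) (a * l).
Proof. by move=> ul; exact: (ccvgM (ccvg_cst a) ul). Qed.

Lemma ccvgD u v a b : ccvg u a -> ccvg v b -> ccvg (fun n => u n + v n) (a + b).
Proof. exact: (@cvgD R[i] R[i]^o nat \oo _ u v a b). Qed.

Lemma ccvgV u a : ccvg u a -> a != 0 -> ccvg (fun n => (u n)^-1) (a^-1).
Proof. by move=> *; exact: (@cvgV R[i] nat \oo _ u a). Qed.

Arguments ccvgZ {u} a {l} _.
Arguments ccvgD {u v a b} _ _.
Arguments ccvgV {u a} _ _.

Lemma ccvg_unique u a b : ccvg u a -> ccvg u b -> a = b.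
Proof. exact: (@cvg_unique R[i]^o (@norm_hausdorff _ _)). Qed.

Lemma ccvg_lim u l : ccvg u l -> limn (u : nat -> R[i]^o) = l.
Proof. by move=> h; apply/cvg_lim. Qed.

Lemma ccvg_cvgn u l : ccvg u l -> cvgn (u : nat -> R[i]^o).
Proof. by move=> h; apply/cvg_ex; exists l. Qed.

Lemma eq_ccvg N u v l : (forall n, (N <= n)%N -> u n = v n) ->
  ccvg u l -> ccvg v l.
Proof.
move=> uv; rewrite !ccvgP; apply: cvg_trans; apply: near_eq_cvg.
by exists N => // n /= /uv ->.
Qed.

Lemma ccvg_shift k u l : ccvg (fun n => u (n + k)%N) l <-> ccvg u l.
Proof. by rewrite /ccvg (cvg_shiftn k (u : nat -> R[i]^o)). Qed.

Lemma ccvg_real (u : nat -> R) (l : R) : u @ \oo --> l ->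
  ccvg (fun n => (u n)%:C) l%:C.
Proof. by move=> h; apply/ccvg_ReIm; split => //=; exact: cvg_cst. Qed.

Lemma ccvg_cabs u l : ccvg u l -> (fun n => cabs (u n)) @ \oo --> cabs l.
Proof.
move=> /ccvgP; rewrite ge0_cvg0P => [h|n]; last exact: cabs_ge0.
apply/cvgrPdist_lt => e /h[N hN]; exists N => // n /hN; apply: le_lt_trans.
have h1 := cabsD (l - u n) (u n); have h2 := cabsD (u n - l) l.
rewrite !subrK in h1 h2; rewrite (cabsB l) in h1.
by rewrite ler_norml; apply/andP; split; lra.
Qed.

Lemma ccvg_squeeze (e : nat -> R) u l :
  (forall n, cabs (u n - l) <= e n) -> e @ \oo --> (0 : R) -> ccvg u l.
Proof.
move=> h; have e0 n : 0 <= e n by apply: le_trans (h n); exact: cabs_ge0.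
rewrite ge0_cvg0P // => he; apply/ccvgP/ge0_cvg0P => [n|d /he[N hN]].
  exact: cabs_ge0.
by exists N => n /hN; apply: le_lt_trans.
Qed.

End ComplexLimits.
Arguments cvg_seqMl {R u} k {l} _.
Arguments cvg_seqMr {R u} k {l} _.
Arguments cvg_seq_le {R u a b} _ _.
Arguments ler_cvg_seq {R} N {u v a b} _ _ _.
Arguments ccvg_cst {R} l.
Arguments ccvgM {R u v a b} _ _.
Arguments ccvgZ {R u} a {l} _.
Arguments ccvgD {R u v a b} _ _.
Arguments ccvgV {R u a} _ _.
Arguments ccvg_unique {R u a b} _ _.
Arguments ccvg_lim {R u l} _.
Arguments ccvg_cvgn {R u l} _.
Arguments eq_ccvg {R} N u {v l} _ _.
Arguments ccvg_shift {R} k {u l}.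
Arguments ccvg_real {R u l} _.
Arguments ccvg_cabs {R u l} _.
Arguments ccvg_squeeze {R e u l} _ _.

(** * The kernel of the Mellin transform *)

(** The Mellin kernel x^(-s), written through the real logarithm; opaque, so
    that only its exponential laws are visible and not the product in its
    body. *)
HB.lock Definition mpow {R : realType} (s : R[i]) (x : R) : R[i] :=
  cexp (- s * (ln x)%:C).

Section ComplexPowers.
Context {R : realType}.
Implicit Types (z w s : R[i]) (x y : R).

Lemma cexpD z w : cexp (z + w) = cexp z * cexp w.
Proof.
rewrite /cexp cReD cImD expRD cosD sinD; case: z w => a b [c d] /=.
by apply: complex_ext; rewrite !(cReM, cImM) /=; ring.
Qed.

Lemma cexp0 : cexp (0 : R[i]) = 1.
Proof. by rewrite /cexp /= expR0 cos0 sin0 mul1r. Qed.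

Lemma cexpN z : cexp (- z) = (cexp z)^-1.
Proof.
have h : cexp z * cexp (- z) = 1 by rewrite -cexpD subrr cexp0.
have z0 : cexp z != 0.
  by apply/eqP => z0; move: h; rewrite z0 mul0r => /eqP; rewrite eq_sym oner_eq0.
by apply: (mulfI z0); rewrite h divff.
Qed.

Lemma cabs_cexp z : cabs (cexp z) = expR (complex.Re z).
Proof.
rewrite /cexp cabsM cabs_real ger0_norm ?expR_ge0 // /cabs /=.
by rewrite cos2Dsin2 sqrtr1 mulr1.
Qed.

Lemma Re_cexp z : complex.Re (cexp z) = expR (complex.Re z) * cos (complex.Im z).
Proof. by rewrite /cexp cReM /= mul0r subr0. Qed.

Lemma Im_cexp z : complex.Im (cexp z) = expR (complex.Re z) * sin (complex.Im z).
Proof. by rewrite /cexp cImM /= mul0r addr0. Qed.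

Lemma Re_mpow s x : complex.Re (mpow s x) =
  expR (- (complex.Re s * ln x)) * cos (complex.Im s * ln x).
Proof.
case: s => a b; rewrite !mpow.unlock Re_cexp !(cReM, cImM) /= !mulr0 subr0 add0r.
by rewrite !mulNr cosN.
Qed.

Lemma Im_mpow s x : complex.Im (mpow s x) =
  - (expR (- (complex.Re s * ln x)) * sin (complex.Im s * ln x)).
Proof.
case: s => a b; rewrite !mpow.unlock Im_cexp !(cReM, cImM) /= !mulr0 subr0 add0r.
by rewrite !mulNr sinN mulrN.
Qed.

Lemma cabs_mpow s x : cabs (mpow s x) = expR (- (complex.Re s * ln x)).
Proof. by rewrite !mpow.unlock cabs_cexp cReM cReN /= mulr0 subr0 mulNr. Qed.

Lemma mpow_neq0 s x : mpow s x != 0.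
Proof. by rewrite -cabs_gt0 cabs_mpow expR_gt0. Qed.

Lemma mpowM s x y : 0 < x -> 0 < y -> mpow s (x * y) = mpow s x * mpow s y.
Proof. by move=> x0 y0; rewrite !mpow.unlock lnM // rmorphD mulrDr cexpD. Qed.

Lemma mpowD s w x : mpow (s + w) x = mpow s x * mpow w x.
Proof. by rewrite !mpow.unlock opprD mulrDl cexpD. Qed.

Lemma mpowN s x : mpow (- s) x = (mpow s x)^-1.
Proof. by rewrite !mpow.unlock mulNr cexpN. Qed.

Lemma mpow1x s : mpow s 1 = 1.
Proof. by rewrite !mpow.unlock ln1 mulr0 cexp0. Qed.

Lemma mpow_inv s x : 0 < x -> mpow s x^-1 = mpow (- s) x.
Proof. by move=> x0; rewrite !mpow.unlock lnV ?posrE // rmorphN mulrN opprK mulNr opprK. Qed.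

Lemma mpow_real (c x : R) : mpow c%:C x = (expR (- (c * ln x)))%:C.
Proof.
by apply: complex_ext; rewrite ?Re_mpow ?Im_mpow /= mul0r ?cos0 ?sin0 ?mulr1 ?mulr0 ?oppr0.
Qed.

Lemma mpow1 x : 0 < x -> mpow 1 x = x^-1%:C.
Proof.
move=> x0; have -> : (1 : R[i]) = 1%:C by [].
by rewrite mpow_real mul1r expRN lnK.
Qed.

Lemma mpowX s x n : 0 < x -> mpow s (x ^+ n) = mpow s x ^+ n.
Proof.
move=> x0; elim: n => [|n ih]; first by rewrite !expr0 mpow1x.
by rewrite !exprS mpowM ?exprn_gt0 // ih.
Qed.

(** The principal argument of a positive real is arccos 1 = 0. *)
Lemma cpow_mpow s x : 0 < x -> cpow x%:C (- s) = mpow s x.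
Proof.
move=> x0; rewrite /cpow mpow.unlock /clog cabs_real gtr0_norm //.
by rewrite /carg lexx cabs_real gtr0_norm //= divff ?gt_eqF // acos1.
Qed.

End ComplexPowers.

(** * Measurability of complex functions *)

Section ComplexMeasurable.
Context {d} {T : measurableType d} {R : realType}.
Implicit Types (D : set T) (F G : T -> R[i]) (f g : T -> R).

Definition cmeas D F : Prop :=
  measurable_fun D (fun x => complex.Re (F x)) /\
  measurable_fun D (fun x => complex.Im (F x)).

Lemma measurable_funV D f : measurable_fun D f ->
  measurable_fun D (fun x => (f x)^-1).
Proof.
move=> mf; have -> : (fun x => (f x)^-1) = (fun x => f x * (f x ^+ 2) `^ (-1)).
  apply/funext => x; rewrite powR_inv1 ?sqr_ge0 //.
  by have [->|f0] := eqVneq (f x) 0; [rewrite invr0 mul0r|field].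
apply: measurable_funM => //.
apply: (measurableT_comp (measurable_powR _)).
exact: measurable_funX.
Qed.

Lemma cmeas_real D f : measurable_fun D f -> cmeas D (fun x => (f x)%:C).
Proof. by move=> mf; split => //=; exact: measurable_cst. Qed.

Lemma cmeas_cst D a : cmeas D (fun=> a).
Proof. by split; exact: measurable_cst. Qed.

Lemma cmeas_pair D f g : measurable_fun D f -> measurable_fun D g ->
  cmeas D (fun x => f x +i* g x).
Proof. by []. Qed.

Lemma cmeasD D F G : cmeas D F -> cmeas D G -> cmeas D (fun x => F x + G x).
Proof.
move=> [f1 f2] [g1 g2]; split.
  by under eq_fun do rewrite cReD; exact: measurable_funD.
by under eq_fun do rewrite cImD; exact: measurable_funD.
Qed.

Lemma cmeasN D F : cmeas D F -> cmeas D (fun x => - F x).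
Proof.
move=> [f1 f2]; split.
  by under eq_fun do rewrite cReN; exact: measurable_funN.
by under eq_fun do rewrite cImN; exact: measurable_funN.
Qed.

Lemma cmeasM D F G : cmeas D F -> cmeas D G -> cmeas D (fun x => F x * G x).
Proof.
move=> [f1 f2] [g1 g2]; split.
  under eq_fun do rewrite cReM.
  by apply: measurable_funB; exact: measurable_funM.
under eq_fun do rewrite cImM.
by apply: measurable_funD; exact: measurable_funM.
Qed.

Lemma cmeas_sum D n (F_ : nat -> T -> R[i]) : (forall k, cmeas D (F_ k)) ->
  cmeas D (fun x => \sum_(1 <= k < n) F_ k x).
Proof.
move=> mF; elim: n => [|[|n] ih].
- by under eq_fun do rewrite big_geq //; exact: cmeas_cst.
- by under eq_fun do rewrite big_geq //; exact: cmeas_cst.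
- by under eq_fun do rewrite big_nat_recr //=; exact: cmeasD.
Qed.

Lemma cmeas_prod D n (F_ : nat -> T -> R[i]) : (forall k, cmeas D (F_ k)) ->
  cmeas D (fun x => \prod_(k < n) F_ k x).
Proof.
move=> mF; elim: n => [|n ih].
- by under eq_fun do rewrite big_ord0 //; exact: cmeas_cst.
- by under eq_fun do rewrite big_ord_recr //=; exact: cmeasM.
Qed.

Lemma measurable_cabs D F : cmeas D F -> measurable_fun D (fun x => cabs (F x)).
Proof.
move=> [f1 f2].
have -> : (fun x => cabs (F x)) =
    (fun x => (complex.Re (F x) ^+ 2 + complex.Im (F x) ^+ 2) `^ 2^-1).
  apply/funext => x; rewrite powR12_sqrt ?addr_ge0 ?sqr_ge0 //.
  by rewrite -cabs_sqr sqrtr_sqr ger0_norm ?cabs_ge0.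
apply: (measurableT_comp (measurable_powR _)).
by apply: measurable_funD; exact: measurable_funX.
Qed.

Lemma cmeasV D F : cmeas D F -> cmeas D (fun x => (F x)^-1).
Proof.
move=> mF; have [f1 f2] := mF; have mn := measurable_cabs mF.
have E z : (z : R[i])^-1 = (cabs z ^+ 2)^-1%:C * (complex.Re z -i* complex.Im z).
  rewrite cabs_sqr; case: z => a b; rewrite /GRing.inv /=.
  by apply: complex_ext; rewrite !(cReM, cImM) /= mul0r ?(subr0, addr0) mulrC ?mulNr ?mulrN.
under [X in cmeas _ X]eq_fun do rewrite E.
apply: cmeasM.
  by apply: cmeas_real; apply: measurable_funV; exact: measurable_funX.
by apply: cmeas_pair => //; exact: measurable_funN.
Qed.

Lemma cmeas_lim D (F_ : nat -> T -> R[i]) F : (forall n, cmeas D (F_ n)) ->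
  (forall x, D x -> ccvg (F_ ^~ x) (F x)) -> cmeas D F.
Proof.
move=> mF cF; split.
  apply: (@measurable_fun_cvg _ _ _ _ (fun n x => complex.Re (F_ n x))).
    by move=> n; have [] := mF n.
  by move=> x /cF /ccvg_ReIm[].
apply: (@measurable_fun_cvg _ _ _ _ (fun n x => complex.Im (F_ n x))).
  by move=> n; have [] := mF n.
by move=> x /cF /ccvg_ReIm[].
Qed.

Lemma cmeas_mpow D (S : T -> R[i]) f : cmeas D S -> measurable_fun D f ->
  cmeas D (fun y => mpow (S y) (f y)).
Proof.
move=> [m1 m2] mf; have ml : measurable_fun D (fun y => ln (f y)).
  by apply: (measurableT_comp (@measurable_ln R)).
have me : measurable_fun D (fun y => expR (- (complex.Re (S y) * ln (f y)))).
  apply: (measurableT_comp (@measurable_expR R)).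
  by apply: measurable_funN; exact: measurable_funM.
split.
  under eq_fun do rewrite Re_mpow; apply: measurable_funM => //.
  apply: (measurableT_comp (continuous_measurable_fun (@continuous_cos R))).
  exact: measurable_funM.
under eq_fun do rewrite Im_mpow; apply: measurable_funN; apply: measurable_funM => //.
apply: (measurableT_comp (continuous_measurable_fun (@continuous_sin R))).
exact: measurable_funM.
Qed.

Lemma cmeasS D E F : measurable E -> D `<=` E -> cmeas E F -> cmeas D F.
Proof. by move=> mE DE [a b]; split; apply: measurable_funS DE _. Qed.

End ComplexMeasurable.

Lemma cmeas_comp d1 d2 (T1 : measurableType d1) (T2 : measurableType d2)
    (R : realType) (F : T2 -> R[i]) (phi : T1 -> T2) :
  cmeas setT F -> measurable_fun setT phi -> cmeas setT (fun x => F (phi x)).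
Proof.
move=> [f1 f2] mphi; split; first exact: (measurableT_comp f1 mphi).
exact: (measurableT_comp f2 mphi).
Qed.

(** * Integrals of complex functions *)

Section ComplexIntegral.
Context {R : realType}.
Implicit Types (D : set R) (F G : R -> R[i]) (f g : R -> R) (a : R[i]).
Notation mu := (@lebesgue_measure R).

Lemma cintegrable_cmeas D F : cintegrable D F -> cmeas D F.
Proof.
by move=> [/(measurable_int mu)/measurable_EFinP ? /(measurable_int mu)/measurable_EFinP ?].
Qed.

Lemma cintegrable_le D F g : measurable D -> cmeas D F ->
  mu.-integrable D (EFin \o g) -> (forall x, D x -> cabs (F x) <= g x) ->
  cintegrable D F.
Proof.
move=> mD [f1 f2] ig Fg; split.
  apply: le_integrable ig => //; first exact/measurable_EFinP.
  move=> x Dx /=; rewrite lee_fin (le_trans (normr_Re_le _)) //.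
  by rewrite (le_trans (Fg _ Dx)) ?ler_norm.
apply: le_integrable ig => //; first exact/measurable_EFinP.
move=> x Dx /=; rewrite lee_fin (le_trans (normr_Im_le _)) //.
by rewrite (le_trans (Fg _ Dx)) ?ler_norm.
Qed.

Lemma cintegrable_cabs D F : measurable D -> cintegrable D F ->
  mu.-integrable D (EFin \o (fun x => cabs (F x))).
Proof.
move=> mD iF; have mF := cintegrable_cmeas iF; have [h1 h2] := iF.
have h3 := integrableD (mu := mu) mD (integrable_norm h1) (integrable_norm h2).
apply: le_integrable h3 => //.
  by apply/measurable_EFinP; exact: measurable_cabs.
move=> x Dx /=; rewrite lee_fin ger0_norm ?cabs_ge0 //.
by rewrite (le_trans (cabs_le_ReIm _)) // ler_norm.
Qed.

(** Multipliers enter the integrals below only through a uniform bound. *)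
Lemma cintegrableM D F G (C : R) : measurable D -> cintegrable D F ->
  cmeas D G -> (forall x, D x -> cabs (G x) <= C) ->
  cintegrable D (fun x => G x * F x).
Proof.
move=> mD iF mG GC; have ia := cintegrable_cabs mD iF.
apply: (@cintegrable_le _ _ (fun x => C * cabs (F x))) => //.
- by apply: cmeasM => //; exact: cintegrable_cmeas.
- have := integrableZl (mu := mu) mD C ia.
  by apply: eq_integrable => // x _.
- by move=> x Dx; rewrite cabsM ler_wpM2r ?cabs_ge0 ?GC.
Qed.

Lemma eq_cintegrable D F G : measurable D -> (forall x, D x -> F x = G x) ->
  cintegrable D F -> cintegrable D G.
Proof.
move=> mD FG [h1 h2]; split.
  by apply: eq_integrable h1 => // x /set_mem Dx /=; rewrite FG.
by apply: eq_integrable h2 => // x /set_mem Dx /=; rewrite FG.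
Qed.

Lemma eq_cintegral D F G : (forall x, D x -> F x = G x) ->
  cintegral D F = cintegral D G.
Proof.
move=> FG; rewrite /cintegral; congr (_ +i* _).
  by apply: eq_Rintegral => x /set_mem Dx; rewrite FG.
by apply: eq_Rintegral => x /set_mem Dx; rewrite FG.
Qed.

Lemma cintegrableD D F G : measurable D -> cintegrable D F -> cintegrable D G ->
  cintegrable D (fun x => F x + G x).
Proof.
move=> mD [f1 f2] [g1 g2]; split.
  by apply: eq_integrable (integrableD (mu := mu) mD f1 g1) => // x _ /=; rewrite cReD.
by apply: eq_integrable (integrableD (mu := mu) mD f2 g2) => // x _ /=; rewrite cImD.
Qed.

Lemma cintegralD D F G : measurable D -> cintegrable D F -> cintegrable D G ->
  cintegral D (fun x => F x + G x) = cintegral D F + cintegral D G.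
Proof.
move=> mD [f1 f2] [g1 g2]; apply: complex_ext; rewrite !(cReD, cImD) /=.
  by rewrite -RintegralD //; apply: eq_Rintegral => x _; rewrite cReD.
by rewrite -RintegralD //; apply: eq_Rintegral => x _; rewrite cImD.
Qed.

Lemma cintegrableZ D F a : measurable D -> cintegrable D F ->
  cintegrable D (fun x => a * F x).
Proof.
by move=> mD iF; apply: (cintegrableM (C := cabs a)) => //; exact: cmeas_cst.
Qed.

Lemma cintegralZ D F a : measurable D -> cintegrable D F ->
  cintegral D (fun x => a * F x) = a * cintegral D F.
Proof.
move=> mD [f1 f2].
have z1 (r : R) := integrableZl (mu := mu) mD r f1; have z2 (r : R) := integrableZl (mu := mu) mD r f2.
apply: complex_ext; rewrite !(cReM, cImM) /=.
  rewrite -!RintegralZl // -RintegralB //; last first.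
  - exact: z2.
  - exact: z1.
  by apply: eq_Rintegral => x _; rewrite cReM.
rewrite -!RintegralZl // -RintegralD //; last first.
- exact: z1.
- exact: z2.
by apply: eq_Rintegral => x _; rewrite cImM.
Qed.

Lemma cintegral_sum D n (F_ : nat -> R -> R[i]) : measurable D ->
  (forall k, (0 < k)%N -> cintegrable D (F_ k)) ->
  cintegrable D (fun x => \sum_(1 <= k < n) F_ k x) /\
  cintegral D (fun x => \sum_(1 <= k < n) F_ k x) =
    \sum_(1 <= k < n) cintegral D (F_ k).
Proof.
move=> mD iF.
have base : cintegrable D (fun=> 0) /\ cintegral D (fun=> 0) = 0.
  split; first by split; exact: integrable0.
  by rewrite /cintegral /Rintegral /= integral0.
elim: n => [|[|n] [ih1 ih2]].
- by rewrite big_geq //; under eq_fun do rewrite big_geq //.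
- by rewrite big_geq //; under eq_fun do rewrite big_geq //.
rewrite big_nat_recr //= -ih2; under eq_fun do rewrite big_nat_recr //=.
have iFn := iF n.+1 (ltn0Sn n).
by split; [exact: cintegrableD|rewrite cintegralD].
Qed.

Lemma cintegral_mkcond D F : cintegral D F =
  cintegral setT (fun x => if x \in D then F x else 0).
Proof.
rewrite /cintegral; congr (_ +i* _); rewrite Rintegral_mkcond;
  by apply: eq_Rintegral => x _; rewrite /patch; case: ifP.
Qed.

Lemma cintegrable_mkcond D F : measurable D -> cintegrable D F <->
  cintegrable setT (fun x => if x \in D then F x else 0).
Proof.
move=> mD; split=> -[h1 h2]; split.
- move/(integrable_mkcond (mu := mu) _ mD) : h1; apply: eq_integrable => // x _.
  by rewrite /patch /=; case: ifP.
- move/(integrable_mkcond (mu := mu) _ mD) : h2; apply: eq_integrable => // x _.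
  by rewrite /patch /=; case: ifP.
- apply/(integrable_mkcond (mu := mu) _ mD); move: h1; apply: eq_integrable => // x _.
  by rewrite /patch /=; case: ifP.
- apply/(integrable_mkcond (mu := mu) _ mD); move: h2; apply: eq_integrable => // x _.
  by rewrite /patch /=; case: ifP.
Qed.

Lemma cmeas_indic D (I : set R) F : measurable I -> cmeas D F ->
  cmeas D (fun x => (\1_I x)%:C * F x).
Proof.
by move=> mI mF; apply: cmeasM => //; apply: cmeas_real; exact: measurable_indic.
Qed.

Lemma cintegral_indic D (I : set R) F : I `<=` D ->
  cintegral D (fun x => (\1_I x)%:C * F x) = cintegral I F.
Proof.
move=> ID; rewrite cintegral_mkcond [RHS]cintegral_mkcond.
apply: eq_cintegral => x _; rewrite indicE.
case: ifPn => [xD|xD]; first by case: ifP; rewrite ?mul1r ?mul0r.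
by rewrite ifN //; apply: contra xD => /set_mem/ID/mem_set.
Qed.

Lemma cabs_indic_le (I : set R) x (z : R[i]) : cabs ((\1_I x)%:C * z) <= cabs z.
Proof.
rewrite cabsM cabs_real indicE ger0_norm ?ler0n // -[leRHS]mul1r.
by rewrite ler_wpM2r ?cabs_ge0 // lern1 leq_b1.
Qed.

Lemma Rintegral_dominated D (f_ : nat -> R -> R) f g : measurable D ->
  (forall n, measurable_fun D (f_ n)) ->
  (forall x, D x -> (f_ ^~ x) @ \oo --> f x) ->
  mu.-integrable D (EFin \o g) ->
  (forall n x, D x -> `|f_ n x| <= g x) ->
  mu.-integrable D (EFin \o f) /\
  (fun n => \int[mu]_(x in D) f_ n x) @ \oo --> \int[mu]_(x in D) f x.
Proof.
move=> mD mf ff ig fg.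
have mlim : measurable_fun D f by exact: measurable_fun_cvg mf ff.
have [] := @dominated_convergence _ _ R mu D mD (fun n => EFin \o f_ n)
  (EFin \o f) (EFin \o g).
- by move=> n; apply/measurable_EFinP; exact: mf.
- exact/measurable_EFinP.
- by apply: aeW => x Dx; apply: cvg_EFin; [exact: nearW|exact: ff].
- exact: ig.
- by apply: aeW => x n Dx /=; rewrite lee_fin fg.
- move=> h1 _ h3; split => //.
  apply: fine_cvg.
  rewrite /Rintegral fineK //; exact: integrable_fin_num.
Qed.

Lemma cintegral_dominated D (F_ : nat -> R -> R[i]) F g : measurable D ->
  (forall n, cmeas D (F_ n)) ->
  (forall x, D x -> ccvg (F_ ^~ x) (F x)) ->
  mu.-integrable D (EFin \o g) ->
  (forall n x, D x -> cabs (F_ n x) <= g x) ->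
  cintegrable D F /\ ccvg (fun n => cintegral D (F_ n)) (cintegral D F).
Proof.
move=> mD mF cF ig Fg.
have [h1 h2] : mu.-integrable D (EFin \o (fun x => complex.Re (F x))) /\
    (fun n => \int[mu]_(x in D) complex.Re (F_ n x)) @ \oo -->
    \int[mu]_(x in D) complex.Re (F x).
  apply: (Rintegral_dominated (g := g)) => //.
  - by move=> n; have [] := mF n.
  - by move=> x /cF /ccvg_ReIm[].
  - by move=> n x Dx; rewrite (le_trans (normr_Re_le _)) // Fg.
have [h3 h4] : mu.-integrable D (EFin \o (fun x => complex.Im (F x))) /\
    (fun n => \int[mu]_(x in D) complex.Im (F_ n x)) @ \oo -->
    \int[mu]_(x in D) complex.Im (F x).
  apply: (Rintegral_dominated (g := g)) => //.
  - by move=> n; have [] := mF n.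
  - by move=> x /cF /ccvg_ReIm[].
  - by move=> n x Dx; rewrite (le_trans (normr_Im_le _)) // Fg.
by split => //; apply/ccvg_ReIm.
Qed.

End ComplexIntegral.

(** * Derivatives of real functions *)

Section RealDerivatives.
Context {R : realType}.
Implicit Types (f g : R -> R) (x a b l : R).

(** The derivative is an explicit term, so that the rules of calculus compose by
    plain application and the result is compared with a closed form at the
    end. *)
Definition isd f x a : Prop := is_derive x 1 f a.

Lemma isd_eq f x a b : isd f x a -> a = b -> isd f x b.
Proof. by move=> h <-. Qed.

Lemma isd_cst x l : isd (fun=> l) x 0.
Proof. exact: is_derive_cst. Qed.

Lemma isd_id x : isd (fun y : R => y) x 1.
Proof. exact: is_derive_id. Qed.

Lemma isdD f g x a b : isd f x a -> isd g x b -> isd (fun y => f y + g y) x (a + b).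
Proof. by rewrite /isd => h1 h2; exact: is_deriveD. Qed.

Lemma isdN f x a : isd f x a -> isd (fun y => - f y) x (- a).
Proof. by rewrite /isd => h1; exact: is_deriveN. Qed.

Lemma isdB f g x a b : isd f x a -> isd g x b -> isd (fun y => f y - g y) x (a - b).
Proof. by rewrite /isd => h1 h2; exact: is_deriveB. Qed.

Lemma isdM f g x a b : isd f x a -> isd g x b ->
  isd (fun y => f y * g y) x (a * g x + f x * b).
Proof.
rewrite /isd => h1 h2; apply: (isd_eq (is_deriveM h1 h2)).
by rewrite addrC mulrC.
Qed.

Lemma isdZ f x l a : isd f x a -> isd (fun y => l * f y) x (l * a).
Proof. by move=> h1; apply: isd_eq (isdM (isd_cst x l) h1) _; rewrite mul0r add0r. Qed.

Lemma isd_comp f g x a b : isd f (g x) a -> isd g x b ->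
  isd (fun y => f (g y)) x (a * b).
Proof. exact: is_derive1_comp. Qed.

Lemma isd_expR g x b : isd g x b -> isd (fun y => expR (g y)) x (expR (g x) * b).
Proof. exact: (isd_comp (is_derive_expR _)). Qed.

Lemma isd_cos g x b : isd g x b -> isd (fun y => cos (g y)) x (- sin (g x) * b).
Proof. exact: (isd_comp (is_derive_cos _)). Qed.

Lemma isd_sin g x b : isd g x b -> isd (fun y => sin (g y)) x (cos (g x) * b).
Proof. exact: (isd_comp (is_derive_sin _)). Qed.

Lemma isd_atan g x b : isd g x b ->
  isd (fun y => atan (g y)) x ((1 + g x ^+ 2)^-1 * b).
Proof. exact: (isd_comp (is_derive1_atan _)). Qed.

Lemma isd_ln g x b : 0 < g x -> isd g x b ->
  isd (fun y => ln (g y)) x ((g x)^-1 * b).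
Proof. by move=> g0; apply: (isd_comp (is_derive1_ln g0)). Qed.

Lemma isdV f x a : f x != 0 -> isd f x a ->
  isd (fun y => (f y)^-1) x (- (f x) ^- 2 * a).
Proof. by rewrite /isd => f0 h; apply: (isd_eq (is_deriveV f0 h)). Qed.

Lemma isd_derivable f x a : isd f x a -> derivable f x 1.
Proof. by rewrite /isd => h; exact: ex_derive. Qed.

Lemma isd_cont f x a : isd f x a -> {for x, continuous f}.
Proof.
move=> /isd_derivable h.
by apply: differentiable_continuous; apply/derivable1_diffP.
Qed.

Lemma isd_within f (A : set R) : (forall x, A x -> exists a, isd f x a) ->
  {within A, continuous f}.
Proof.
move=> h; apply: continuous_in_subspaceT => x /set_mem /h[a]; exact: isd_cont.
Qed.

Lemma isd_derive1 f x a : isd f x a -> derive1 f x = a.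
Proof. by rewrite /isd => h; rewrite derive1E; exact: derive_val. Qed.

Lemma isd_ndecr f f' a b : (forall x, a <= x <= b -> isd f x (f' x)) ->
  (forall x, a < x < b -> 0 <= f' x) -> a <= b -> f a <= f b.
Proof.
move=> fd f0 ab; apply: (@ger0_derive1_ndecr _ f a b) => //.
- move=> x; rewrite in_itv /= => /andP[ax xb].
  by apply: (@isd_derivable _ _ (f' x)); apply: fd; rewrite !ltW.
- move=> x; rewrite in_itv /= => /andP[ax xb].
  have h : isd f x (f' x) by apply: fd; rewrite !ltW.
  by rewrite (isd_derive1 h) f0 ?ax.
- apply: isd_within => x /=; rewrite in_itv /= => xab.
  by exists (f' x); exact: fd.
Qed.

End RealDerivatives.

(** * Integration of powers over a half line *)

Section MellinKernelCalculus.
Context {R : realType}.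
Implicit Types (s a : R[i]) (x b c : R).
Notation mu := (@lebesgue_measure R).

Lemma isd_expln (c x : R) : 0 < x ->
  isd (fun y => expR (- (c * ln y))) x (- c * x^-1 * expR (- (c * ln x))).
Proof.
move=> x0; apply: isd_eq.
  by apply: isd_expR; apply: isdN; apply: isdZ; apply: isd_ln; [exact: x0|exact: isd_id].
by rewrite /=; ring.
Qed.

Lemma isd_mpow s x : 0 < x ->
  isd (fun y => complex.Re (mpow s y)) x (complex.Re (- s * mpow (s + 1) x)) /\
  isd (fun y => complex.Im (mpow s y)) x (complex.Im (- s * mpow (s + 1) x)).
Proof.
move=> x0; rewrite mpowD mpow1 // !(cReM, cImM, cReN, cImN, Re_mpow, Im_mpow, cRe_real, cIm_real).
have hl : isd (fun y => complex.Im s * ln y) x (complex.Im s * x^-1).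
  by apply: isdZ; exact: is_derive1_ln.
split.
  under eq_fun do rewrite Re_mpow.
  apply: isd_eq.
    by apply: isdM; [exact: isd_expln|exact: isd_cos hl].
  by rewrite /=; ring.
under eq_fun do rewrite Im_mpow.
apply: isd_eq.
  apply: isdN.
  by apply: isdM; [exact: isd_expln|exact: isd_sin hl].
by rewrite /=; ring.
Qed.

Lemma isd_Zmpow a s x : 0 < x ->
  isd (fun y => complex.Re (a * mpow s y)) x
    (complex.Re (a * (- s * mpow (s + 1) x))) /\
  isd (fun y => complex.Im (a * mpow s y)) x
    (complex.Im (a * (- s * mpow (s + 1) x))).
Proof.
move=> x0; have [h1 h2] := isd_mpow s x0; split.
  under eq_fun do rewrite cReM; rewrite [in X in isd _ _ X]cReM.
  by apply: isdB; exact: isdZ.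
under eq_fun do rewrite cImM; rewrite [in X in isd _ _ X]cImM.
by apply: isdD; exact: isdZ.
Qed.

Lemma cmeas_mpowx D s : cmeas D (mpow s).
Proof. by apply: cmeas_mpow => //; exact: cmeas_cst. Qed.

(** The comparison function used for every integral over the half line: it has
    the decay of x^(-c) at infinity and, unlike it, no singularity at 0. *)
Definition tame c (x : R) := expR (- (c * ln (1 + x))).

Lemma tame_gt0 c x : 0 < tame c x. Proof. exact: expR_gt0. Qed.

Lemma measurable_tame c (D : set R) : measurable_fun D (tame c).
Proof.
apply: (measurableT_comp (@measurable_expR R)); apply: measurable_funN.
apply: measurable_funM => //; apply: (measurableT_comp (@measurable_ln R)).
exact: measurable_funD.
Qed.

Lemma cvg_tame0 c : 0 < c -> tame c x @[x --> +oo] --> (0 : R).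
Proof.
move=> c0; apply/cvgrPdist_lt => e e0.
near=> x.
have hx : expR (- (ln e / c)) < 1 + x.
  by rewrite -ltrBlDl; near: x; exact: nbhs_pinfty_gt.
have x0 : 0 < 1 + x by apply: lt_trans hx; exact: expR_gt0.
rewrite sub0r normrN ger0_norm ?expR_ge0 //.
rewrite -[X in _ < X]lnK ?posrE // ltr_expR ltrNl mulrC -ltr_pdivrMr //.
by rewrite mulNr -(expRK (- (ln e / c))) ltr_ln ?posrE ?expR_gt0.
Unshelve. all: by end_near. Qed.

Lemma isd_tame c x : -1 < x ->
  isd (tame c) x (- c * (1 + x)^-1 * tame c x).
Proof.
move=> x1; have x0 : 0 < 1 + x by lra.
apply: isd_eq.
  apply: (isd_comp (f := fun y => expR (- (c * ln y))) (isd_expln c x0)).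
  by apply: isdD; [exact: isd_cst|exact: isd_id].
by rewrite add0r mulr1.
Qed.

Lemma tame_shift c x : -1 < x -> tame (c + 1) x = (1 + x)^-1 * tame c x.
Proof.
move=> x1; have x0 : 0 < 1 + x by lra.
rewrite /tame mulrDl mul1r opprD expRD [X in _ * X]expRN lnK ?posrE //.
by rewrite mulrC.
Qed.

Lemma integrable_tame c : 1 < c -> mu.-integrable `[0, +oo[ (EFin \o tame c).
Proof.
move=> c1; have c0 : 0 < c - 1 by lra.
have d0 x : -1 < x ->
    isd (fun y => - (c - 1)^-1 * tame (c - 1) y) x (tame c x).
  move=> x1; apply: isd_eq; first by apply: isdZ; exact: isd_tame.
  rewrite -[in RHS](subrK 1 c) tame_shift // mulrA mulrA mulrNN mulVf ?gt_eqF //.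
  by rewrite mul1r.
apply/integrableP; split; first by apply/measurable_EFinP; exact: measurable_tame.
under eq_integral do rewrite /= ger0_norm ?(ltW (tame_gt0 _ _)) //.
rewrite (@ge0_continuous_FTC2y _ _ (fun y => - (c - 1)^-1 * tame (c - 1) y) 0 0).
- by rewrite ltry.
- by move=> x _; exact: ltW (tame_gt0 _ _).
- apply: isd_within => x /=; rewrite in_itv /= andbT => x0.
  by exists (- c * (1 + x)^-1 * tame c x); apply: isd_tame; lra.
- rewrite -(mulr0 (- (c - 1)^-1)); apply: cvgMl_tmp.
  exact: cvg_tame0.
- by move=> x x0; apply: isd_derivable; apply: d0; lra.
- by apply: cvg_at_right_filter; apply: (isd_cont (d0 0 _)); lra.
- move=> x; rewrite in_itv /= andbT => x0.
  by rewrite (isd_derive1 (d0 _ _)) //; lra.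
Qed.

(** Away from 0 the ratio x / (1 + x) is bounded below. *)
Lemma expln_le_tame (b : R) c x : 0 < b -> 0 <= c -> b <= x ->
  expR (- (c * ln x)) <= expR (c * ln (1 + b^-1)) * tame c x.
Proof.
move=> b0 c0 bx; have x0 : 0 < x by apply: lt_le_trans bx.
have b1 : 0 < 1 + b^-1 by rewrite addr_gt0 ?invr_gt0.
rewrite /tame -expRD ler_expR -mulrN -mulrN -mulrDr ler_wpM2l //.
rewrite -lnV ?posrE // -lnV ?posrE; last by lra.
rewrite -lnM ?posrE ?invr_gt0 //; last by lra.
rewrite ler_ln ?posrE ?mulr_gt0 ?invr_gt0 //; try by lra.
rewrite ler_pdivlMr; last by lra.
rewrite mulrDr mulr1 mulVf ?gt_eqF // [leRHS]addrC lerD2r lef_pV2 ?posrE //.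
Qed.

Lemma Rintegral_isd (F f : R -> R) (a b : R) : a < b ->
  (forall x, a <= x <= b -> isd F x (f x)) ->
  {within `[a, b], continuous f} ->
  \int[mu]_(x in `[a, b]) f x = F b - F a.
Proof.
move=> ab Ff cf; rewrite /Rintegral (@continuous_FTC2 _ f F) //.
  split.
  - by move=> x; rewrite in_itv /= => /andP[ax xb]; apply: isd_derivable;
      apply: Ff; rewrite !ltW.
  - by apply: cvg_at_right_filter; apply: (isd_cont (Ff a _)); rewrite lexx ltW.
  - by apply: cvg_at_left_filter; apply: (isd_cont (Ff b _)); rewrite lexx ltW.
move=> x; rewrite in_itv /= => /andP[ax xb]; apply: isd_derive1.
by apply: Ff; rewrite !ltW.
Qed.

Lemma mpow_segment s b e : s != 0 -> 0 < b -> b < e ->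
  cintegral `[b, e] (mpow (s + 1)) = s^-1 * mpow s b - s^-1 * mpow s e.
Proof.
move=> s0 b0 be.
have pos x : b <= x <= e -> 0 < x by move=> /andP[bx _]; exact: lt_le_trans bx.
have E x : mpow (s + 1) x = - s^-1 * (- s * mpow (s + 1) x).
  by rewrite mulrA mulrNN mulVf // mul1r.
have -> : s^-1 * mpow s b - s^-1 * mpow s e =
    (- s^-1 * mpow s e) - (- s^-1 * mpow s b).
  by rewrite !mulNr opprK addrC.
have F x : b <= x <= e -> _ := fun h => isd_Zmpow (- s^-1) s (pos x h).
have C x : `[b, e]%classic x -> _ := fun h => isd_mpow (s + 1) (pos x h).
apply: complex_ext; rewrite !(cReD, cReN, cImD, cImN) /cintegral.
  apply: (@Rintegral_isd (fun x => complex.Re (- s^-1 * mpow s x))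
    (fun x => complex.Re (mpow (s + 1) x))) => // [x bxe|].
    by have [h _] := F x bxe; rewrite E.
  by apply: isd_within => x /C[h _]; eexists; exact: h.
apply: (@Rintegral_isd (fun x => complex.Im (- s^-1 * mpow s x))
  (fun x => complex.Im (mpow (s + 1) x))) => // [x bxe|].
  by have [_ h] := F x bxe; rewrite E.
by apply: isd_within => x /C[_ h]; eexists; exact: h.
Qed.

Lemma ray_ge b x : `[b, +oo[%classic x -> b <= x.
Proof. by rewrite /= in_itv /= andbT. Qed.

Lemma Rpos_gt0 x : `]0, +oo[%classic x -> 0 < x.
Proof. by rewrite /= in_itv /= andbT. Qed.

Lemma mpow_half_line s b : 0 < complex.Re s -> 0 < b ->
  cintegrable `[b, +oo[ (mpow (s + 1)) /\
  cintegral `[b, +oo[ (mpow (s + 1)) = mpow s b / s.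
Proof.
move=> s0 b0.
have s_neq0 : s != 0 by apply: contraTneq s0 => ->; rewrite ltxx.
pose c := complex.Re s + 1.
pose g x := expR (c * ln (1 + b^-1)) * tame c x.
have ig : mu.-integrable `[b, +oo[ (EFin \o g).
  have h : mu.-integrable `[b, +oo[ (EFin \o tame c).
    apply: (integrableS _ _ _ (integrable_tame _)) => //; last by rewrite /c; lra.
    by apply: subset_itvr; rewrite bnd_simp ltW.
  exact: (integrableZl (mu := mu) _ _ h).
have Fg x : `[b, +oo[%classic x -> cabs (mpow (s + 1) x) <= g x.
  move=> /ray_ge bx; rewrite cabs_mpow cReD.
  by apply: expln_le_tame => //; rewrite /= addr_ge0 // ltW.
pose I n : set R := `[b, b + n.+1%:R]%classic.
have ID n : I n `<=` `[b, +oo[%classic.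
  by move=> x; rewrite /I /= !in_itv /= andbT => /andP[].
pose F_ (n : nat) x := (\1_(I n) x)%:C * mpow (s + 1) x.
have b_oo : (fun n => b + n.+1%:R) @ \oo --> +oo%R.
  apply/cvgryPge => A; near=> n; rewrite -lerBlDl.
  apply: (@le_trans _ _ n%:R); last by rewrite ler_nat.
  by near: n; exact: nbhs_infty_ger.
have [h1 h2] : cintegrable `[b, +oo[ (mpow (s + 1)) /\
    ccvg (fun n => cintegral `[b, +oo[ (F_ n)) (cintegral `[b, +oo[ (mpow (s + 1))).
  apply: (cintegral_dominated (g := g)) => //.
  - by move=> n; apply: cmeas_indic; [exact: measurable_itv|exact: cmeas_mpowx].
  - move=> x /ray_ge bx; have [N _ hN] := nbhs_infty_ger (x - b).
    apply: (eq_ccvg N (fun=> mpow (s + 1) x)); last exact: ccvg_cst.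
    move=> n /hN xbn; rewrite /F_ indicE mem_set ?mul1r // /I /= in_itv /= bx /=.
    by rewrite -lerBlDl (le_trans xbn) // ler_nat.
  - by move=> n x Dx; rewrite (le_trans (cabs_indic_le _ _ _)) // Fg.
split => //; apply: ccvg_unique h2 _.
have -> : (fun n => cintegral `[b, +oo[ (F_ n)) =
    (fun n => s^-1 * mpow s b + - s^-1 * mpow s (b + n.+1%:R)).
  apply/funext => n; rewrite mulNr -mpow_segment //; last by rewrite ltrDl.
  exact: cintegral_indic.
rewrite mulrC -[X in ccvg _ X]addr0 -(mulr0 (- s^-1)).
apply: ccvgD; first exact: ccvg_cst.
apply: ccvgM; first exact: ccvg_cst.
apply: (ccvg_squeeze (e := fun n => expR (complex.Re s * ln (1 + b^-1)) * tame (complex.Re s) (b + n.+1%:R))).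
  move=> n; rewrite subr0 cabs_mpow; apply: expln_le_tame => //; first exact: ltW.
  by rewrite lerDl.
rewrite -(mulr0 (expR (complex.Re s * ln (1 + b^-1)))).
apply: cvgMl_tmp.
exact: cvg_comp b_oo (cvg_tame0 s0).
Unshelve. all: by end_near. Qed.

End MellinKernelCalculus.

(** * Euler's integral and limit formula for Gamma *)

Section GammaFunction.
Context {R : realType}.
Implicit Types (s : R[i]) (a b c x u : R).
Notation mu := (@lebesgue_measure R).

Definition rising n s : R[i] := \prod_(i < n) (s + i%:R).

Lemma rising_recr n s : rising n.+1 s = rising n s * (s + n%:R).
Proof. by rewrite /rising big_ord_recr. Qed.

Lemma rising_recl n s : rising n.+1 s = s * rising n (s + 1).
Proof.
rewrite /rising big_ord_recl addr0; congr (_ * _).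
by apply: eq_bigr => i _; rewrite /bump /= natrD addrA.
Qed.

Lemma Re_gt0_neq0 s : 0 < complex.Re s -> s != 0.
Proof. by move=> s0; apply: contraTneq s0 => ->; rewrite ltxx. Qed.

Lemma rising_neq0 n s : 0 < complex.Re s -> rising n s != 0.
Proof.
move=> s0; apply/prodf_neq0 => i _; apply: Re_gt0_neq0.
by rewrite cReD cRe_natr ltr_wpDr.
Qed.

(** The Beta integral, rescaled to a half line. The recursion on the exponent
    is the expansion of one factor 1 - b / u, so no integration by parts is
    involved. *)
Lemma beta_half_line n s b : 0 < complex.Re s -> 0 < b ->
  cintegrable `[b, +oo[ (fun u => ((1 - b / u) ^+ n)%:C * mpow (s + 1) u) /\
  cintegral `[b, +oo[ (fun u => ((1 - b / u) ^+ n)%:C * mpow (s + 1) u) =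
    mpow s b * n`!%:R / rising n.+1 s.
Proof.
move=> + b0; elim: n s => [|n ih] s s0.
  have [h1 h2] := mpow_half_line s0 b0.
  rewrite rising_recr /rising big_ord0 mul1r addr0 fact0 mulr1 -h2; split.
    by apply: eq_cintegrable h1 => // u _; rewrite expr0 mul1r.
  by apply: eq_cintegral => u _; rewrite expr0 mul1r.
have s10 : 0 < complex.Re (s + 1) by rewrite cReD /= addr_gt0.
have [h1 h2] := ih _ s0; have [h3 h4] := ih _ s10.
have E u : `[b, +oo[%classic u ->
    ((1 - b / u) ^+ n)%:C * mpow (s + 1) u +
      - b%:C * (((1 - b / u) ^+ n)%:C * mpow (s + 1 + 1) u) =
    ((1 - b / u) ^+ n.+1)%:C * mpow (s + 1) u.
  move=> /ray_ge bu; have u0 : 0 < u by apply: lt_le_trans bu.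
  rewrite [mpow (s + 1 + 1) u]mpowD mpow1 // exprS rmorphM rmorphB rmorphM /=.
  by rewrite rmorph1; ring.
have h5 : cintegrable `[b, +oo[ (fun u =>
    - b%:C * (((1 - b / u) ^+ n)%:C * mpow (s + 1 + 1) u)).
  exact: cintegrableZ.
split.
  by apply: eq_cintegrable E _ => //; exact: cintegrableD.
rewrite -(eq_cintegral E) cintegralD // cintegralZ // h2 h4.
rewrite mpowD mpow1 //.
have r1 : s + n.+1%:R != 0.
  by apply: Re_gt0_neq0; rewrite cReD cRe_natr ltr_wpDr.
have sn0 := Re_gt0_neq0 s0.
have e1 := rising_recl n.+1 s; have e2 := rising_recr n.+1 s.
have r2 := rising_neq0 n.+1 s0;
have r4 : b%:C != 0 :> R[i] by rewrite (fmorph_eq0 (real_complex R)) gt_eqF.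
have e3 : rising n.+1 (s + 1) = rising n.+1 s * (s + n.+1%:R) / s.
  by rewrite -e2 e1 mulrC mulKf.
rewrite e2 e3 factS natrM fmorphV /=.
move: r1; move: (n.+1%:R : R[i]) => m r1.
by field; rewrite r1 r2 r4 sn0.
Qed.

Lemma bernoulli_ineq (z : R) n : 0 <= z <= 1 -> 1 - n%:R * z <= (1 - z) ^+ n.
Proof.
move=> /andP[z0 z1]; elim: n => [|n ih]; first by rewrite mul0r subr0 expr0.
rewrite exprS; apply: (le_trans _ (ler_wpM2l _ ih)); last by lra.
rewrite -subr_ge0 -natr1.
have -> : (1 - z) * (1 - n%:R * z) - (1 - (n%:R + 1) * z) = n%:R * z ^+ 2 by ring.
by rewrite mulr_ge0 // sqr_ge0.
Qed.

Lemma exp_approx_le (y : R) n : 0 <= y <= n.+1%:R ->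
  (1 - y / n.+1%:R) ^+ n.+1 <= expR (- y).
Proof.
move=> /andP[y0 yn].
have -> : - y = n.+1%:R * (- (y / n.+1%:R)).
  by rewrite mulrN mulrC divfK.
rewrite expRM_natl; apply: lerXn2r; rewrite ?nnegrE ?expR_ge0 //.
  by rewrite subr_ge0 ler_pdivrMr // mul1r.
exact: expR_ge1Dx.
Qed.

Lemma exp_approx_ge (y : R) n : 0 <= y <= n.+1%:R ->
  expR (- y) * (1 - y ^+ 2 / n.+1%:R) <= (1 - y / n.+1%:R) ^+ n.+1.
Proof.
move=> /andP[y0 yn]; set z := y / n.+1%:R.
have z0 : 0 <= z by rewrite divr_ge0.
have z1 : z <= 1 by rewrite ler_pdivrMr // mul1r.
have yE : y = n.+1%:R * z by rewrite mulrC divfK.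
have -> : - y = n.+1%:R * (- z) by rewrite yE mulrN.
have -> : y ^+ 2 / n.+1%:R = n.+1%:R * z ^+ 2.
  have : (n.+1%:R : R) != 0 by rewrite pnatr_eq0.
  by rewrite /z; move: (n.+1%:R : R) => m m0; field.
rewrite expRM_natl.
apply: (le_trans (y := expR (- z) ^+ n.+1 * (1 - z ^+ 2) ^+ n.+1)).
  rewrite ler_wpM2l ?exprn_ge0 ?expR_ge0 // bernoulli_ineq // sqr_ge0 /=.
  by rewrite expr_le1.
rewrite -exprMn; apply: lerXn2r; rewrite ?nnegrE.
- by rewrite mulr_ge0 ?expR_ge0 // subr_ge0 expr_le1.
- by rewrite subr_ge0.
rewrite expRN mulrC ler_pdivrMr ?expR_gt0 //.
have -> : 1 - z ^+ 2 = (1 - z) * (1 + z) by ring.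
by rewrite ler_wpM2l ?subr_ge0 // expR_ge1Dx.
Qed.

Lemma cvg_divS (a : R) : (fun n => a / n.+1%:R) @ \oo --> (0 : R).
Proof.
by rewrite -(mulr0 a); apply: cvgMl_tmp; exact: cvg_harmonic.
Qed.

Lemma cvg_exp_approx (y : R) : 0 <= y ->
  (fun n => (1 - y / n.+1%:R) ^+ n.+1) @ \oo --> expR (- y).
Proof.
move=> y0; have [N _ hN] := nbhs_infty_ger y.
have h n : (N <= n)%N -> 0 <= y <= n.+1%:R.
  by move=> /hN /= yn; rewrite y0 (le_trans yn) // ler_nat.
apply: (@squeeze_cvgr _ _ _ _ (fun n => expR (- y) * (1 - y ^+ 2 / n.+1%:R))
   (fun=> expR (- y))).
- by exists N => // n /h hn; rewrite exp_approx_ge // exp_approx_le.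
- rewrite -[X in _ --> X]mulr1 -[X in _ * X]subr0; apply: cvgMl_tmp.
  by apply: cvgB; [exact: cvg_cst|exact: cvg_divS].
- exact: cvg_cst.
Qed.

Definition lambert_kernel x u := (u * (expR (x / u) - 1))^-1.

Lemma lambert_kernel_gt0 x u : 0 < x -> 0 < u -> 0 < lambert_kernel x u.
Proof.
by move=> x0 u0; rewrite invr_gt0 mulr_gt0 // subr_gt0 expR_gt1 divr_gt0.
Qed.

Lemma exp_kernel_le a u : 0 < a -> 0 < u ->
  u^-1 * expR (- (a / u)) <= lambert_kernel a u.
Proof.
move=> a0 u0; rewrite /lambert_kernel invfM.
rewrite ler_wpM2l ?invr_ge0 ?(ltW u0) // expRN.
rewrite lef_pV2 ?posrE ?expR_gt0 ?gerBl //.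
by rewrite subr_gt0 expR_gt1 divr_gt0.
Qed.

Lemma measurable_lambert_kernel x (D : set R) : measurable_fun D (lambert_kernel x).
Proof.
apply: measurable_funV; apply: measurable_funM => //.
apply: measurable_funB => //; apply: (measurableT_comp (@measurable_expR R)).
by apply: measurable_funM => //; exact: measurable_funV.
Qed.

Lemma measurable_expln c (D : set R) :
  measurable_fun D (fun u => expR (- (c * ln u))).
Proof.
apply: (measurableT_comp (@measurable_expR R)); apply: measurable_funN.
apply: measurable_funM => //; apply: measurable_funS (@measurable_ln R) => //.
Qed.

(** Near 0 the kernel beats every power: half of the exponential absorbs
    (1 + 1/u)^c, the other half is bounded below by its linear term. *)
Lemma lambert_kernel_tame c x : 0 < c -> 0 < x -> exists C, forall u, 0 < u ->
  expR (- (c * ln u)) * lambert_kernel x u <= C * tame c u.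
Proof.
(* K is such that c / K is x / 2, half of the rate of the exponential. *)
move=> c0 x0; pose K := 2 * c / x.
have K0 : 0 < K by rewrite !mulr_gt0 // invr_gt0.
exists (expR (c * (K^-1 - 1 + ln K)) * (2 / x)) => u u0.
set v := u^-1; have v0 : 0 < v by rewrite invr_gt0.
have lnb : ln (1 + v) <= v / K + (K^-1 - 1 + ln K).
  have v1 : 0 < (1 + v) / K by rewrite divr_gt0 // addr_gt0.
  have -> : 1 + v = ((1 + v) / K) * K by rewrite divfK ?gt_eqF.
  rewrite lnM ?posrE // addrA lerD2r.
  have := @le_ln1Dx R ((1 + v) / K - 1).
  rewrite (addrC 1 (_ - 1)) subrK => h.
  by apply: (le_trans (h _)); [lra|rewrite mulrDl mul1r; lra].
have -> : expR (- (c * ln u)) = expR (c * ln (1 + v)) * tame c u.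
  rewrite /tame -expRD; congr expR.
  have -> : 1 + u = (1 + v) * u by rewrite mulrDl mul1r mulVf ?gt_eqF // addrC.
  by rewrite lnM ?posrE ?addr_gt0 //; ring.
rewrite mulrAC ler_wpM2r ?(ltW (tame_gt0 _ _)) //.
pose w := x * v / 2.
have w0 : 0 < w by rewrite !mulr_gt0 // invr_gt0.
have h1 : expR (c * ln (1 + v)) <= expR (c * (K^-1 - 1 + ln K)) * expR w.
  rewrite -expRD ler_expR.
  have -> : c * (K^-1 - 1 + ln K) + w = c * (v / K + (K^-1 - 1 + ln K)).
    by rewrite /w /K; field; rewrite !gt_eqF.
  by rewrite ler_wpM2l // ltW.
have h2 : expR w * lambert_kernel x u <= 2 / x.
  rewrite /lambert_kernel ler_pdivrMr; last first.
    by rewrite mulr_gt0 // subr_gt0 expR_gt1 divr_gt0.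
  have -> : x / u = w + w by rewrite /w -/v; field.
  have -> : 2 / x * (u * (expR (w + w) - 1)) = w^-1 * (expR (w + w) - 1).
    by rewrite /w /v; field; rewrite !gt_eqF.
  rewrite ler_pdivlMl //.
  have -> : expR (w + w) - 1 = (expR w - 1) * (expR w + 1) by rewrite expRD; ring.
  have hw := expR_ge1Dx w.
  by apply: ler_pM; lra.
apply: le_trans (_ : expR (c * (K^-1 - 1 + ln K)) * expR w * lambert_kernel x u <= _).
  by rewrite ler_wpM2r // ltW // lambert_kernel_gt0.
by rewrite -mulrA ler_wpM2l ?expR_ge0.
Qed.

Lemma Rpos_ray : `]0, +oo[%classic `<=` (`[0, +oo[%classic : set R).
Proof. by apply: subset_itvr; rewrite bnd_simp. Qed.

Lemma integrable_lambert_kernel c x : 1 < c -> 0 < x ->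
  mu.-integrable `]0, +oo[ (EFin \o (fun u => expR (- (c * ln u)) * lambert_kernel x u)).
Proof.
move=> c1 x0; have [|C hC] := @lambert_kernel_tame c x _ x0; first by lra.
have h : mu.-integrable `]0, +oo[ (EFin \o tame c).
  by apply: (integrableS _ _ _ (integrable_tame c1)) => //; exact: Rpos_ray.
apply: le_integrable (integrableZl (mu := mu) _ C h) => //.
  apply/measurable_EFinP; apply: measurable_funM.
    exact: measurable_expln.
  exact: measurable_lambert_kernel.
move=> u /Rpos_gt0 u0 /=; rewrite lee_fin ger0_norm.
  by rewrite (le_trans (hC _ u0)) // ler_norm.
by rewrite mulr_ge0 ?expR_ge0 // ltW // lambert_kernel_gt0.
Qed.

(** Euler's approximants n^s n! / (s (s + 1) ... (s + n)) of Gamma. *)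
Definition Gamma_approx n s : R[i] := mpow (- s) n%:R * n`!%:R / rising n.+1 s.

(** Euler's integral, after the substitution of 1/u for the variable. *)
Definition Gammac s : R[i] :=
  cintegral `]0, +oo[ (fun u => (u^-1 * expR (- u^-1))%:C * mpow s u).

(** Euler's limit formula. Both conclusions come from the same dominated limit
    of Beta integrals; the case a = 1 identifies the limit. *)
Lemma mellin_exp_Gamma s : 1 < complex.Re s ->
  ccvg (Gamma_approx ^~ s) (Gammac s) /\
  (forall a, 0 < a ->
    cintegrable `]0, +oo[ (fun u => (u^-1 * expR (- (a / u)))%:C * mpow s u) /\
    cintegral `]0, +oo[ (fun u => (u^-1 * expR (- (a / u)))%:C * mpow s u) =
      mpow s a * Gammac s).
Proof.
move=> s1; have s0 : 0 < complex.Re s by lra.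
have lim a : 0 < a ->
    cintegrable `]0, +oo[ (fun u => (u^-1 * expR (- (a / u)))%:C * mpow s u) /\
    ccvg (fun n => mpow s a * Gamma_approx n s)
      (cintegral `]0, +oo[ (fun u => (u^-1 * expR (- (a / u)))%:C * mpow s u)).
  move=> a0; pose b n := a / n.+1%:R.
  have b0 n : 0 < b n by rewrite divr_gt0.
  pose I n : set R := `[b n, +oo[%classic.
  have IR n : I n `<=` `]0, +oo[%classic.
    by apply: subset_itvr; rewrite bnd_simp.
  pose F_ n u := (\1_(I n) u)%:C * (((1 - b n / u) ^+ n.+1)%:C * mpow (s + 1) u).
  have E n : cintegral `]0, +oo[ (F_ n) = mpow s a * Gamma_approx n.+1 s.
    rewrite cintegral_indic //; have [_ ->] := beta_half_line n.+1 s0 (b0 n).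
    by rewrite /Gamma_approx /b mpowM ?invr_gt0 // mpow_inv // !mulrA.
  have [h1 h2] : cintegrable `]0, +oo[ (fun u => (u^-1 * expR (- (a / u)))%:C * mpow s u) /\
      ccvg (fun n => cintegral `]0, +oo[ (F_ n))
      (cintegral `]0, +oo[ (fun u => (u^-1 * expR (- (a / u)))%:C * mpow s u)).
    apply: (cintegral_dominated (g := fun u => expR (- (complex.Re s * ln u)) * lambert_kernel a u)) => //.
    - move=> n; apply: cmeas_indic; first exact: measurable_itv.
      apply: cmeasM; last exact: cmeas_mpowx.
      apply: cmeas_real; apply: measurable_funX; apply: measurable_funB => //.
      by apply: measurable_funM => //; exact: measurable_funV.
    - move=> u /Rpos_gt0 u0.
      have -> : (u^-1 * expR (- (a / u)))%:C * mpow s u = (expR (- (a / u)))%:C * mpow (s + 1) u.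
        by rewrite mpowD mpow1 // rmorphM /=; ring.
      have [N _ hN] := nbhs_infty_ger (a / u).
      apply: (eq_ccvg N (fun n => ((1 - (a / u) / n.+1%:R) ^+ n.+1)%:C * mpow (s + 1) u)).
        move=> n /hN aun; rewrite /F_ indicE mem_set ?mul1r.
          by rewrite /b mulrAC.
        rewrite /I /= in_itv /= andbT /b ler_pdivrMr // mulrC -ler_pdivrMr //.
        by rewrite (le_trans aun) // ler_nat.
      apply: ccvgM; last exact: ccvg_cst.
      by apply: ccvg_real; apply: cvg_exp_approx; rewrite divr_ge0 // ltW.
    - exact: integrable_lambert_kernel.
    - move=> n u /Rpos_gt0 u0; rewrite /F_ indicE.
      case: (boolP (u \in I n)) => [/set_mem /ray_ge bu|_]; last first.
        by rewrite mul0r cabs0 mulr_ge0 ?expR_ge0 // ltW // lambert_kernel_gt0.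
      have au : a / u <= n.+1%:R.
        by move: bu; rewrite /b ler_pdivrMr // mulrC -ler_pdivrMr.
      rewrite mul1r cabsM cabs_real mpowD cabsM mpow1 // cabs_real.
      rewrite cabs_mpow mulrCA ler_wpM2l ?expR_ge0 //.
      apply: le_trans (exp_kernel_le a0 u0); rewrite mulrC.
      rewrite [`|u^-1|]ger0_norm ?invr_ge0 ?(ltW u0) //.
      rewrite ler_wpM2l ?invr_ge0 ?(ltW u0) // /b [a / _ / _]mulrAC ger0_norm.
        by apply: exp_approx_le; rewrite au divr_ge0 // ltW.
      by rewrite exprn_ge0 // subr_ge0 ler_pdivrMr // mul1r.
  split => //; apply/(ccvg_shift 1).
  have -> : (fun n => mpow s a * Gamma_approx (n + 1)%N s) = (fun n => cintegral `]0, +oo[ (F_ n)).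
    by apply/funext => n; rewrite E addn1.
  exact: h2.
have GE : Gammac s = cintegral `]0, +oo[ (fun u => (u^-1 * expR (- (1 / u)))%:C * mpow s u).
  by apply: eq_cintegral => u _; rewrite div1r.
have G1 : ccvg (Gamma_approx ^~ s) (Gammac s).
  have [_] := lim 1 ltr01; rewrite -GE.
  by apply: (eq_ccvg 0%N _) => n _; rewrite mpow1x mul1r.
split; first exact: G1.
move=> a a0; have [h1 h2] := lim a a0; split; first exact: h1.
have h3 := ccvgZ (mpow s a) G1.
exact: (ccvg_unique h2 h3).
Qed.

End GammaFunction.

(** * Convexity estimates *)

Section Stirling.
Context {R : realType}.
Implicit Types (s : R[i]) (t x y u c : R).

(** Twice the logarithm of the modulus of 1 + i t / y, that is, of the ratio by
    which a factor of the Gamma product grows off the real axis. *)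
Definition hlog t y : R := ln (1 + (t / y) ^+ 2).

(** The integral of hlog t over the half line starting at y. *)
Definition htail t y : R := 2 * (t * atan (t / y)) - y * hlog t y.

Lemma oneDsq_gt0 t y : 0 < 1 + (t / y) ^+ 2.
Proof. by rewrite ltr_pwDl // sqr_ge0. Qed.

Lemma hlog_ge0 t y : 0 <= hlog t y.
Proof. by rewrite ln_ge0 // lerDl sqr_ge0. Qed.

Lemma isd_divl t y : 0 < y -> isd (fun x => t / x) y (- t / y ^+ 2).
Proof.
move=> y0; apply: isd_eq.
  by apply: isdZ; apply: isdV; [rewrite gt_eqF|exact: isd_id].
by rewrite /=; field; rewrite gt_eqF.
Qed.

Lemma isd_hlog t y : 0 < y ->
  isd (hlog t) y (- (2 * t ^+ 2) / (y * (y ^+ 2 + t ^+ 2))).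
Proof.
move=> y0; apply: isd_eq.
  apply: isd_ln; first exact: oneDsq_gt0.
  apply: isdD; first exact: isd_cst.
  exact: (isdM (isd_divl t y0) (isd_divl t y0)).
have d0 : y ^+ 2 + t ^+ 2 != 0 by rewrite gt_eqF // ltr_pwDl ?exprn_gt0 ?sqr_ge0.
by rewrite /=; field; rewrite d0 gt_eqF.
Qed.

Lemma isd_htail t y : 0 < y -> isd (htail t) y (- hlog t y).
Proof.
move=> y0; apply: isd_eq.
  apply: isdB.
    by apply: isdZ; apply: isdZ; apply: isd_atan; exact: isd_divl.
  exact: (isdM (isd_id y) (isd_hlog t y0)).
have d0 : y ^+ 2 + t ^+ 2 != 0 by rewrite gt_eqF // ltr_pwDl ?exprn_gt0 ?sqr_ge0.
by rewrite /=; field; rewrite d0 gt_eqF.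
Qed.

(** Exponentiated, both sides are polynomials in t ^+ 2, which compare
    coefficientwise. *)
Lemma hlog_midconvex t y u : 0 <= u < y ->
  2 * hlog t y <= hlog t (y - u) + hlog t (y + u).
Proof.
move=> /andP[u0 uy]; have y0 : 0 < y by apply: le_lt_trans uy.
have a0 : 0 < y - u by lra. have b0 : 0 < y + u by lra.
rewrite mulr_natl -lnXn ?oneDsq_gt0 // -lnM ?posrE ?oneDsq_gt0 //.
rewrite ler_ln ?posrE ?mulr_gt0 ?exprn_gt0 ?oneDsq_gt0 //.
rewrite !expr_div_n.
have p0 : 0 < y ^+ 2 - u ^+ 2 by rewrite subr_sqr mulr_gt0.
have p1 : 0 < y ^+ 2 by rewrite exprn_gt0.
have p2 : y ^+ 2 - u ^+ 2 <= y ^+ 2 by rewrite gerBl sqr_ge0.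
have -> : (1 + t ^+ 2 / (y - u) ^+ 2) * (1 + t ^+ 2 / (y + u) ^+ 2) =
   1 + t ^+ 2 * (2 * (y ^+ 2 + u ^+ 2)) / (y ^+ 2 - u ^+ 2) ^+ 2 +
   (t ^+ 2) ^+ 2 / (y ^+ 2 - u ^+ 2) ^+ 2.
  have -> : y ^+ 2 - u ^+ 2 = (y - u) * (y + u) by rewrite subr_sqr.
  by field; rewrite !gt_eqF.
have i2 : (y ^+ 2) ^- 2 <= (y ^+ 2 - u ^+ 2) ^- 2.
  by rewrite lef_pV2 ?posrE ?exprn_gt0 // lerXn2r ?nnegrE // ltW.
have -> : (1 + t ^+ 2 / y ^+ 2) ^+ 2 =
   1 + t ^+ 2 * (2 * y ^+ 2) / (y ^+ 2) ^+ 2 + (t ^+ 2) ^+ 2 / (y ^+ 2) ^+ 2.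
  by field; rewrite gt_eqF.
apply: lerD; last by rewrite ler_wpM2l // sqr_ge0.
rewrite lerD2l; apply: ler_pM => //.
- by rewrite mulr_ge0 ?sqr_ge0 // mulr_ge0 ?sqr_ge0.
- by rewrite invr_ge0 exprn_ge0 // sqr_ge0.
- by rewrite ler_wpM2l ?sqr_ge0 // ler_wpM2l // lerDl sqr_ge0.
Qed.

(** Midpoint and trapezoid comparisons between a convex function and its
    integral over a unit interval; differentiating in the half length turns
    them into convexity of hlog and monotonicity of its derivative. *)
Lemma hlog_le_midpoint t y : 2^-1 < y ->
  hlog t y <= htail t (y - 2^-1) - htail t (y + 2^-1).
Proof.
move=> y2; have y0 : 0 < y by apply: lt_trans y2; rewrite invr_gt0.
pose D u := htail t (y - u) - htail t (y + u) - (2 * hlog t y) * u.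
pose D' u := hlog t (y - u) + hlog t (y + u) - 2 * hlog t y.
have h : D 0 <= D 2^-1.
  apply: (@isd_ndecr _ D D') => [u /andP[u0 u1]|u /andP[u0 u1]|]; last 1 first.
  - by rewrite invr_ge0.
  - apply: isd_eq.
      apply: isdB.
        apply: isdB.
          apply: (isd_comp (f := htail t) (g := fun u => y - u)).
            by apply: isd_htail; lra.
          by apply: isdB; [exact: isd_cst|exact: isd_id].
        apply: (isd_comp (f := htail t) (g := fun u => y + u)).
          by apply: isd_htail; lra.
        by apply: isdD; [exact: isd_cst|exact: isd_id].
      by apply: isdZ; exact: isd_id.
    by rewrite /D'; ring.
  - by rewrite subr_ge0 hlog_midconvex //; lra.
move: h; rewrite /D subr0 addr0 subrr mulr0 subr0 subr_ge0.
by have -> : 2 * hlog t y * 2^-1 = hlog t y by field.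
Qed.

Lemma hlog_ge_trapezoid t y : 0 < y ->
  htail t y - htail t (y + 1) <= (hlog t y + hlog t (y + 1)) / 2.
Proof.
move=> y0; pose m := y + 2^-1.
pose g x := - (2 * t ^+ 2) / (x * (x ^+ 2 + t ^+ 2)).
have g_mono a b : 0 < a -> a <= b -> g a <= g b.
  move=> a0 ab; rewrite /g !mulNr lerN2 ler_wpM2l ?(mulr_ge0 _ (sqr_ge0 _)) //.
  have b0 : 0 < b by apply: lt_le_trans ab.
  have sq : a ^+ 2 <= b ^+ 2 by rewrite lerXn2r ?nnegrE // ltW.
  rewrite lef_pV2 ?posrE ?mulr_gt0 ?ltr_pwDl ?exprn_gt0 ?sqr_ge0 //.
  by apply: ler_pM; rewrite ?(ltW a0) ?lerD2r ?addr_ge0 ?sqr_ge0.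
pose D u := u * (hlog t (m - u) + hlog t (m + u)) -
  (htail t (m - u) - htail t (m + u)).
pose D' u := u * (g (m + u) - g (m - u)).
have h : D 0 <= D 2^-1.
  apply: (@isd_ndecr _ D D') => [u /andP[u0 u1]|u /andP[u0 u1]|]; last 1 first.
  - by rewrite invr_ge0.
  - have dm : isd (fun u => m - u) u (0 - 1).
      by apply: isdB; [exact: isd_cst|exact: isd_id].
    have dp : isd (fun u => m + u) u (0 + 1).
      by apply: isdD; [exact: isd_cst|exact: isd_id].
    have mu0 : 0 < m - u by rewrite /m; lra.
    have pu0 : 0 < m + u by rewrite /m; lra.
    apply: isd_eq.
      apply: isdB.
        apply: isdM; first exact: isd_id.
        apply: isdD.
          exact: (isd_comp (g := fun u => m - u) (isd_hlog t mu0) dm).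
        exact: (isd_comp (g := fun u => m + u) (isd_hlog t pu0) dp).
      apply: isdB.
        exact: (isd_comp (g := fun u => m - u) (isd_htail t mu0) dm).
      exact: (isd_comp (g := fun u => m + u) (isd_htail t pu0) dp).
    by rewrite /D' -/(g (m - u)) -/(g (m + u)); ring.
  - by rewrite /D' mulr_ge0 ?(ltW u0) // subr_ge0 g_mono //; rewrite /m; lra.
move: h; rewrite /D mul0r subr0 addr0 subrr subr0 subr_ge0.
have -> : m - 2^-1 = y by rewrite /m addrK.
have -> : m + 2^-1 = y + 1 by rewrite /m; field.
by rewrite [_ / 2]mulrC.
Qed.

Lemma atan_mul_norm t y : t * atan (t / y) = `|t| * atan (`|t| / y).
Proof. by case: ger0P => // _; rewrite !mulNr atanN mulrN opprK. Qed.

(** The derivative in |t| is twice an arctangent. *)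
Lemma htail_ge0 t y : 0 < y -> 0 <= htail t y.
Proof.
move=> y0; pose D z : R := 2 * (z * atan z) - ln (1 + z ^+ 2).
have atan_ge0 z : 0 <= z -> 0 <= atan z :> R.
  by move=> z0; rewrite -(@atan0 R) le_atan.
have D_ge0 z : 0 <= z -> 0 <= D z.
  move=> z0.
  have h : D 0 <= D z.
    apply: (@isd_ndecr _ D (fun x => 2 * atan x) _ _ _ _ z0) => [u _|u /andP[u0 u1]].
      apply: isd_eq.
        apply: isdB.
          apply: isdZ; apply: isdM; first exact: isd_id.
          by apply: isd_atan; exact: isd_id.
        apply: isd_ln; first by rewrite ltr_pwDl // sqr_ge0.
        apply: isdD; first exact: isd_cst.
        exact: (isdM (isd_id u) (isd_id u)).
      have d0 : 1 + u ^+ 2 != 0 by rewrite gt_eqF // ltr_pwDl // sqr_ge0.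
      by rewrite /=; field.
    by rewrite mulr_ge0 // atan_ge0 // ltW.
  by apply: le_trans h; rewrite /D mul0r mulr0 expr0n addr0 ln1 subrr.
have E : htail t y = y * D (`|t| / y).
  rewrite /htail /D /hlog !expr_div_n real_normK ?num_real //.
  by rewrite atan_mul_norm; field; rewrite gt_eqF.
by rewrite E mulr_ge0 ?(ltW y0) // D_ge0 // divr_ge0 // ltW.
Qed.

Lemma atan_le_id x : 0 <= x -> atan x <= x.
Proof.
move=> x0; rewrite -subr_ge0.
pose D z : R := z - atan z.
have h : D 0 <= D x.
  apply: (@isd_ndecr _ D (fun z => 1 - (1 + z ^+ 2)^-1) _ _ _ _ x0) => [u _|u _].
    apply: isd_eq.
      by apply: isdB; [exact: isd_id|apply: isd_atan; exact: isd_id].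
    by rewrite mulr1.
  by rewrite subr_ge0 invf_le1 ?lerDl ?sqr_ge0 // ltr_pwDl // sqr_ge0.
by move: h; rewrite /D atan0 subr0.
Qed.

(** For a = pi / 2 - atan z this is the inequality a cos a <= sin a. *)
Lemma atan_compl (z : R) : 0 <= z -> z * (pi / 2 - atan z) <= 1.
Proof.
move=> z0; set a := pi / 2 - atan z.
have a0 : 0 <= a by rewrite subr_ge0 ltW // atan_ltpi2.
have az : a <= pi / 2 by rewrite /a gerBl -(@atan0 R) le_atan.
have sa : sin a = cos (atan z).
  by rewrite /a sinB sin_pihalf cos_pihalf mul1r mul0r subr0.
have ca : cos a = sin (atan z).
  by rewrite /a cosB cos_pihalf sin_pihalf mul1r mul0r add0r.
have cz : 0 < cos (atan z).
  by apply: cos_gt0_pihalf; rewrite atan_gtNpi2 atan_ltpi2.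
have zE : z = cos a / sin a by rewrite ca sa -[LHS]atanK.
have s0 : 0 < sin a by rewrite sa.
rewrite zE mulrAC ler_pdivrMr // mul1r mulrC -subr_ge0.
pose D x : R := sin x - x * cos x.
have h : D 0 <= D a.
  apply: (@isd_ndecr _ D (fun x => x * sin x) _ _ _ _ a0) => [u _|u /andP[u0 u1]].
    apply: isd_eq.
      apply: isdB; first by apply: isd_sin; exact: isd_id.
      apply: isdM; first exact: isd_id.
      by apply: isd_cos; exact: isd_id.
    by rewrite /=; ring.
  rewrite mulr_ge0 ?(ltW u0) // sin_ge0_pi // (ltW u0) /=.
  lra.
by move: h; rewrite /D sin0 mul0r subr0.
Qed.

Lemma htail_le t y : 0 < y -> htail t y <= pi * `|t| - y * hlog t y.
Proof.
move=> y0; rewrite /htail lerD2r atan_mul_norm mulrCA mulrC ler_wpM2r //.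
by have := @atan_ltpi2 R (`|t| / y); lra.
Qed.

Lemma htail_ge t y : 0 < y -> pi * `|t| - 2 * y - y * hlog t y <= htail t y.
Proof.
move=> y0; rewrite /htail lerD2r atan_mul_norm.
have ty : 0 <= `|t| / y by rewrite divr_ge0 // ltW.
have := atan_compl ty; rewrite mulrAC ler_pdivrMr // mul1r mulrBr.
lra.
Qed.

Lemma cvg_htail0 t c : 0 < c -> (fun n : nat => htail t (c + n%:R)) @ \oo --> (0 : R).
Proof.
move=> c0.
have h n : htail t (c + n.+1%:R) <= 2 * t ^+ 2 / n.+1%:R.
  have p : 0 < c + n.+1%:R by rewrite ltr_wpDr.
  rewrite /htail; apply: (@le_trans _ _ (2 * (t * atan (t / (c + n.+1%:R))))).
    by rewrite gerBl mulr_ge0 ?hlog_ge0 // ltW.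
  rewrite -mulrA ler_wpM2l // atan_mul_norm.
  apply: (@le_trans _ _ (`|t| * (`|t| / (c + n.+1%:R)))).
    by rewrite ler_wpM2l // atan_le_id // divr_ge0 // ltW.
  rewrite mulrA -expr2 real_normK ?num_real // ler_wpM2l ?sqr_ge0 //.
  by rewrite lef_pV2 ?posrE // lerDr ltW.
rewrite -(cvg_shiftS (fun n : nat => htail t (c + n%:R))).
apply: (@squeeze_cvgr _ _ _ _ (fun=> 0) (fun n => 2 * t ^+ 2 / n.+1%:R)).
- by apply: nearW => n; rewrite h htail_ge0 // ltr_wpDr.
- exact: cvg_cst.
- exact: cvg_divS.
Qed.

Definition hsum t c n : R := \sum_(i < n) hlog t (c + i%:R).

Lemma hsum_le t c n : 2^-1 < c -> hsum t c n <= htail t (c - 2^-1).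
Proof.
move=> c2; suff h : hsum t c n <= htail t (c - 2^-1) - htail t (c + n%:R - 2^-1).
  apply: (le_trans h); rewrite gerBl htail_ge0 //.
  by rewrite -addrAC ltr_wpDr // subr_gt0.
elim: n => [|n ih]; first by rewrite /hsum big_ord0 addr0 subrr.
rewrite /hsum big_ord_recr /=.
have := @hlog_le_midpoint t (c + n%:R); rewrite ltr_wpDr // => /(_ isT) h.
apply: (le_trans (lerD ih h)); rewrite -(natr1 n).
have -> : c + (n%:R + 1) - 2^-1 = c + n%:R + 2^-1 by field.
by rewrite addrA subrK.
Qed.

Lemma hsum_ge t c n : 0 < c ->
  hlog t c / 2 + htail t c - htail t (c + n%:R) <= hsum t c n.+1.
Proof.
move=> c0; suff h : hlog t c / 2 + hlog t (c + n%:R) / 2 + htail t c - htail t (c + n%:R)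
    <= hsum t c n.+1.
  apply: le_trans h; rewrite lerD2r lerD2r lerDl divr_ge0 //; exact: hlog_ge0.
elim: n => [|n ih].
  rewrite /hsum big_ord_recr big_ord0 /= addr0 addrK add0r.
  by have -> : hlog t c / 2 + hlog t c / 2 = hlog t c by field.
rewrite /hsum big_ord_recr /=.
have := @hlog_ge_trapezoid t (c + n%:R); rewrite ltr_wpDr // => /(_ isT).
have -> : c + n%:R + 1 = c + n.+1%:R by rewrite -(natr1 n) addrA.
move: ih; rewrite /hsum.
by lra.
Qed.

End Stirling.

(** * The modulus of Gamma on a vertical line *)

Section GammaModulus.
Context {R : realType}.
Implicit Types (s : R[i]) (t x y u c : R).
Notation mu := (@lebesgue_measure R).

Lemma cabs_shift s n : 0 < complex.Re s -> cabs (s + n%:R) =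
  (complex.Re s + n%:R) * expR (hlog (complex.Im s) (complex.Re s + n%:R) / 2).
Proof.
move=> s0; set c := complex.Re s + n%:R.
have c0 : 0 < c by rewrite ltr_wpDr.
apply/eqP; rewrite -(@eqrXn2 _ 2) ?cabs_ge0 ?mulr_ge0 ?expR_ge0 ?(ltW c0) //.
rewrite cabs_sqr cReD cImD cRe_natr cIm_natr addr0 -/c exprMn -expRM_natl.
have -> : 2%:R * (hlog (complex.Im s) c / 2) = hlog (complex.Im s) c by field.
rewrite lnK ?posrE ?oneDsq_gt0 // expr_div_n.
by apply/eqP; field; rewrite gt_eqF.
Qed.

Lemma cabs_rising n s : 0 < complex.Re s -> cabs (rising n s) =
  cabs (rising n (complex.Re s)%:C) *
  expR (hsum (complex.Im s) (complex.Re s) n / 2).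
Proof.
move=> s0; elim: n => [|n ih].
  by rewrite /rising /hsum !big_ord0 mul0r expR0 mulr1.
rewrite !rising_recr !cabsM ih cabs_shift //.
have -> : hsum (complex.Im s) (complex.Re s) n.+1 =
    hsum (complex.Im s) (complex.Re s) n + hlog (complex.Im s) (complex.Re s + n%:R).
  by rewrite /hsum big_ord_recr.
have -> : cabs ((complex.Re s)%:C + n%:R) = complex.Re s + n%:R.
  by rewrite -(rmorph_nat (real_complex R)) -rmorphD cabs_real ger0_norm // addr_ge0 ?(ltW s0).
by rewrite [X in _ = _ * expR X]mulrDl expRD mulrACA.
Qed.

Lemma cabs_Gamma_approx n s : 0 < complex.Re s -> cabs (Gamma_approx n s) =
  cabs (Gamma_approx n (complex.Re s)%:C) *
  expR (- (hsum (complex.Im s) (complex.Re s) n.+1 / 2)).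
Proof.
move=> s0; have E z : cabs (Gamma_approx n z) =
    cabs (mpow (- z) n%:R) * cabs (n`!%:R : R[i]) / cabs (rising n.+1 z).
  by rewrite /Gamma_approx cabsM cabsM cabsV.
rewrite !E cabs_rising // !cabs_mpow.
by rewrite !cReN cRe_real invfM -[in LHS]expRN !mulrA.
Qed.

(** Gamma does not vanish at real points, being the integral of a positive
    function there. *)
Lemma Gamma_real_gt0 c : 1 < c -> 0 < cabs (Gammac c%:C).
Proof.
move=> c1; have s1 : 1 < complex.Re c%:C by [].
have [_ /(_ 1 ltr01)[[+ _] _]] := mellin_exp_Gamma s1.
pose f u := u^-1 * expR (- u^-1) * expR (- (c * ln u)).
have -> : (fun u => complex.Re ((u^-1 * expR (- (1 / u)))%:C * mpow c%:C u)) = f.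
  by apply/funext => u; rewrite mpow_real -rmorphM cRe_real div1r.
move=> fi; apply: lt_le_trans (normr_Re_le _).
have -> : complex.Re (Gammac c%:C) = \int[mu]_(u in `]0, +oo[) f u.
  by apply: eq_Rintegral => u _; rewrite mpow_real -rmorphM cRe_real.
pose k := 2^-1 * expR (-1) * expR (- (c * ln 2)).
have k0 : 0 < k by rewrite !mulr_gt0 ?expR_gt0.
pose I : set R := `[1, 2]%classic.
have IR : I `<=` `]0, +oo[%classic by apply: subset_itv; rewrite bnd_simp.
suff h : k <= \int[mu]_(u in `]0, +oo[) f u by apply: lt_le_trans (ler_norm _); apply: lt_le_trans h.
have kE : \int[mu]_(u in `]0, +oo[) (k * \1_I u) = k.
  rewrite Rintegral_mkcond.
  have -> : \int[mu]_u ((fun u => k * \1_I u) \_ `]0, +oo[) u = \int[mu]_u ((fun=> k) \_ I) u.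
    apply: eq_Rintegral => u _; rewrite /patch indicE.
    case: (boolP (u \in I)) => [uI|uI]; last by rewrite mulr0; case: ifP.
    by rewrite mulr1 ifT //; move/set_mem/IR/mem_set : uI.
  rewrite -Rintegral_mkcond Rintegral_cst; last exact: measurable_itv.
  have mI : mu I = (1 : R)%:E.
    have := @lebesgue_measure_itv R `[1, 2]; rewrite /= lte_fin ltr1n => h.
    by apply: (etrans h); rewrite -EFinB; congr EFin; ring.
  exact: (etrans (congr1 (fun z => k * fine z) mI) (mulr1 k)).
rewrite -kE; apply: le_Rintegral => //.
  have h : mu.-integrable `]0, +oo[ (EFin \o (\1_I : R -> R)).
    apply: (@integrableS _ _ R mu setT) => //.
    exact: integrable_indic_itv.
  exact: (integrableZl (mu := mu) _ k h).
move=> u /Rpos_gt0 u0; rewrite indicE.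
case: (boolP (u \in I)) => [/set_mem|_]; last first.
  by rewrite mulr0 !mulr_ge0 ?expR_ge0 // invr_ge0 ltW.
rewrite /I /= in_itv /= => /andP[u1 u2]; rewrite mulr1 /k /f.
apply: ler_pM; rewrite ?mulr_ge0 ?expR_ge0 //.
  apply: ler_pM; rewrite ?expR_ge0 ?lef_pV2 ?posrE ?ler_expR //.
  by rewrite lerN2 invf_le1.
rewrite ler_expR lerN2 ler_wpM2l ?ler_ln ?posrE //.
by lra.
Qed.

Lemma Gamma_approx_cvg s : 1 < complex.Re s -> ccvg (Gamma_approx ^~ s) (Gammac s).
Proof. by move=> /mellin_exp_Gamma[]. Qed.

Lemma cvg_Gamma_real c : 1 < c ->
  (fun n => cabs (Gamma_approx n c%:C)) @ \oo --> cabs (Gammac c%:C).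
Proof. by move=> c1; apply: ccvg_cabs; exact: Gamma_approx_cvg. Qed.

(** The midpoint rule bounds the product of the moduli from above. *)
Lemma Gamma_lower s : 1 < complex.Re s ->
  cabs (Gammac (complex.Re s)%:C) *
    expR (- (htail (complex.Im s) (complex.Re s - 2^-1) / 2)) <= cabs (Gammac s).
Proof.
move=> s1; have s0 : 0 < complex.Re s by lra.
apply: (ler_cvg_seq 0 (cvg_seqMr _ (cvg_Gamma_real s1))
  (ccvg_cabs (Gamma_approx_cvg s1))) => n _; rewrite [leRHS]cabs_Gamma_approx // ler_wpM2l ?cabs_ge0 //.
by rewrite ler_expR lerN2 ler_pM2r // hsum_le //; lra.
Qed.

(** The trapezoid rule bounds the product of the moduli from below; half of its
    end term is what makes the power of |s| agree with that of the lower
    bound. *)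
Lemma Gamma_upper s : 1 < complex.Re s -> cabs (Gammac s) <=
  cabs (Gammac (complex.Re s)%:C) *
    expR (- ((hlog (complex.Im s) (complex.Re s) / 2 +
              htail (complex.Im s) (complex.Re s)) / 2)).
Proof.
move=> s1; have s0 : 0 < complex.Re s by lra.
set t := complex.Im s; set c := complex.Re s.
have h : (fun n => cabs (Gamma_approx n c%:C) *
    expR (- ((hlog t c / 2 + htail t c - htail t (c + n%:R)) / 2))) @ \oo -->
    cabs (Gammac c%:C) * expR (- ((hlog t c / 2 + htail t c - 0) / 2)).
  apply: cvgM; first exact: cvg_Gamma_real.
  apply: continuous_cvg; first exact: continuous_expR.
  apply: cvgN; apply: cvg_seqMr; apply: cvgB; [exact: cvg_cst|exact: cvg_htail0].
rewrite subr0 in h.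
apply: (ler_cvg_seq 0 (ccvg_cabs (Gamma_approx_cvg s1)) h) => n _; rewrite cabs_Gamma_approx // ler_wpM2l ?cabs_ge0 //.
by rewrite ler_expR lerN2 ler_pM2r // hsum_ge.
Qed.

(** The approximants decrease in modulus relative to their values on the real
    axis, as each new factor of the product is larger off the axis. *)
Lemma Gamma_ratio_le k s : 1 < complex.Re s ->
  cabs (Gammac s) * cabs (Gamma_approx k (complex.Re s)%:C) <=
  cabs (Gammac (complex.Re s)%:C) * cabs (Gamma_approx k s).
Proof.
move=> s1; have s0 : 0 < complex.Re s by lra.
set g := cabs (Gamma_approx k _).
apply: (ler_cvg_seq k (cvg_seqMr g (ccvg_cabs (Gamma_approx_cvg s1)))
  (cvg_seqMr (cabs (Gamma_approx k s)) (cvg_Gamma_real s1))) => n kn.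
rewrite (cabs_Gamma_approx n s0) (cabs_Gamma_approx k s0) -/g.
rewrite -mulrA ler_wpM2l ?cabs_ge0 // mulrC ler_wpM2l ?cabs_ge0 //.
rewrite ler_expR lerN2 ler_pM2r // /hsum.
rewrite -(big_mkord xpredT (fun i => hlog (complex.Im s) (complex.Re s + i%:R))).
rewrite -(big_mkord xpredT (fun i => hlog (complex.Im s) (complex.Re s + i%:R))).
rewrite [leRHS](big_cat_nat (n := k.+1)) //=.
by rewrite lerDl sumr_ge0 // => i _; exact: hlog_ge0.
Qed.

Lemma Gammac_neq0 s : 1 < complex.Re s -> Gammac s != 0.
Proof.
move=> s1; rewrite -cabs_gt0; apply: lt_le_trans (Gamma_lower s1).
by rewrite mulr_gt0 ?expR_gt0 ?Gamma_real_gt0.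
Qed.

(** Two-sided form of Stirling's formula on a vertical line. The logarithmic
    terms of both bounds are the same function of |s|, which is what makes the
    weighted space the exact image. *)
Lemma stirling_line c : 1 < c -> exists A B, 0 < A /\ forall t,
  A <= expR ((1 / 2 - c) * ln (cabs (c +i* t))) *
         expR (pi * (1 / 2) * cabs (c +i* t)) * cabs (Gammac (c +i* t)) <= B.
Proof.
move=> c1; have c0 : 0 < c by lra.
pose g := cabs (Gammac c%:C); have g0 : 0 < g by exact: Gamma_real_gt0.
(* In the upper bound pi / 2 * c accounts for |s| <= |t| + c, and the last c for
   the error of htail_ge. *)
exists (g * expR ((1 / 2 - c) * ln c)), (g * expR ((1 / 2 - c) * ln c + pi / 2 * c + c)).
split; first by rewrite mulr_gt0 ?expR_gt0.
move=> t; set s := c +i* t; have s1 : 1 < complex.Re s by [].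
have lo := Gamma_lower s1; have up := Gamma_upper s1.
rewrite -[complex.Re s]/c -[complex.Im s]/t -/g in lo up.
have ls : ln (cabs s) = ln c + hlog t c / 2.
  have := @cabs_shift s 0; rewrite addr0 -[complex.Re s]/c -[complex.Im s]/t addr0 => -> //.
  by rewrite lnM ?posrE ?expR_gt0 // expRK.
have tl := @htail_le R t (c - 2^-1); rewrite subr_gt0 in tl.
have {}tl := tl _; have {}tl : htail t (c - 2^-1) <= pi * `|t| - (c - 2^-1) * hlog t c.
  apply: le_trans (tl _) _; first by lra.
  rewrite lerD2l lerN2 ler_wpM2l; [|lra|].
    by [].
  rewrite /hlog ler_ln ?posrE ?oneDsq_gt0 // lerD2l !expr_div_n.
  have c2 : 0 < c - 2^-1 by lra.
  rewrite ler_wpM2l ?sqr_ge0 // lef_pV2 ?posrE ?exprn_gt0 //.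
  by rewrite lerXn2r ?nnegrE ?(ltW c0) ?(ltW c2) // gerBl.
have tg := @htail_ge R t c c0.
have st : `|t| <= cabs s := normr_Im_le s.
have ts : cabs s <= `|t| + c.
  by have := cabs_le_ReIm s; rewrite -[complex.Re s]/c -[complex.Im s]/t ger0_norm ?(ltW c0) // addrC.
have p0 := pi_gt0 R.
apply/andP; split.
  apply: (le_trans _ (ler_wpM2l _ lo)); last by rewrite mulr_ge0 ?expR_ge0.
  rewrite mulrCA ler_wpM2l ?(ltW g0) // -!expRD ler_expR ls.
  have := ler_wpM2l (ltW p0) st; lra.
apply: (le_trans (ler_wpM2l _ up)); first by rewrite mulr_ge0 ?expR_ge0.
rewrite mulrCA ler_wpM2l ?(ltW g0) // -!expRD ler_expR ls.
have := ler_wpM2l (ltW p0) ts; lra.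
Qed.

End GammaModulus.

(** * The Moebius function *)

Section Moebius.

Lemma big_multiples (V : nmodType) N i (G : nat -> V) : (0 < i)%N ->
  \sum_(1 <= n < N | (i %| n)%N) G n = \sum_(1 <= j < N | (i * j < N)%N) G (i * j)%N.
Proof.
move=> i0; rewrite -big_filter -[RHS]big_filter.
rewrite -(big_map (muln i) xpredT G); apply: perm_big; apply: uniq_perm.
- by rewrite filter_uniq // iota_uniq.
- rewrite map_inj_uniq ?filter_uniq ?iota_uniq // => a b /eqP.
  by rewrite eqn_pmul2l // => /eqP.
move=> n; rewrite mem_filter mem_index_iota; apply/andP/mapP.
  move=> [/dvdnP[j ->]]; rewrite muln_gt0 => /andP[/andP[j0 _] jiN].
  exists j; last by rewrite mulnC.
  rewrite mem_filter mem_index_iota mulnC jiN j0 /=.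
  by apply: leq_ltn_trans jiN; rewrite leq_pmulr.
move=> [j]; rewrite mem_filter mem_index_iota => /andP[ijN /andP[j0 _]] ->.
by rewrite dvdn_mulr // ijN muln_gt0 i0 j0.
Qed.

Lemma moebius1 : moebius 1 = 1.
Proof. by []. Qed.

Lemma moebius_mul_prime p j : prime p -> (0 < j)%N ->
  moebius (p * j) = if (p %| j)%N then 0 else - moebius j.
Proof.
move=> pp j0; have p0 := prime_gt0 pp.
have pj0 : (0 < p * j)%N by rewrite muln_gt0 p0.
have lE q : logn q (p * j) = ((q == p) + logn q j)%N.
  by rewrite lognM // logn_prime // eq_sym.
rewrite /moebius pj0 j0 /=; case: (boolP (p %| j)%N) => pj.
  case: ifP => // /seq.allP /(_ p); rewrite mem_primes pp pj0 dvdn_mulr // => /(_ isT).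
  by rewrite lE eqxx add1n eqSS -leqn0 leqNgt logn_gt0 mem_primes pp j0 pj.
have perm : perm_eq (primes (p * j)) (p :: primes j).
  apply: uniq_perm; first exact: primes_uniq.
    by rewrite /= primes_uniq andbT mem_primes pp j0.
  by move=> q; rewrite primesM // inE primes_prime // inE.
have lp0 : logn p j = 0%N.
  by apply/eqP; rewrite -leqn0 leqNgt logn_gt0 mem_primes pp j0.
rewrite (perm_all _ perm) (perm_size perm) /= lE eqxx lp0 addn0 eqxx /=.
have -> : all (fun q => logn q (p * j) == 1%N) (primes j) =
    all (fun q => logn q j == 1%N) (primes j).
  apply: eq_in_all => q qj; rewrite lE; have [qp|//] := eqVneq q p.
  by move: qj; rewrite qp mem_primes pp j0 (negPf pj).
by case: ifP => _; rewrite ?oppr0 // exprS mulN1r.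
Qed.

(** Removing one prime factor pairs the squarefree divisors with opposite
    values. *)
Lemma sum_moebius_divisors N n : (0 < n < N)%N ->
  \sum_(1 <= d < N | (d %| n)%N) moebius d = (n == 1%N)%:R.
Proof.
move=> /andP[n0 nN]; case: eqVneq => [->|n1].
  rewrite big_mkcond big_ltn ?(leq_ltn_trans n0) //= moebius1 big1_seq ?addr0 //.
  move=> d; rewrite mem_index_iota => /andP[_ /andP[d2 _]].
  by rewrite dvdn1; case: eqP d2 => // ->.
have n_gt1 : (1 < n)%N by rewrite ltn_neqAle eq_sym n1.
pose p := pdiv n; have pp : prime p by exact: pdiv_prime.
have pn : (p %| n)%N by exact: pdiv_dvd.
pose F d := if (d %| n)%N then moebius d else 0.
rewrite big_mkcond -/F (bigID (fun d => p %| d)%N) /= big_multiples ?prime_gt0 //.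
rewrite big_mkcond [X in _ + X]big_mkcond -big_split /= big1_seq // => j.
rewrite mem_index_iota => /andP[_ /andP[j0 _]].
rewrite /F moebius_mul_prime //; case: (boolP (p %| j)%N) => pj /=.
  by rewrite addr0; case: ifP => // _; case: ifP.
have co : coprime p j by rewrite prime_coprime.
have pjn : (p * j %| n)%N = (j %| n)%N by rewrite Gauss_dvd // pn.
rewrite pjn; case: (boolP (j %| n)%N) => jn; last by rewrite if_same addr0.
rewrite ifT ?addNr //; apply: leq_ltn_trans nN.
by apply: dvdn_leq => //; rewrite pjn.
Qed.

Lemma normr_moebius (R : realType) n : cabs ((moebius n)%:~R : R[i]) <= 1.
Proof.
rewrite /moebius; case: ifP => _; last by rewrite cabs0.
rewrite rmorphXn /= rmorphN1; elim: (size _) => [|m ih]; first by rewrite expr0 cabs1.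
by rewrite exprS cabsM cabsN cabs1 mul1r.
Qed.

End Moebius.

(** * The zeta function and the Lambert kernel *)

Section Zeta.
Context {R : realType}.
Implicit Types (s : R[i]) (x u c : R).

Definition zeta_sum N s : R[i] := \sum_(1 <= n < N) mpow s n%:R.
Definition moebius_sum N s : R[i] :=
  \sum_(1 <= n < N) (moebius n)%:~R * mpow s n%:R.

Definition zetac s : R[i] := limn ((zeta_sum ^~ s) : nat -> R[i]^o).

Lemma lambert_kernel_partial x u N : 0 < x -> 0 < u ->
  \sum_(1 <= n < N.+1) u^-1 * expR (- (n%:R * x / u)) =
  lambert_kernel x u * (1 - expR (- (N%:R * x / u))).
Proof.
move=> x0 u0; have e1 : expR (x / u) - 1 != 0.
  by rewrite gt_eqF // subr_gt0 expR_gt1 divr_gt0.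
elim: N => [|N ih].
  by rewrite big_geq // !mul0r oppr0 expR0 subrr mulr0.
rewrite big_nat_recr //= ih /lambert_kernel.
have -> : - (N%:R * x / u) = - (N.+1%:R * x / u) + x / u.
  by rewrite -(natr1 N); field; rewrite gt_eqF.
by rewrite expRD; field; rewrite e1 gt_eqF.
Qed.

(** Geometric expansion of the kernel, whose partial sums are dominated by the
    kernel itself. The limit is not yet identified: its existence is what proves
    the convergence of the zeta series. *)
Lemma mellin_lambert_limit s x : 1 < complex.Re s -> 0 < x ->
  cintegrable `]0, +oo[ (fun u => (lambert_kernel x u)%:C * mpow s u) /\
  ccvg (fun N => mpow s x * Gammac s * zeta_sum N s)
    (cintegral `]0, +oo[ (fun u => (lambert_kernel x u)%:C * mpow s u)).
Proof.
move=> s1 x0; have [_ mE] := mellin_exp_Gamma s1.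
pose F_ n u := (u^-1 * expR (- (n%:R * x / u)))%:C * mpow s u.
have nx0 n : (0 < n)%N -> 0 < n%:R * x by move=> n0; rewrite mulr_gt0 // ltr0n.
have SE N : cintegrable `]0, +oo[ (fun u => \sum_(1 <= n < N) F_ n u) /\
    cintegral `]0, +oo[ (fun u => \sum_(1 <= n < N) F_ n u) =
    mpow s x * Gammac s * zeta_sum N s.
  have [|h1 h2] := @cintegral_sum R `]0, +oo[ N F_ (measurable_itv _).
    by move=> n n0; have [] := mE _ (nx0 n n0).
  split; first exact: h1.
  have -> : mpow s x * Gammac s * zeta_sum N s =
      \sum_(1 <= n < N) mpow s x * Gammac s * mpow s n%:R by exact: mulr_sumr.
  apply: (etrans h2); apply: eq_big_nat => n /andP[n0 _].
  have [_ e] := mE _ (nx0 n n0); apply: (etrans e).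
  by rewrite mpowM ?ltr0n //; ring.
have SK N u : 0 < u -> \sum_(1 <= n < N.+1) F_ n u =
    (lambert_kernel x u * (1 - expR (- (N%:R * x / u))))%:C * mpow s u.
  by move=> u0; rewrite -lambert_kernel_partial // rmorph_sum mulr_suml.
have [h1 h2] : cintegrable `]0, +oo[ (fun u => (lambert_kernel x u)%:C * mpow s u) /\
    ccvg (fun N => cintegral `]0, +oo[ (fun u => \sum_(1 <= n < N.+1) F_ n u))
    (cintegral `]0, +oo[ (fun u => (lambert_kernel x u)%:C * mpow s u)).
  apply: (cintegral_dominated (g := fun u =>
    expR (- (complex.Re s * ln u)) * lambert_kernel x u)) => //.
  - by move=> N; have [h _] := SE N.+1; exact: cintegrable_cmeas h.
  - move=> u /Rpos_gt0 u0.
    apply: (eq_ccvg 0 (fun N => (lambert_kernel x u * (1 - expR (- (N%:R * x / u))))%:C * mpow s u)).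
      by move=> N _; rewrite SK.
    apply: ccvgM; last exact: ccvg_cst.
    apply: ccvg_real; rewrite -[X in _ --> X]mulr1; apply: cvg_seqMl.
    rewrite -[X in _ --> X]subr0; apply: cvgB; first exact: cvg_cst.
    have -> : (fun N => expR (- (N%:R * x / u))) = (fun N => expR (- (x / u)) ^+ N).
      by apply/funext => N; rewrite -expRM_natl mulrN mulrA.
    apply: cvg_expr; rewrite ger0_norm ?expR_ge0 // expR_lt1 oppr_lt0.
    by rewrite divr_gt0.
  - exact: integrable_lambert_kernel.
  - move=> N u /Rpos_gt0 u0; rewrite SK // cabsM cabs_real cabs_mpow mulrC.
    rewrite ler_wpM2l ?expR_ge0 //.
    have l0 := lambert_kernel_gt0 x0 u0.
    have e1 : expR (- (N%:R * x / u)) <= 1.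
      by rewrite expR_le1 oppr_le0 mulr_ge0 ?invr_ge0 ?(ltW u0) // mulr_ge0 // ltW.
    rewrite normrM !ger0_norm ?subr_ge0 ?(ltW l0) //.
    by rewrite ger_pMr // gerBl ltW.
split; first exact: h1.
apply/(ccvg_shift 1); apply: (eq_ccvg 0 _ _ h2) => N _.
by have [_ ->] := SE N.+1; rewrite addn1.
Qed.

Lemma zeta_cvg s : 1 < complex.Re s -> ccvg (zeta_sum ^~ s) (zetac s).
Proof.
move=> s1; have [_ h] := mellin_lambert_limit s1 ltr01.
have G0 := Gammac_neq0 s1.
have h2 : ccvg (zeta_sum ^~ s) ((Gammac s)^-1 *
    cintegral `]0, +oo[ (fun u => (lambert_kernel 1 u)%:C * mpow s u)).
  apply: (eq_ccvg 0 _ _ (ccvgZ (Gammac s)^-1 h)) => N _.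
  by rewrite mpow1x mul1r mulKf.
by rewrite /zetac (ccvg_lim h2).
Qed.

Lemma mellin_lambert s x : 1 < complex.Re s -> 0 < x ->
  cintegrable `]0, +oo[ (fun u => (lambert_kernel x u)%:C * mpow s u) /\
  cintegral `]0, +oo[ (fun u => (lambert_kernel x u)%:C * mpow s u) =
    mpow s x * Gammac s * zetac s.
Proof.
move=> s1 x0; have [h1 h2] := mellin_lambert_limit s1 x0.
split; first exact: h1.
exact: (ccvg_unique h2 (ccvgZ (mpow s x * Gammac s) (zeta_cvg s1))).
Qed.

Definition zetar_sum N c : R := \sum_(1 <= n < N) expR (- (c * ln n%:R)).

Lemma zeta_sum_real N c : zeta_sum N c%:C = (zetar_sum N c)%:C.
Proof.
by rewrite /zeta_sum /zetar_sum rmorph_sum; apply: eq_bigr => n _; rewrite mpow_real.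
Qed.

Definition zetar c : R := complex.Re (zetac c%:C).

Lemma zetar_cvg c : 1 < c -> (zetar_sum ^~ c) @ \oo --> zetar c.
Proof.
move=> c1; have s1 : 1 < complex.Re c%:C by [].
have /ccvg_ReIm[h _] := zeta_cvg s1; move: h.
by under eq_fun do rewrite zeta_sum_real cRe_real.
Qed.

Lemma zetar_sum_mono c : nondecreasing_seq (zetar_sum ^~ c).
Proof.
apply/nondecreasing_seqP => -[|n]; rewrite /zetar_sum; first by rewrite !big_geq.
by rewrite [leRHS]big_nat_recr //= lerDl expR_ge0.
Qed.

Lemma zetar_sum_le N c : 1 < c -> zetar_sum N c <= zetar c.
Proof.
move=> c1; have h := zetar_cvg c1.
rewrite -(cvg_lim _ h) //; apply: nondecreasing_cvgn_le; first exact: zetar_sum_mono.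
by apply/cvg_ex; exists (zetar c).
Qed.

Lemma zetar_sum_ge0 N c : 0 <= zetar_sum N c.
Proof. by rewrite /zetar_sum sumr_ge0 // => i _; exact: expR_ge0. Qed.

Lemma cabs_zeta_sum N s : 1 < complex.Re s ->
  cabs (zeta_sum N s) <= zetar (complex.Re s).
Proof.
move=> s1; apply: le_trans (zetar_sum_le N s1).
rewrite (le_trans (cabs_sum_le _ _ _)) //.
by apply: ler_sum => n _; rewrite cabs_mpow.
Qed.

Lemma cabs_moebius_sum N s : 1 < complex.Re s ->
  cabs (moebius_sum N s) <= zetar (complex.Re s).
Proof.
move=> s1; apply: le_trans (zetar_sum_le N s1).
rewrite (le_trans (cabs_sum_le _ _ _)) //; apply: ler_sum => n _.
by rewrite cabsM cabs_mpow ler_piMl ?expR_ge0 // normr_moebius.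
Qed.

End Zeta.

(** * The inverse of zeta *)

Section MoebiusZeta.
Context {R : realType}.
Implicit Types (s : R[i]) (c : R).

(** The part of the product of the two partial sums lying under the hyperbola
    i j < N collapses to its first term. *)
Lemma moebius_hyperbola N s : (1 < N)%N ->
  \sum_(1 <= i < N) \sum_(1 <= j < N | (i * j < N)%N)
    (moebius i)%:~R * (mpow s i%:R * mpow s j%:R) = 1.
Proof.
move=> N1.
have E i : (1 <= i < N)%N -> \sum_(1 <= j < N | (i * j < N)%N)
      (moebius i)%:~R * (mpow s i%:R * mpow s j%:R) =
    \sum_(1 <= n < N) (if (i %| n)%N then (moebius i)%:~R else 0) * mpow s n%:R.
  move=> /andP[i0 _].
  have -> : \sum_(1 <= n < N) (if (i %| n)%N then (moebius i)%:~R else 0) * mpow s n%:R =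
      \sum_(1 <= n < N | (i %| n)%N) (moebius i)%:~R * mpow s n%:R.
    by rewrite [RHS]big_mkcond; apply: eq_bigr => n _; case: ifP => // _; exact: mul0r.
  rewrite big_multiples //.
  rewrite [LHS]big_seq_cond [RHS]big_seq_cond; apply: eq_bigr => j /andP[+ _].
  rewrite mem_index_iota => /andP[j0 _].
  by rewrite natrM mpowM ?ltr0n.
rewrite (eq_big_nat _ _ E) exchange_big /=.
have F n : (1 <= n < N)%N ->
    \sum_(1 <= i < N) (if (i %| n)%N then (moebius i)%:~R else 0) * mpow s n%:R =
    (n == 1%N)%:R * mpow s n%:R :> R[i].
  move=> /andP[n0 nN]; rewrite -mulr_suml -big_mkcond /= -rmorph_sum.
  by rewrite sum_moebius_divisors ?n0 // rmorph_nat.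
rewrite (eq_big_nat _ _ F) big_ltn //= mul1r mpow1x big1_seq ?addr0 // => n.
rewrite mem_index_iota => /andP[_ /andP[n2 _]].
by case: eqP n2 => [->//|_ _]; exact: mul0r.
Qed.

(** The product of the partial sums differs from 1 by the terms with i j >= N;
    these all lie outside of the square [1, K) x [1, K). *)
Lemma moebius_zeta_error K N s : 1 < complex.Re s -> (1 < N)%N -> (K * K <= N)%N ->
  cabs (moebius_sum N s * zeta_sum N s - 1) <=
  zetar (complex.Re s) ^+ 2 - zetar_sum K (complex.Re s) ^+ 2.
Proof.
move=> s1 N1 KN; set c := complex.Re s.
pose a n := expR (- (c * ln n%:R)) : R.
have a0 n : 0 <= a n by exact: expR_ge0.
have E : moebius_sum N s * zeta_sum N s - 1 =
  \sum_(1 <= i < N) \sum_(1 <= j < N | ~~ (i * j < N)%N)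
    (moebius i)%:~R * (mpow s i%:R * mpow s j%:R).
  rewrite -[X in _ - X](moebius_hyperbola s N1) /moebius_sum /zeta_sum mulr_suml -sumrB.
  apply: eq_bigr => i _; rewrite mulr_sumr (bigID (fun j => i * j < N)%N) /=.
  rewrite [X in X + _ - _](_ : _ = \sum_(1 <= j < N | (i * j < N)%N)
    (moebius i)%:~R * (mpow s i%:R * mpow s j%:R)); last first.
    by apply: eq_bigr => j _; rewrite mulrA.
  by rewrite addrAC subrr add0r; apply: eq_bigr => j _; rewrite mulrA.
rewrite E; apply: le_trans (cabs_sum_le _ _ _) _.
apply: (@le_trans _ _ (\sum_(1 <= i < N) \sum_(1 <= j < N | ~~ (i * j < N)%N) a i * a j)).
  apply: ler_sum => i _; apply: le_trans (cabs_sum_le _ _ _) _.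
  apply: ler_sum => j _.
  rewrite cabsM cabsM !cabs_mpow -/(a i) -/(a j) ler_piMl ?mulr_ge0 //.
  exact: normr_moebius.
have sq : zetar_sum N c ^+ 2 = \sum_(1 <= i < N) \sum_(1 <= j < N) a i * a j.
  by rewrite expr2 /zetar_sum mulr_suml; apply: eq_bigr => i _; rewrite mulr_sumr.
have split2 : zetar_sum N c ^+ 2 =
   \sum_(1 <= i < N) \sum_(1 <= j < N | (i * j < N)%N) a i * a j +
   \sum_(1 <= i < N) \sum_(1 <= j < N | ~~ (i * j < N)%N) a i * a j.
  rewrite sq -big_split; apply: eq_bigr => i _.
  by rewrite (bigID (fun j => i * j < N)%N).
have lo : zetar_sum K c ^+ 2 <=
   \sum_(1 <= i < N) \sum_(1 <= j < N | (i * j < N)%N) a i * a j.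
  have KN' : (K <= N)%N by case: (K) KN => // k; apply: leq_trans; rewrite leq_pmulr.
  rewrite expr2 /zetar_sum mulr_suml (big_nat_widen _ _ _ _ _ KN') big_mkcond /=.
  rewrite big_nat_cond [leRHS]big_nat_cond; apply: ler_sum => i.
  rewrite andbT => /andP[i0 iN]; case: ifPn => [iK|_]; last first.
    by apply: sumr_ge0 => j _; rewrite mulr_ge0.
  rewrite mulr_sumr (big_nat_widen _ _ _ _ _ KN') /=.
  rewrite big_mkcond [leRHS]big_mkcond; apply: ler_sum => j _.
  case: ifPn => [jK|_]; last by case: ifP => // _; rewrite mulr_ge0.
  rewrite ifT //; apply: leq_trans KN.
  by apply: ltn_mul.
have hi : zetar_sum N c ^+ 2 <= zetar c ^+ 2.
  rewrite lerXn2r ?nnegrE ?zetar_sum_ge0 ?zetar_sum_le //.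
  exact: le_trans (zetar_sum_ge0 N c) (zetar_sum_le N s1).
by lra.
Qed.

(** Zeta cannot vanish, since the partial Moebius sums stay bounded while their
    product with the partial zeta sums tends to 1. *)
Lemma moebius_zeta s : 1 < complex.Re s ->
  zetac s != 0 /\ ccvg (moebius_sum ^~ s) (zetac s)^-1.
Proof.
move=> s1; set c := complex.Re s.
have h : ccvg (fun N => moebius_sum N s * zeta_sum N s) 1.
  apply/ccvgP/ge0_cvg0P => [n|e e0]; first exact: cabs_ge0.
  have : (fun K => zetar c ^+ 2 - zetar_sum K c ^+ 2) @ \oo --> zetar c ^+ 2 - zetar c ^+ 2.
    apply: cvgB; first exact: cvg_cst.
    by apply: cvgM; exact: zetar_cvg.
  rewrite subrr => /cvgrPdist_lt /(_ _ e0) [K _ hK].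
  exists (maxn 2 (K * K)) => N; rewrite geq_max => /andP[N1 KN].
  apply: le_lt_trans (moebius_zeta_error s1 N1 KN) _.
  have := hK K (leqnn K) => /=; rewrite sub0r normrN; apply: le_lt_trans.
  exact: ler_norm.
have Z := zeta_cvg s1.
have Z0 : zetac s != 0.
  apply/eqP => z0; rewrite z0 in Z.
  have h0 : ccvg (fun N => moebius_sum N s * zeta_sum N s) 0.
    have /ccvgP Z' := Z.
    apply: (ccvg_squeeze (e := fun N => zetar c * cabs (zeta_sum N s - 0))).
      move=> N; rewrite !subr0 cabsM ler_wpM2r ?cabs_ge0 //.
      exact: cabs_moebius_sum.
    by rewrite -(mulr0 (zetar c)); exact: cvg_seqMl.
  by have /eqP := ccvg_unique h0 h; rewrite eq_sym oner_eq0.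
split; first exact: Z0.
have Zv := ccvgV Z Z0.
have [N0 hN0] : exists N0, forall n, (N0 <= n)%N -> zeta_sum n s != 0.
  have /ccvgP := Z; rewrite ge0_cvg0P => [Z'|n]; last exact: cabs_ge0.
  have [|N hN] := Z' (cabs (zetac s)); first by rewrite cabs_gt0.
  exists N => n /hN; apply: contraTneq => ->.
  by rewrite sub0r cabsN ltxx.
apply: (eq_ccvg N0 (fun N => moebius_sum N s * zeta_sum N s * (zeta_sum N s)^-1)).
  by move=> n /hN0 n0; rewrite mulfK.
by rewrite -[X in ccvg _ X]mul1r; exact: ccvgM h Zv.
Qed.

End MoebiusZeta.

(** * Exchange of integrals *)

Section RealFubini.
Context d1 d2 (T1 : measurableType d1) (T2 : measurableType d2) (R : realType).
Variable m1 : {sigma_finite_measure set T1 -> \bar R}.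
Variable m2 : {sigma_finite_measure set T2 -> \bar R}.
Variables (f : T1 * T2 -> R) (h : T1 -> R) (k : T2 -> R).
Hypothesis mf : measurable_fun setT f.
Hypothesis h0 : forall x, 0 <= h x.
Hypothesis k0 : forall y, 0 <= k y.
Hypothesis ih : m1.-integrable setT (EFin \o h).
Hypothesis ik : m2.-integrable setT (EFin \o k).
Hypothesis fhk : forall x y, `|f (x, y)| <= h x * k y.

Lemma integrable_sectionl x : m2.-integrable setT (EFin \o (fun y => f (x, y))).
Proof.
apply: le_integrable (integrableZl (mu := m2) _ (h x) ik) => //.
  by apply/measurable_EFinP; exact: (measurableT_comp mf).
by move=> y _ /=; rewrite lee_fin (le_trans (fhk _ _)) // ler_norm.
Qed.

Lemma integrable_sectionr y : m1.-integrable setT (EFin \o (fun x => f (x, y))).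
Proof.
apply: le_integrable (integrableZl (mu := m1) _ (k y) ih) => //.
  by apply/measurable_EFinP; exact: (measurableT_comp mf).
by move=> x _ /=; rewrite lee_fin mulrC (le_trans (fhk _ _)) // ler_norm.
Qed.

Lemma integrable_prod_bound : (m1 \x m2)%E.-integrable setT (EFin \o f).
Proof.
apply/integrable12ltyP; first exact/measurable_EFinP.
pose K := \int[m2]_y k y.
have KE : (\int[m2]_y (k y)%:E = K%:E)%E.
  by rewrite /K /Rintegral fineK // integrable_fin_num.
have mk := measurable_int m2 ik.
have ihK := integrableZl (mu := m1) measurableT K ih.
apply: le_lt_trans (integrable_lty measurableT ihK).
have mabs : measurable_fun setT (abse \o (EFin \o f)).
  by apply: measurableT_comp => //; exact/measurable_EFinP.
apply: ge0_le_integral => //.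
- by move=> x _; apply: integral_ge0.
- by apply: (measurable_fun_fubini_tonelli_F (abse \o (EFin \o f))) => //=.
- exact: measurable_int ihK.
move=> x _; rewrite muleC -KE -ge0_integralZl //; last first.
- by rewrite lee_fin.
- by move=> y _; rewrite lee_fin.
apply: ge0_le_integral => //.
- apply/measurableT_comp => //; apply/measurable_EFinP.
  exact: (measurableT_comp mf).
- by apply: emeasurable_funM => //; exact: measurable_cst.
- by move=> y _; rewrite lee_fin.
Qed.

Lemma Rintegral_Fubini :
  m1.-integrable setT (EFin \o (fun x => \int[m2]_y f (x, y))) /\
  \int[m1]_x \int[m2]_y f (x, y) = \int[m2]_y \int[m1]_x f (x, y).
Proof.
have if2 := integrable_prod_bound.
have E1 x : (\int[m2]_y (f (x, y))%:E = (\int[m2]_y f (x, y))%:E)%E.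
  by rewrite /Rintegral fineK // integrable_fin_num //; exact: integrable_sectionl.
have E2 y : (\int[m1]_x (f (x, y))%:E = (\int[m1]_x f (x, y))%:E)%E.
  by rewrite /Rintegral fineK // integrable_fin_num //; exact: integrable_sectionr.
have F1 : EFin \o (fun x => \int[m2]_y f (x, y)) = fubini_F m2 (EFin \o f).
  by apply/funext => x; rewrite /= -E1.
have i1 := integrable_fubini_F if2.
split; first by rewrite F1.
rewrite /Rintegral; congr fine.
under eq_integral do rewrite -E1.
under [RHS]eq_integral do rewrite -E2.
exact: (Fubini if2).
Qed.

End RealFubini.

Section ComplexFubini.
Context {R : realType}.
Notation mu := (@lebesgue_measure R).

Lemma cintegral_Fubini (F : R -> R -> R[i]) (h k : R -> R) :
  cmeas setT (fun z : R * R => F z.1 z.2) ->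
  (forall x, 0 <= h x) -> (forall y, 0 <= k y) ->
  mu.-integrable setT (EFin \o h) -> mu.-integrable setT (EFin \o k) ->
  (forall x y, cabs (F x y) <= h x * k y) ->
  cintegrable setT (fun x => cintegral setT (F x)) /\
  cintegral setT (fun x => cintegral setT (F x)) =
    cintegral setT (fun y => cintegral setT (F ^~ y)).
Proof.
move=> [m1 m2] h0 k0 ih ik Fhk.
have [i1 e1] := @Rintegral_Fubini _ _ _ _ R mu mu
  (fun z => complex.Re (F z.1 z.2)) h k m1 h0 k0 ih ik
  (fun x y => le_trans (normr_Re_le _) (Fhk x y)).
have [i2 e2] := @Rintegral_Fubini _ _ _ _ R mu mu
  (fun z => complex.Im (F z.1 z.2)) h k m2 h0 k0 ih ik
  (fun x y => le_trans (normr_Im_le _) (Fhk x y)).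
split; first by split; [exact: i1|exact: i2].
by apply: complex_ext; [exact: e1|exact: e2].
Qed.

End ComplexFubini.

(** * Inverse Mellin integrals on a line *)

Section MellinLine.
Context {R : realType}.
Implicit Types (c x a : R) (p q m : R -> R[i]) (g : R -> R).
Notation mu := (@lebesgue_measure R).

(** The inverse Mellin integral on the line of abscissa c, as a function of the
    density p on that line. Every operator below acts on it by a multiplier. *)
Definition mellin_line c p x : R[i] :=
  ((2 * pi)^-1)%:C * cintegral setT (fun t => mpow (c +i* t) x * p t).

Lemma inverse_mellinE c (fs : R[i] -> R[i]) x : 0 < x ->
  inverse_mellin c fs x = mellin_line c (fun t => fs (c +i* t)) x.
Proof.
move=> x0; rewrite /inverse_mellin /line_integral /mellin_line mulrA; congr (_ * _).
  have i0 : (0 +i* 1 : R[i]) != 0.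
    by apply/negP => /eqP [/eqP]; rewrite oner_eq0.
  have p0 : (pi%:C : R[i]) != 0 by rewrite (fmorph_eq0 (real_complex R)) gt_eqF ?pi_gt0.
  rewrite fmorphV rmorphM /= rmorph_nat.
  by move: (pi%:C : R[i]) (0 +i* 1 : R[i]) p0 i0 => P I p0 i0; field; rewrite i0 p0.
by apply: eq_cintegral => t _; rewrite cpow_mpow // mulrC.
Qed.

Lemma measurable_line_im (D : set R) c : cmeas D (fun t => c +i* t).
Proof. by apply: cmeas_pair. Qed.

Lemma cmeas_mpow_line (D : set R) c x : cmeas D (fun t => mpow (c +i* t) x).
Proof. by apply: cmeas_mpow; [exact: measurable_line_im|exact: measurable_cst]. Qed.

Lemma cintegrable_mellin c p x : cintegrable setT p ->
  cintegrable setT (fun t => mpow (c +i* t) x * p t).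
Proof.
move=> ip; apply: (cintegrableM (C := expR (- (c * ln x)))) => //.
  exact: cmeas_mpow_line.
by move=> t _; rewrite cabs_mpow.
Qed.

Lemma eq_mellin_line c p q x : (forall t, p t = q t) ->
  mellin_line c p x = mellin_line c q x.
Proof. by move=> pq; have -> : p = q by exact/funext. Qed.

(** The kernel has constant modulus on the line, so bounded pointwise convergence
    of multipliers is dominated. *)
Lemma mellin_line_cvg c p x (m_ : nat -> R -> R[i]) m (C : R) :
  cintegrable setT p -> (forall n, cmeas setT (m_ n)) ->
  (forall n t, cabs (m_ n t) <= C) -> (forall t, ccvg (m_ ^~ t) (m t)) ->
  ccvg (fun n => mellin_line c (fun t => m_ n t * p t) x)
    (mellin_line c (fun t => m t * p t) x).
Proof.
move=> ip mm mC mt; apply: ccvgZ.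
have iq := cintegrable_mellin c x ip.
have ia := cintegrable_cabs measurableT iq.
have E n t : mpow (c +i* t) x * (m_ n t * p t) = m_ n t * (mpow (c +i* t) x * p t).
  by ring.
have iC := integrableZl (mu := mu) measurableT C ia.
have bound n t : setT t -> cabs (mpow (c +i* t) x * (m_ n t * p t)) <=
    C * cabs (mpow (c +i* t) x * p t).
  by move=> _; rewrite E cabsM ler_wpM2r ?cabs_ge0.
have meas n : cmeas setT (fun t => mpow (c +i* t) x * (m_ n t * p t)).
  apply: cmeasM; first exact: cmeas_mpow_line.
  by apply: cmeasM; [exact: mm|exact: cintegrable_cmeas ip].
have lim t : setT t -> ccvg (fun n => mpow (c +i* t) x * (m_ n t * p t))
    (mpow (c +i* t) x * (m t * p t)).
  by move=> _; apply: ccvgZ; apply: ccvgM (mt t) (ccvg_cst (p t)).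
by have [_ h] := cintegral_dominated measurableT meas lim iC bound.
Qed.

Lemma mellin_lineD c p q x : cintegrable setT p -> cintegrable setT q ->
  mellin_line c (fun t => p t + q t) x = mellin_line c p x + mellin_line c q x.
Proof.
move=> ip iq; rewrite /mellin_line -mulrDr -cintegralD //.
- by congr (_ * _); apply: eq_cintegral => t _; rewrite mulrDr.
- exact: cintegrable_mellin.
- exact: cintegrable_mellin.
Qed.

Lemma mellin_lineZ c p x (z : R[i]) : cintegrable setT p ->
  mellin_line c (fun t => z * p t) x = z * mellin_line c p x.
Proof.
move=> ip; rewrite /mellin_line [RHS]mulrCA; congr (_ * _).
rewrite -cintegralZ //; last exact: cintegrable_mellin.
by apply: eq_cintegral => t _; rewrite mulrCA.
Qed.

Lemma mellin_line_scale c p x a : 0 < x -> 0 < a ->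
  mellin_line c p (x * a) = mellin_line c (fun t => mpow (c +i* t) a * p t) x.
Proof.
move=> x0 a0; rewrite /mellin_line; congr (_ * _).
by apply: eq_cintegral => t _; rewrite mpowM // mulrA.
Qed.

(** Turns the partial sums of the inversion series into multipliers, on which
    the limit is then taken. *)
Lemma mellin_line_dilations c p x (z : nat -> R[i]) (a : nat -> R) N : 0 < x ->
  (forall n, (0 < n)%N -> 0 < a n) -> cintegrable setT p ->
  \sum_(1 <= n < N) z n * mellin_line c p (x * a n) =
  mellin_line c (fun t => (\sum_(1 <= n < N) z n * mpow (c +i* t) (a n)) * p t) x.
Proof.
move=> x0 a0 ip.
have iq n : cintegrable setT (fun t => z n * (mpow (c +i* t) (a n) * p t)).
  by apply: cintegrableZ => //; exact: cintegrable_mellin.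
have zero : mellin_line c (fun=> 0) x = 0.
  by rewrite (@eq_mellin_line _ _ (fun t => 0 * p t)) ?mellin_lineZ ?mul0r // => t; rewrite mul0r.
have int0 : cintegrable setT (fun=> 0 : R[i]) by split; exact: integrable0.
suff [_ ->] : cintegrable setT (fun t => (\sum_(1 <= n < N) z n * mpow (c +i* t) (a n)) * p t) /\
  \sum_(1 <= n < N) z n * mellin_line c p (x * a n) =
  mellin_line c (fun t => (\sum_(1 <= n < N) z n * mpow (c +i* t) (a n)) * p t) x by [].
elim: N => [|[|N] [ih1 ih2]].
- rewrite big_geq //; split.
    by apply: eq_cintegrable int0 => // t _; rewrite big_geq // mul0r.
  by rewrite -[LHS]zero; apply: eq_mellin_line => t; rewrite big_geq // mul0r.
- rewrite big_geq //; split.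
    by apply: eq_cintegrable int0 => // t _; rewrite big_geq // mul0r.
  by rewrite -[LHS]zero; apply: eq_mellin_line => t; rewrite big_geq // mul0r.
have E t : (\sum_(1 <= n < N.+2) z n * mpow (c +i* t) (a n)) * p t =
  (\sum_(1 <= n < N.+1) z n * mpow (c +i* t) (a n)) * p t +
  z N.+1 * (mpow (c +i* t) (a N.+1) * p t).
  by rewrite big_nat_recr //= mulrDl mulrA.
split.
  by apply: eq_cintegrable (cintegrableD measurableT ih1 (iq N.+1)).
rewrite big_nat_recr //= ih2 (eq_mellin_line _ _ E) mellin_lineD // mellin_lineZ //.
  by rewrite mellin_line_scale ?a0.
exact: cintegrable_mellin.
Qed.

(** Fubini applies because |u^(-s)| depends on u only, so that the double integral
    is dominated by a product. *)
Lemma mellin_line_kernel c p (K : R -> R) : measurable_fun setT K ->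
  (forall u, 0 < u -> 0 <= K u) ->
  mu.-integrable `]0, +oo[ (EFin \o (fun u => expR (- (c * ln u)) * K u)) ->
  cintegrable setT p ->
  cintegrable `]0, +oo[ (fun u => (K u)%:C * mellin_line c p u) /\
  cintegral `]0, +oo[ (fun u => (K u)%:C * mellin_line c p u) =
  ((2 * pi)^-1)%:C * cintegral setT
    (fun t => cintegral `]0, +oo[ (fun u => (K u)%:C * mpow (c +i* t) u) * p t).
Proof.
move=> mK K0 iK ip; pose J : set R := `]0, +oo[%classic.
have mJ : measurable J by exact: measurable_itv.
pose K' u := \1_J u * K u.
have K'0 u : 0 <= K' u.
  rewrite /K' indicE; case: (boolP (u \in J)) => [/set_mem/Rpos_gt0 u0|_].
    by rewrite mul1r K0.
  by rewrite mul0r.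
have mK' : measurable_fun setT K'.
  by apply: measurable_funM => //; exact: measurable_indic.
pose F u t := (K' u)%:C * (mpow (c +i* t) u * p t).
pose h u := expR (- (c * ln u)) * K' u.
have ih : mu.-integrable setT (EFin \o h).
  move/(integrable_mkcond (mu := mu) _ mJ) : iK; apply: eq_integrable => // u _.
  rewrite /h /K' /patch /= indicE; case: ifP => _; first by rewrite mul1r.
  by rewrite mul0r mulr0.
have [h1 h2] : cintegrable setT (fun u => cintegral setT (F u)) /\
  cintegral setT (fun u => cintegral setT (F u)) =
  cintegral setT (fun t => cintegral setT (F ^~ t)).
  apply: (cintegral_Fubini (h := h) (k := fun t => cabs (p t))) => //.
  - apply: cmeasM.
      by apply: cmeas_real; exact: (measurableT_comp mK' measurable_fst).
    apply: cmeasM; last exact: (cmeas_comp (cintegrable_cmeas ip) measurable_snd).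
    by apply: cmeas_mpow; [apply: cmeas_pair|].
  - by move=> u; rewrite mulr_ge0 ?expR_ge0.
  - by move=> t; exact: cabs_ge0.
  - exact: cintegrable_cabs.
  - move=> u t; rewrite /F cabsM cabs_real cabsM cabs_mpow ger0_norm // /h.
    by rewrite mulrA [K' u * _]mulrC.
have E u : ((2 * pi)^-1)%:C * cintegral setT (F u) =
    if u \in J then (K u)%:C * mellin_line c p u else 0.
  have -> : cintegral setT (F u) =
      (K' u)%:C * cintegral setT (fun t => mpow (c +i* t) u * p t).
    exact: (cintegralZ (K' u)%:C measurableT (cintegrable_mellin c u ip)).
  rewrite /K' indicE /mellin_line; case: ifP => _.
    by rewrite mul1r mulrCA.
  by rewrite mul0r mul0r mulr0.
have E2 t : cintegral setT (F ^~ t) =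
    cintegral `]0, +oo[ (fun u => (K u)%:C * mpow (c +i* t) u) * p t.
  have iKm : cintegrable `]0, +oo[ (fun u => (K u)%:C * mpow (c +i* t) u).
    apply: (cintegrable_le mJ _ iK).
      apply: cmeasM; last exact: cmeas_mpowx.
      exact: (cmeasS measurableT (@subsetT _ _) (cmeas_real mK)).
    move=> u /Rpos_gt0 u0; rewrite cabsM cabs_real cabs_mpow mulrC.
    by rewrite ger0_norm ?K0.
  rewrite mulrC; apply: etrans (cintegralZ (p t) mJ iKm).
  apply: etrans (esym (cintegral_mkcond _ _)).
  apply: eq_cintegral => u _; rewrite /F /K' indicE -/J.
  case: ifP => _; last by rewrite mul0r mul0r.
  by rewrite mul1r; ring.
have iZ := cintegrableZ ((2 * pi)^-1)%:C measurableT h1.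
split.
  apply/(cintegrable_mkcond _ mJ).
  by apply: (eq_cintegrable measurableT _ iZ) => u _; rewrite E.
have -> : cintegral `]0, +oo[ (fun u => (K u)%:C * mellin_line c p u) =
    cintegral setT (fun u => ((2 * pi)^-1)%:C * cintegral setT (F u)).
  apply: etrans (cintegral_mkcond _ _) _.
  by apply: eq_cintegral => u _; rewrite E.
rewrite (cintegralZ _ measurableT h1); congr (_ * _); apply: (etrans h2).
by apply: eq_cintegral => t _; exact: E2.
Qed.

End MellinLine.

(** * Differentiation of inverse Mellin integrals *)

Section MellinLineDerivative.
Context {R : realType}.
Implicit Types (c x a : R) (p q : R -> R[i]) (F : R -> R[i]).
Notation mu := (@lebesgue_measure R).

Lemma isd_near (f g : R -> R) x a : 0 < x -> (forall y, 0 < y -> f y = g y) ->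
  isd g x a -> isd f x a.
Proof.
move=> x0 fg; apply: near_eq_is_derive.
by near=> y; rewrite fg //; near: y; exact: lt_nbhsr.
Unshelve. all: by end_near. Qed.

Lemma isd_under_integral (f f' : R -> R -> R) (G : R -> R) a u v :
  u < a < v ->
  (forall x, u < x < v -> mu.-integrable setT (EFin \o f x)) ->
  (forall x t, u < x < v -> isd (f ^~ t) x (f' x t)) ->
  (forall t, 0 <= G t) -> mu.-integrable setT (EFin \o G) ->
  (forall x t, u < x < v -> `|f' x t| <= G t) ->
  isd (fun x => \int[mu]_t f x t) a (\int[mu]_t f' a t).
Proof.
move=> uav intf df G0 iG fG.
have I x : `]u, v[%classic x -> u < x < v by rewrite /= in_itv.
have h1 := @derivable_under_integral R _ _ mu f setT measurableT a u v uav
  (fun x Ix => intf x (I x Ix)) (fun x t Ix _ => isd_derivable (df x t (I x Ix)))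
  G G0 iG.
have h2 := @differentiation_under_integral R _ _ mu f setT measurableT a u v uav
  (fun x Ix => intf x (I x Ix)) (fun x t Ix _ => isd_derivable (df x t (I x Ix)))
  G G0 iG.
have bd x t : `]u, v[%classic x -> setT t -> `|partial1of2 f x t| <= G t.
  by move=> /I Ix _; rewrite /partial1of2 (isd_derive1 (df x t Ix)) fG.
apply: (isd_eq (derivableP (h1 bd))).
rewrite -derive1E (h2 bd); apply: eq_Rintegral => t _.
by rewrite /partial1of2 (isd_derive1 (df a t uav)).
Qed.

Lemma line_add1 c (t : R) : (c + 1) +i* t = c +i* t + 1.
Proof. by apply: complex_ext; rewrite ?cReD ?cImD /= ?addr0. Qed.

(** The derivative of the kernel is bounded on a neighbourhood of x by its
    value at x / 2, which dominates as soon as s p(s) is integrable. *)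
Lemma mellin_line_isd c p x : 0 < c -> 0 < x -> cintegrable setT p ->
  cintegrable setT (fun t => (c +i* t) * p t) ->
  isd (fun y => complex.Re (mellin_line c p y)) x
    (complex.Re (mellin_line (c + 1) (fun t => - (c +i* t) * p t) x)) /\
  isd (fun y => complex.Im (mellin_line c p y)) x
    (complex.Im (mellin_line (c + 1) (fun t => - (c +i* t) * p t) x)).
Proof.
move=> c0 x0 ip isp.
pose G t := expR (- ((c + 1) * ln (x / 2))) * cabs ((c +i* t) * p t).
have G0 t : 0 <= G t by rewrite mulr_ge0 ?expR_ge0 ?cabs_ge0.
have iG : mu.-integrable setT (EFin \o G).
  exact: (integrableZl (mu := mu) measurableT _ (cintegrable_cabs measurableT isp)).
have xI : x / 2 < x < 2 * x by lra.
have pos y : x / 2 < y < 2 * x -> 0 < y.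
  by move=> /andP[h _]; apply: lt_trans h; rewrite divr_gt0.
pose D y t := p t * (- (c +i* t) * mpow (c +i* t + 1) y).
have DG y t : x / 2 < y < 2 * x -> cabs (D y t) <= G t.
  move=> yI; have y0 := pos y yI.
  have -> : D y t = - (mpow (c +i* t + 1) y * ((c +i* t) * p t)) by rewrite /D; ring.
  rewrite cabsN cabsM ler_wpM2r ?cabs_ge0 // cabs_mpow cReD.
  rewrite ler_expR lerN2 ler_wpM2l ?addr_ge0 ?(ltW c0) //.
  rewrite ler_ln ?posrE ?divr_gt0 //; by case/andP: yI => /ltW.
have iT y : cintegrable setT (fun t => p t * mpow (c +i* t) y).
  by apply: (eq_cintegrable measurableT _ (cintegrable_mellin c y ip)) => t _; rewrite mulrC.
have h1 : isd (fun y => \int[mu]_t complex.Re (p t * mpow (c +i* t) y)) x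
    (\int[mu]_t complex.Re (D x t)).
  apply: (@isd_under_integral (fun y t => complex.Re (p t * mpow (c +i* t) y))
    (fun y t => complex.Re (D y t)) G x _ _ xI) => //.
  - by move=> y _; have [] := iT y.
  - by move=> y t yI; have [] := isd_Zmpow (p t) (c +i* t) (pos y yI).
  - by move=> y t yI; apply: le_trans (normr_Re_le _) (DG y t yI).
have h2 : isd (fun y => \int[mu]_t complex.Im (p t * mpow (c +i* t) y)) x
    (\int[mu]_t complex.Im (D x t)).
  apply: (@isd_under_integral (fun y t => complex.Im (p t * mpow (c +i* t) y))
    (fun y t => complex.Im (D y t)) G x _ _ xI) => //.
  - by move=> y _; have [] := iT y.
  - by move=> y t yI; have [] := isd_Zmpow (p t) (c +i* t) (pos y yI).
  - by move=> y t yI; apply: le_trans (normr_Im_le _) (DG y t yI).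
have E y : mellin_line c p y =
    ((2 * pi)^-1)%:C * cintegral setT (fun t => p t * mpow (c +i* t) y).
  by congr (_ * _); apply: eq_cintegral => t _; rewrite mulrC.
have E' : mellin_line (c + 1) (fun t => - (c +i* t) * p t) x =
    ((2 * pi)^-1)%:C * cintegral setT (D x).
  congr (_ * _); apply: eq_cintegral => t _; rewrite /D line_add1.
  by ring.
have Zre (k : R) (z : R[i]) : complex.Re (k%:C * z) = k * complex.Re z.
  by rewrite cReM cRe_real cIm_real mul0r subr0.
have Zim (k : R) (z : R[i]) : complex.Im (k%:C * z) = k * complex.Im z.
  by rewrite cImM cRe_real cIm_real mul0r addr0.
split.
  rewrite E' Zre; under eq_fun do rewrite E Zre.
  exact: isdZ h1.
rewrite E' Zim; under eq_fun do rewrite E Zim.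
exact: isdZ h2.
Qed.

(** What allows the inverse Mellin integral to be differentiated any number of
    times. *)
Definition rapid p : Prop := forall j, cintegrable setT (fun t => t%:C ^+ j * p t).

Lemma rapid_cintegrable p : rapid p -> cintegrable setT p.
Proof.
by move=> /(_ 0%N); apply: (eq_cintegrable measurableT) => t _; rewrite expr0 mul1r.
Qed.

Lemma rapid_linear p (a b : R[i]) : rapid p -> rapid (fun t => (a + b * t%:C) * p t).
Proof.
move=> rp j.
have h1 := cintegrableZ a measurableT (rp j).
have h2 := cintegrableZ b measurableT (rp j.+1).
apply: (eq_cintegrable measurableT _ (cintegrableD measurableT h1 h2)) => t _.
by rewrite exprS; ring.
Qed.

Lemma line_linear c (t : R) : c +i* t = c%:C + 'i * t%:C.
Proof. by apply: complex_ext; rewrite !(cReD, cImD, cReM, cImM) /= ; ring. Qed.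

Lemma rapid_line p c (a b : R[i]) : rapid p -> rapid (fun t => (a + b * (c +i* t)) * p t).
Proof.
move=> rp; have h := rapid_linear (a + b * c%:C) (b * 'i) rp.
by move=> j; apply: (eq_cintegrable measurableT _ (h j)) => t _; rewrite line_linear; ring.
Qed.

Lemma cderive_mellin_line c p F x : 0 < c -> rapid p -> 0 < x ->
  (forall y, 0 < y -> F y = mellin_line c p y) ->
  cderivable F x /\
  cderive F x = mellin_line (c + 1) (fun t => - (c +i* t) * p t) x.
Proof.
move=> c0 rp x0 FE.
have isp : cintegrable setT (fun t => (c +i* t) * p t).
  have h := rapid_cintegrable (rapid_line c 0 1 rp).
  by apply: (eq_cintegrable measurableT _ h) => t _; rewrite add0r mul1r.
have [h1 h2] := mellin_line_isd c0 x0 (rapid_cintegrable rp) isp.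
have k1 : isd (fun y => complex.Re (F y)) x
    (complex.Re (mellin_line (c + 1) (fun t => - (c +i* t) * p t) x)).
  by apply: (isd_near x0 _ h1) => y y0; rewrite FE.
have k2 : isd (fun y => complex.Im (F y)) x
    (complex.Im (mellin_line (c + 1) (fun t => - (c +i* t) * p t) x)).
  by apply: (isd_near x0 _ h2) => y y0; rewrite FE.
split; first by split; [exact: isd_derivable k1|exact: isd_derivable k2].
by apply: complex_ext; [exact: isd_derive1 k1|exact: isd_derive1 k2].
Qed.

Lemma mellin_line_smooth c p F n : 0 < c -> rapid p ->
  (forall y, 0 < y -> F y = mellin_line c p y) -> derivable_upto_Rpos n F.
Proof.
move=> c0 rp FE.
have step i : exists2 q, rapid q &
    forall y, 0 < y -> iter i cderive F y = mellin_line (c + i%:R) q y.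
  elim: i => [|i [q rq qE]]; first by exists p => // y y0; rewrite addr0; exact: FE.
  have ci0 : 0 < c + i%:R by rewrite ltr_wpDr.
  exists (fun t => - ((c + i%:R) +i* t) * q t).
    have h := rapid_line (c + i%:R) 0 (-1) rq.
    by move=> j; apply: (eq_cintegrable measurableT _ (h j)) => t _; rewrite add0r mulN1r.
  move=> y y0; rewrite iterS; have [_ ->] := cderive_mellin_line ci0 rq y0 qE.
  by rewrite -addrA natr1.
move=> i x _ x0; have [q rq qE] := step i.
have ci0 : 0 < c + i%:R by rewrite ltr_wpDr.
by have [] := cderive_mellin_line ci0 rq x0 qE.
Qed.

Lemma mellin_line_shift c p x : 0 < x -> cintegrable setT p ->
  x%:C * mellin_line (c + 1) p x = mellin_line c p x.
Proof.
move=> x0 ip; rewrite -mellin_lineZ //; congr (_ * _); apply: eq_cintegral => t _.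
rewrite line_add1 mpowD mpow1 // -mulrA; congr (_ * _).
by rewrite mulrA -rmorphM mulVf ?gt_eqF // rmorph1 mul1r.
Qed.

Lemma euler_factor_mellin_line c p F j : 0 < c -> rapid p ->
  (forall y, 0 < y -> F y = mellin_line c p y) ->
  forall y, 0 < y -> euler_factor j F y =
    mellin_line c (fun t => (1 + j%:R^-1 * (c +i* t)) * p t) y.
Proof.
move=> c0 rp FE y y0; have ip := rapid_cintegrable rp.
have [_ dE] := cderive_mellin_line c0 rp y0 FE.
have isp : cintegrable setT (fun t => (c +i* t) * p t).
  have h := rapid_cintegrable (rapid_line c 0 1 rp).
  by apply: (eq_cintegrable measurableT _ h) => t _; rewrite add0r mul1r.
have insp : cintegrable setT (fun t => - (c +i* t) * p t).
  have h := cintegrableZ (-1) measurableT isp.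
  by apply: (eq_cintegrable measurableT _ h) => t _; rewrite mulN1r mulNr.
rewrite /euler_factor dE FE // rmorphM [y%:C * _]mulrC -mulrA mellin_line_shift //.
rewrite fmorphV rmorph_nat -mellin_lineZ // -mulN1r -mellin_lineZ; last first.
  exact: cintegrableZ.
rewrite -mellin_lineD //; last by apply: cintegrableZ => //; exact: cintegrableZ.
by apply: eq_mellin_line => t; ring.
Qed.

Lemma euler_factors_mellin_line c p F (l : seq nat) : 0 < c -> rapid p ->
  (forall y, 0 < y -> F y = mellin_line c p y) ->
  rapid (fun t => (\prod_(j <- l) (1 + j%:R^-1 * (c +i* t))) * p t) /\
  forall y, 0 < y -> foldr euler_factor F l y =
    mellin_line c (fun t => (\prod_(j <- l) (1 + j%:R^-1 * (c +i* t))) * p t) y.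
Proof.
move=> c0 rp FE; elim: l => [|j l [rq qE]].
  split=> [i|y y0]; last first.
    by rewrite [LHS]FE //; apply: eq_mellin_line => t; rewrite big_nil mul1r.
  by apply: (eq_cintegrable measurableT _ (rp i)) => t _; rewrite big_nil mul1r.
have E t : (1 + j%:R^-1 * (c +i* t)) *
    ((\prod_(j <- l) (1 + j%:R^-1 * (c +i* t))) * p t) =
  (\prod_(j <- j :: l) (1 + j%:R^-1 * (c +i* t))) * p t.
  by rewrite big_cons mulrA.
split=> [i|y y0].
  have h := rapid_line c 1 j%:R^-1 rq i.
  by apply: (eq_cintegrable measurableT _ h) => t _; rewrite E.
by rewrite [LHS](euler_factor_mellin_line _ c0 rq qE) //; apply: eq_mellin_line.
Qed.

Lemma prod_euler k (s : R[i]) :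
  s * \prod_(j <- iota 1 k) (1 + j%:R^-1 * s) = rising k.+1 s / k`!%:R.
Proof.
elim: k => [|k ih].
  by rewrite big_nil /rising big_ord_recr big_ord0 /= fact0 addr0 mul1r mulr1 divr1.
have -> : iota 1 k.+1 = iota 1 k ++ iota (1 + k) 1 by rewrite -iotaD addn1.
rewrite big_cat /= big_seq1 mulrA ih.
rewrite add1n [rising k.+2 s]rising_recr factS natrM.
have f0 : (k`!%:R : R[i]) != 0 by rewrite pnatr_eq0 -lt0n fact_gt0.
have k0 : (k.+1%:R : R[i]) != 0 by rewrite pnatr_eq0.
by move: (k.+1%:R : R[i]) k0 => m m0; field; rewrite f0 m0.
Qed.

(** The operator - x d/dx multiplies the density by s, so the composition
    multiplies it by s (1 + s) (1 + s / 2) ... (1 + s / k), which is the inverse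
    of Euler's approximant of Gamma up to the power k^s. *)
Lemma euler_op_mellin_line c p F k y : 0 < c -> rapid p ->
  (forall y, 0 < y -> F y = mellin_line c p y) -> 0 < y ->
  euler_op k F y =
    mellin_line c (fun t => rising k.+1 (c +i* t) / k`!%:R * p t) y.
Proof.
move=> c0 rp FE y0; have [rq qE] := euler_factors_mellin_line (iota 1 k) c0 rp FE.
have [_ dE] := cderive_mellin_line c0 rq y0 qE.
rewrite /euler_op dE.
pose q t : R[i] := (\prod_(j <- iota 1 k) (1 + j%:R^-1 * (c +i* t))) * p t.
have {}rq : rapid q := rq.
have isq : cintegrable setT (fun t => (c +i* t) * q t).
  have h := rapid_cintegrable (rapid_line c 0 1 rq).
  by apply: (eq_cintegrable measurableT _ h) => t _; rewrite add0r mul1r.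
have insq : cintegrable setT (fun t => - (c +i* t) * q t).
  have h := cintegrableZ (-1) measurableT isq.
  by apply: (eq_cintegrable measurableT _ h) => t _; rewrite mulN1r mulNr.
rewrite -/q mulNr mellin_line_shift // -mulN1r -mellin_lineZ //.
by apply: eq_mellin_line => t; rewrite -prod_euler /q; ring.
Qed.

End MellinLineDerivative.

(** * Gamma and zeta as multipliers *)

Section Multipliers.
Context {R : realType}.
Variable c : R.
Hypothesis c1 : 1 < c.
Implicit Types (x : R) (p q : R -> R[i]).
Notation s_ t := (c +i* t).

Let line1 t : 1 < complex.Re (s_ t). Proof. exact: c1. Qed.
Let line0 t : 0 < complex.Re (s_ t). Proof. exact: lt_trans ltr01 c1. Qed.

Lemma cmeas_Gamma_approx n : cmeas setT (fun t => Gamma_approx n (s_ t)).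
Proof.
have ml := @measurable_line_im R setT c.
apply: cmeasM.
  apply: cmeasM; last exact: cmeas_cst.
  by apply: cmeas_mpow; [exact: cmeasN|exact: measurable_cst].
apply: cmeasV; apply: (@cmeas_prod _ _ _ setT n.+1 (fun k t => s_ t + k%:R)) => k.
by apply: cmeasD => //; exact: cmeas_cst.
Qed.

Lemma cmeas_Gammac : cmeas setT (fun t => Gammac (s_ t)).
Proof.
apply: (cmeas_lim cmeas_Gamma_approx) => t _.
exact: Gamma_approx_cvg (line1 t).
Qed.

Lemma cmeas_zetac : cmeas setT (fun t => zetac (s_ t)).
Proof.
apply: (@cmeas_lim _ _ _ setT (fun n t => zeta_sum n (s_ t))) => [n|t _].
  apply: (@cmeas_sum _ _ _ setT n (fun k t => mpow (s_ t) k%:R)) => k.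
  exact: cmeas_mpow_line.
exact: zeta_cvg (line1 t).
Qed.

Lemma cmeas_moebius_sum n : cmeas setT (fun t => moebius_sum n (s_ t)).
Proof.
apply: (@cmeas_sum _ _ _ setT n
  (fun k t => (moebius k)%:~R * mpow (s_ t) k%:R)) => k.
apply: cmeasM; first exact: cmeas_cst.
exact: cmeas_mpow_line.
Qed.

Lemma zetac_le t : cabs (zetac (s_ t)) <= zetar c.
Proof.
have /ccvg_cabs h := zeta_cvg (line1 t).
apply: (cvg_seq_le h) => n.
exact: cabs_zeta_sum (line1 t).
Qed.

Lemma zetacV_le t : cabs (zetac (s_ t))^-1 <= zetar c.
Proof.
have [_ /ccvg_cabs h] := moebius_zeta (line1 t).
apply: (cvg_seq_le h) => n.
exact: cabs_moebius_sum (line1 t).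
Qed.

Lemma zetac_neq0 t : zetac (s_ t) != 0.
Proof. by have [] := moebius_zeta (line1 t). Qed.

Lemma Gammac_line_neq0 t : Gammac (s_ t) != 0.
Proof. exact: Gammac_neq0 (line1 t). Qed.

Lemma Gamma_approx_neq0 k (s : R[i]) : 0 < complex.Re s -> Gamma_approx k s != 0.
Proof.
by move=> s0; rewrite !mulf_neq0 ?mpow_neq0 ?invr_eq0 ?rising_neq0.
Qed.

Lemma Gamma_approx_real_gt0 k : 0 < cabs (Gamma_approx k c%:C).
Proof. by rewrite cabs_gt0 Gamma_approx_neq0 // (lt_trans ltr01). Qed.

(** Gamma is dominated on the line by each of its approximants, and the one of
    order j decays like |t| ^- j.+1. *)
Lemma rapid_Gamma p : cintegrable setT p -> rapid (fun t => Gammac (s_ t) * p t).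
Proof.
move=> ip j.
have c0 : 0 < c by apply: lt_trans c1.
pose C := cabs (Gammac c%:C) / cabs (Gamma_approx j c%:C) *
  (cabs (mpow (- c%:C) j%:R : R[i]) * j`!%:R / c).
have bound t : cabs (t%:C ^+ j * Gammac (s_ t)) <= C.
  have g0 := Gamma_approx_real_gt0 j.
  have h1 : cabs (Gammac (s_ t)) <= cabs (Gammac c%:C) / cabs (Gamma_approx j c%:C) *
      cabs (Gamma_approx j (s_ t)).
    by rewrite mulrAC ler_pdivlMr // Gamma_ratio_le.
  have r1 : cabs (t%:C : R[i]) ^+ j * c <= cabs (rising j.+1 (s_ t)).
    have st n : c <= cabs (s_ t + n%:R) /\ cabs (t%:C : R[i]) <= cabs (s_ t + n%:R).
      split.
        apply: le_trans (normr_Re_le _); rewrite cReD cRe_natr /= ger0_norm ?lerDl //.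
        by rewrite addr_ge0 // ltW.
      apply: le_trans (normr_Im_le _).
      by rewrite cabs_real cImD cIm_natr addr0.
    rewrite rising_recr cabsM; apply: ler_pM; rewrite ?exprn_ge0 ?cabs_ge0 ?(ltW c0) //.
      elim: (j) => [|n ih]; first by rewrite expr0 /rising big_ord0 cabs1.
      rewrite exprSr rising_recr cabsM; apply: ler_pM; rewrite ?exprn_ge0 ?cabs_ge0 //.
      by have [] := st n.
    by have [] := st j.
  have r0 : 0 < cabs (rising j.+1 (s_ t)) by rewrite cabs_gt0 rising_neq0.
  rewrite cabsM; apply: (le_trans (ler_wpM2l (cabs_ge0 _) h1)).
  rewrite mulrCA /C ler_wpM2l ?divr_ge0 ?cabs_ge0 //.
  have -> : cabs (Gamma_approx j (s_ t)) =
      cabs (mpow (- s_ t) j%:R) * j`!%:R / cabs (rising j.+1 (s_ t)).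
    by rewrite /Gamma_approx cabsM cabsM cabsV cabs_nat.
  have -> : cabs (mpow (- s_ t) j%:R) = cabs (mpow (- c%:C) j%:R : R[i]).
    by rewrite !cabs_mpow !cReN.
  have -> : cabs (t%:C ^+ j : R[i]) = cabs (t%:C : R[i]) ^+ j.
    by elim: (j) => [|n ih]; rewrite ?expr0 ?cabs1 // !exprS cabsM ih.
  rewrite mulrCA ler_wpM2l ?mulr_ge0 ?cabs_ge0 //.
  by rewrite ler_pdivrMr // ler_pdivlMl // mulrC.
have h := @cintegrableM R setT p (fun t => t%:C ^+ j * Gammac (s_ t)) C measurableT ip.
have m : cmeas setT (fun t : R => t%:C ^+ j * Gammac (s_ t)).
  apply: cmeasM; last exact: cmeas_Gammac.
  elim: (j) => [|n ih]; first by under eq_fun do rewrite expr0; exact: cmeas_cst.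
  under eq_fun do rewrite exprS; apply: cmeasM => //.
  by apply: cmeas_real; exact: measurable_id.
by apply: (eq_cintegrable measurableT _ (h m (fun t _ => bound t))) => t _; rewrite mulrA.
Qed.

(** Euler's limit formula read as an inversion: the Euler operator of order k
    divides by the k-th approximant of Gamma, uniformly boundedly. *)
Lemma euler_inversion p (F_ : nat -> R -> R[i]) x : cintegrable setT p ->
  (forall k y, (0 < k)%N -> 0 < y -> F_ k y =
    mellin_line c (fun t => mpow (s_ t) k%:R * (Gammac (s_ t) * p t)) y) ->
  0 < x -> ccvg (fun k => euler_op k (F_ k) x) (mellin_line c p x).
Proof.
move=> ip FE x0; have c0 : 0 < c by apply: lt_trans c1.
pose m_ k t := Gammac (s_ t) / Gamma_approx k (s_ t).
have E k : (0 < k)%N -> euler_op k (F_ k) x = mellin_line c (fun t => m_ k t * p t) x.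
  move=> k0.
  have rq : rapid (fun t => mpow (s_ t) k%:R * (Gammac (s_ t) * p t)).
    have rp := rapid_Gamma (cintegrable_mellin c k%:R ip) => j.
    by apply: (eq_cintegrable measurableT _ (rp j)) => t _; ring.
  rewrite (euler_op_mellin_line _ c0 rq (fun y => FE k y k0)) //.
  apply: eq_mellin_line => t; rewrite /m_ /Gamma_approx mpowN.
  have a1 := rising_neq0 k.+1 (line0 t); have a2 := mpow_neq0 (s_ t) k%:R.
  have a3 : (k`!%:R : R[i]) != 0 by rewrite pnatr_eq0 -lt0n fact_gt0.
  by field; rewrite a1 a2 a3.
have bnd : exists C, forall k, cabs (Gammac c%:C) / cabs (Gamma_approx k c%:C) <= C.
  have g0 := Gamma_real_gt0 c1.
  have h : (fun k => cabs (Gammac c%:C) / cabs (Gamma_approx k c%:C)) @ \oo -->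
      cabs (Gammac c%:C) / cabs (Gammac c%:C).
    apply: cvg_seqMl; apply: cvgV; first by rewrite gt_eqF.
    exact: cvg_Gamma_real.
  have /cvg_seq_bounded[M [Mr hM]] : cvgn (fun k => cabs (Gammac c%:C) / cabs (Gamma_approx k c%:C)).
    by apply/cvg_ex; eexists; exact: h.
  exists (M + 1) => k; apply: le_trans (ler_norm _) _.
  by apply: (hM (M + 1)) => //; rewrite ltrDl.
have [C hC] := bnd.
have lim : ccvg (fun k => mellin_line c (fun t => m_ k t * p t) x)
    (mellin_line c (fun t => 1 * p t) x).
  apply: (@mellin_line_cvg R c p x m_ (fun=> 1) C ip).
  - move=> k; apply: cmeasM; first exact: cmeas_Gammac.
    by apply: cmeasV; exact: cmeas_Gamma_approx.
  - move=> k t; apply: le_trans (hC k); rewrite /m_ cabsM cabsV.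
    have a0 : 0 < cabs (Gamma_approx k (s_ t)) by rewrite cabs_gt0 Gamma_approx_neq0.
    rewrite ler_pdivrMr // mulrAC ler_pdivlMr ?Gamma_approx_real_gt0 //.
    exact: Gamma_ratio_le (line1 t).
  - move=> t; have G0 := Gammac_line_neq0 t; rewrite -(divff G0).
    exact: ccvgZ (ccvgV (Gamma_approx_cvg (line1 t)) G0).
rewrite (@eq_mellin_line _ c p (fun t => 1 * p t)); last by move=> t; rewrite mul1r.
by apply: (eq_ccvg 1 _ _ lim) => k k0; rewrite E.
Qed.

Lemma moebius_dilations q x : cintegrable setT q -> 0 < x ->
  ccvg (fun N => \sum_(1 <= n < N) (moebius n)%:~R * mellin_line c q (x * n%:R))
    (mellin_line c (fun t => (zetac (s_ t))^-1 * q t) x).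
Proof.
move=> iq x0.
have lim : ccvg (fun N => mellin_line c (fun t => moebius_sum N (s_ t) * q t) x)
    (mellin_line c (fun t => (zetac (s_ t))^-1 * q t) x).
  apply: (@mellin_line_cvg R c q x (fun N t => moebius_sum N (s_ t))
    (fun t => (zetac (s_ t))^-1) (zetar c) iq).
  - exact: cmeas_moebius_sum.
  - by move=> N t; exact: cabs_moebius_sum (line1 t).
  - by move=> t; have [] := moebius_zeta (line1 t).
apply: (eq_ccvg 0 _ _ lim) => N _.
by rewrite mellin_line_dilations // => n n0; rewrite ltr0n.
Qed.

End Multipliers.

(** * The weighted space *)

Section WeightedSpace.
Context {R : realType}.
Implicit Types (c t x : R) (p q : R -> R[i]) (f : R -> R[i]).

Lemma cmeas_cexp d (T : measurableType d) (D : set T) (F : T -> R[i]) :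
  cmeas D F -> cmeas D (fun y => cexp (F y)).
Proof.
move=> [f1 f2].
have me : measurable_fun D (fun y => expR (complex.Re (F y))).
  exact: (measurableT_comp (@measurable_expR R) f1).
split.
  under eq_fun do rewrite Re_cexp; apply: measurable_funM => //.
  exact: (measurableT_comp (continuous_measurable_fun (@continuous_cos R)) f2).
under eq_fun do rewrite Im_cexp; apply: measurable_funM => //.
exact: (measurableT_comp (continuous_measurable_fun (@continuous_sin R)) f2).
Qed.

Lemma cabs_line c t : 0 < c -> cabs (c +i* t) = c * Num.sqrt (1 + (t / c) ^+ 2).
Proof.
move=> c0; rewrite -{2}(ger0_norm (ltW c0)) -sqrtr_sqr -sqrtrM ?sqr_ge0 //.
by rewrite /cabs /=; congr Num.sqrt; field; rewrite gt_eqF.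
Qed.

(** The measurability of the argument along the line comes from this form. *)
Lemma carg_line c t : 0 < c -> carg (c +i* t) = atan (t / c).
Proof.
move=> c0; rewrite /carg cabs_line //=.
have -> : c / (c * Num.sqrt (1 + (t / c) ^+ 2)) = cos (atan (t / c)).
  by rewrite cos_atan invfM mulrA divff ?gt_eqF // mul1r.
have := atan_ltpi2 (t / c); have := atan_gtNpi2 (t / c).
move=> a1 a2; case: ifPn => t0.
  apply: cosK; rewrite in_itv /=; apply/andP; split; last by lra.
  by rewrite -(@atan0 R) le_atan // divr_ge0 // ltW.
rewrite cosKN ?opprK //; apply/andP; split; first by lra.
rewrite -(@atan0 R) le_atan // ler_pdivrMr // mul0r.
by rewrite ltW // ltNge.
Qed.

Definition line_weight c t : R[i] :=
  cpow (c +i* t) (1 / 2 - c)%:C * (expR (pi * (1 / 2) * cabs (c +i* t)))%:C.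

Lemma cabs_line_weight c t : cabs (line_weight c t) =
  expR ((1 / 2 - c) * ln (cabs (c +i* t))) * expR (pi * (1 / 2) * cabs (c +i* t)).
Proof.
rewrite /line_weight cabsM cabs_real [`|_|]ger0_norm ?expR_ge0 //.
by rewrite /cpow cabs_cexp cReM cIm_real mul0r subr0.
Qed.

Lemma cmeas_line_weight c : 0 < c -> cmeas setT (line_weight c).
Proof.
move=> c0.
have mabs : measurable_fun setT (fun t => cabs (c +i* t)).
  by apply: measurable_cabs; exact: measurable_line_im.
have mlog : cmeas setT (fun t => clog (c +i* t)).
  apply: cmeas_pair; first exact: (measurableT_comp (@measurable_ln R) mabs).
  under eq_fun do rewrite carg_line //.
  apply: continuous_measurable_fun => t.
  apply: (isd_cont (isd_atan (isdM (isd_id t) (isd_cst t c^-1)))).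
apply: cmeasM.
  by apply: cmeas_cexp; apply: cmeasM => //; exact: cmeas_cst.
apply: cmeas_real; apply: (measurableT_comp (@measurable_expR R)).
by apply: measurable_funM.
Qed.

Lemma eq_on_Rpos f g : (forall x, 0 < x -> f x = g x) -> on_Rpos f = on_Rpos g.
Proof. by move=> fg; apply/funext => x; rewrite /on_Rpos; case: ifP => // /fg. Qed.

Lemma on_RposE f x : 0 < x -> on_Rpos f x = f x.
Proof. by rewrite /on_Rpos => ->. Qed.

Lemma mellin_invP c f : mellin_inv c f <->
  exists2 p, cintegrable setT p & f = on_Rpos (mellin_line c p).
Proof.
split=> [[fs h ->]|[p ip ->]].
  by exists (fun t => fs (c +i* t)) => //; apply: eq_on_Rpos => x; exact: inverse_mellinE.
exists (fun s => p (complex.Im s)) => //.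
by apply: eq_on_Rpos => x x0; rewrite inverse_mellinE.
Qed.

Lemma mellin_inv_weightedP c f : mellin_inv_weighted c (1 / 2) (1 / 2 - c) f <->
  exists2 q, cintegrable setT (fun t => line_weight c t * q t) &
    f = on_Rpos (mellin_line c q).
Proof.
split=> [[fs h ->]|[p ip ->]].
  by exists (fun t => fs (c +i* t)) => //; apply: eq_on_Rpos => x; exact: inverse_mellinE.
exists (fun s => p (complex.Im s)) => //.
by apply: eq_on_Rpos => x x0; rewrite inverse_mellinE.
Qed.

(** A transform acting by a multiplier comparable to the inverse of the weight
    maps the unweighted space onto the weighted one. *)
Lemma multiplier_bij c (L : (R -> R[i]) -> R -> R[i]) (M : R -> R[i]) (A B : R) :
  0 < c -> 0 < A -> cmeas setT M ->
  (forall t, A <= cabs (line_weight c t * M t) <= B) ->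
  (forall p, cintegrable setT p ->
    L (on_Rpos (mellin_line c p)) = on_Rpos (mellin_line c (fun t => M t * p t))) ->
  {in mellin_inv c &, injective L} ->
  set_bij (mellin_inv c) (mellin_inv_weighted c (1 / 2) (1 / 2 - c)) L.
Proof.
move=> c0 A0 mM bd LE inj; pose W t := line_weight c t * M t.
have mW : cmeas setT W by apply: cmeasM => //; exact: cmeas_line_weight.
have W0 t : W t != 0.
  by rewrite -cabs_gt0 (lt_le_trans A0) //; have /andP[] := bd t.
split => //.
- move=> f /mellin_invP[p ip ->]; rewrite LE //; apply/mellin_inv_weightedP.
  exists (fun t => M t * p t) => //.
  have h := cintegrableM measurableT ip mW (fun t _ => proj2 (andP (bd t))).
  by apply: (eq_cintegrable measurableT _ h) => t _; rewrite /W mulrA.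
- move=> g /mellin_inv_weightedP[q iq ->].
  have iV : cintegrable setT (fun t => (W t)^-1 * (line_weight c t * q t)).
    apply: (cintegrableM (C := A^-1) measurableT iq (cmeasV mW)) => t _.
    rewrite cabsV lef_pV2 ?posrE //; first by have /andP[] := bd t.
    by rewrite cabs_gt0.
  exists (on_Rpos (mellin_line c (fun t => (W t)^-1 * (line_weight c t * q t)))).
    by apply/mellin_invP; eexists; first exact: iV.
  rewrite LE //; congr on_Rpos; apply/funext => x; apply: eq_mellin_line => t.
  have := W0 t; rewrite /W mulf_eq0 negb_or => /andP[w0 m0].
  by field; rewrite w0 m0.
Qed.

End WeightedSpace.

(** * The two transforms as multipliers *)

Section LambertTransform.
Context {R : realType}.
Variable c : R.
Hypothesis c1 : 1 < c.
Implicit Types (x : R) (p q : R -> R[i]).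
Notation s_ t := (c +i* t).

Let line1 t : 1 < complex.Re (s_ t). Proof. exact: c1. Qed.
Let c0 : 0 < c. Proof. exact: lt_trans ltr01 c1. Qed.

Lemma cintegrable_GammaZeta p : cintegrable setT p ->
  cintegrable setT (fun t => Gammac (s_ t) * zetac (s_ t) * p t).
Proof.
move=> ip; have iG := rapid_cintegrable (rapid_Gamma c1 ip).
have h := cintegrableM measurableT iG (cmeas_zetac c1) (fun t _ => zetac_le c1 t).
by apply: (eq_cintegrable measurableT _ h) => t _; ring.
Qed.

Lemma lambert_integrandE p x u : 0 < u ->
  lambert_integrand (on_Rpos (mellin_line c p)) x u =
  (lambert_kernel x u)%:C * mellin_line c p u.
Proof.
by move=> u0; rewrite /lambert_integrand on_RposE // /lambert_kernel fmorphV mulrC.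
Qed.

Lemma lambert_kernel_mellin p x : 0 < x -> cintegrable setT p ->
  cintegrable `]0, +oo[ (fun u => (lambert_kernel x u)%:C * mellin_line c p u) /\
  cintegral `]0, +oo[ (fun u => (lambert_kernel x u)%:C * mellin_line c p u) =
    mellin_line c (fun t => Gammac (s_ t) * zetac (s_ t) * p t) x.
Proof.
move=> x0 ip.
have [h1 h2] := mellin_line_kernel (@measurable_lambert_kernel R x setT)
  (fun u u0 => ltW (lambert_kernel_gt0 x0 u0)) (integrable_lambert_kernel c1 x0) ip.
split; first exact: h1.
apply: (etrans h2); congr (_ * _); apply: eq_cintegral => t _.
by have [_ ->] := mellin_lambert (line1 t) x0; rewrite !mulrA.
Qed.

Lemma lambert_mellin p x : 0 < x -> cintegrable setT p ->
  cintegrable `]0, +oo[ (lambert_integrand (on_Rpos (mellin_line c p)) x) /\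
  lambert (on_Rpos (mellin_line c p)) x =
    mellin_line c (fun t => Gammac (s_ t) * zetac (s_ t) * p t) x.
Proof.
move=> x0 ip; have [h1 h2] := lambert_kernel_mellin x0 ip; split.
  apply: (eq_cintegrable (measurable_itv _) _ h1) => u /Rpos_gt0 u0.
  by rewrite lambert_integrandE.
rewrite /lambert on_RposE // -h2; apply: eq_cintegral => u /Rpos_gt0 u0.
by rewrite lambert_integrandE.
Qed.

(** The Widder-Lambert kernel is a difference of two Lambert kernels, so its
    multiplier differs by the factor 1 - 2^(1 - s). *)
Definition alt_factor t : R[i] := 1 - 2 * mpow (s_ t) 2.

Lemma widder_integrandE p x u : 0 < x -> 0 < u ->
  widder_lambert_integrand (on_Rpos (mellin_line c p)) x u =
  (lambert_kernel x u)%:C * mellin_line c p u +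
  - 2 * ((lambert_kernel (x * 2) u)%:C * mellin_line c p u).
Proof.
move=> x0 u0; rewrite /widder_lambert_integrand on_RposE //.
have e1 : 0 < expR (x / u) - 1 by rewrite subr_gt0 expR_gt1 divr_gt0.
have e0 := expR_gt0 (x / u).
have -> : (u * (expR (x / u) + 1))%:C^-1 =
    (lambert_kernel x u - 2 * lambert_kernel (x * 2) u)%:C.
  rewrite -fmorphV /=; congr (_%:C); rewrite /lambert_kernel.
  have -> : x * 2 / u = x / u + x / u by field; rewrite gt_eqF.
  rewrite expRD; move: (expR (x / u)) e1 e0 => e e1 e0.
  have d1 : e * e - 1 != 0.
    have -> : e * e - 1 = (e - 1) * (e + 1) by ring.
    by rewrite mulf_neq0 // gt_eqF // addr_gt0.
  by field; rewrite d1 !gt_eqF // addr_gt0.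
by rewrite rmorphB rmorphM rmorph_nat /=; ring.
Qed.

Lemma widder_mellin p x : 0 < x -> cintegrable setT p ->
  cintegrable `]0, +oo[ (widder_lambert_integrand (on_Rpos (mellin_line c p)) x) /\
  widder_lambert (on_Rpos (mellin_line c p)) x =
    mellin_line c (fun t => Gammac (s_ t) * zetac (s_ t) * alt_factor t * p t) x.
Proof.
move=> x0 ip; have x20 : 0 < x * 2 by rewrite mulr_gt0.
have [h1 h2] := lambert_kernel_mellin x0 ip.
have [h3 h4] := lambert_kernel_mellin x20 ip.
have mJ : measurable (`]0, +oo[%classic : set R) := measurable_itv _.
have h5 := cintegrableZ (- 2) mJ h3.
split.
  apply: (eq_cintegrable mJ _ (cintegrableD mJ h1 h5)) => u /Rpos_gt0 u0.
  by rewrite widder_integrandE.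
rewrite /widder_lambert on_RposE //.
have iq := cintegrable_GammaZeta ip.
apply: (@etrans _ _ (cintegral `]0, +oo[ (fun u =>
  (lambert_kernel x u)%:C * mellin_line c p u +
  - 2 * ((lambert_kernel (x * 2) u)%:C * mellin_line c p u)))).
  by apply: eq_cintegral => u /Rpos_gt0 u0; rewrite widder_integrandE.
apply: (etrans (cintegralD mJ h1 h5)).
rewrite (cintegralZ (- 2) mJ h3) h2 h4 mellin_line_scale //.
have iq2 := cintegrable_mellin c 2 iq.
rewrite -(mellin_lineZ c x (- 2) iq2) -mellin_lineD //; last exact: cintegrableZ.
by apply: eq_mellin_line => t; rewrite /alt_factor; ring.
Qed.

End LambertTransform.

(** * Inversion formulas and bijectivity *)

Section Inversion.
Context {R : realType}.
Variable c : R.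
Hypothesis c1 : 1 < c.
Implicit Types (x : R) (p q f : R -> R[i]).
Notation s_ t := (c +i* t).

Let line1 t : 1 < complex.Re (s_ t). Proof. exact: c1. Qed.
Let c0 : 0 < c. Proof. exact: lt_trans ltr01 c1. Qed.

(** The common sum of both Moebius series: Gamma alone is left of the multiplier
    of the transform. *)
Definition gamma_dilate p k x : R[i] :=
  mellin_line c (fun t => mpow (s_ t) k%:R * (Gammac (s_ t) * p t)) x.

Lemma rapid_gamma_dilate p k : cintegrable setT p ->
  rapid (fun t => mpow (s_ t) k%:R * (Gammac (s_ t) * p t)).
Proof.
move=> ip j; have h := rapid_Gamma c1 (cintegrable_mellin c k%:R ip) j.
by apply: (eq_cintegrable measurableT _ h) => t _; ring.
Qed.

Lemma gamma_dilate_inversion p (S : nat -> R -> R[i]) : cintegrable setT p ->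
  (forall k x, (0 < k)%N -> 0 < x -> S k x = gamma_dilate p k x) ->
  (forall k, (0 < k)%N -> derivable_upto_Rpos k.+1 (S k)) /\
  (forall x, 0 < x ->
    (fun k => euler_op k (S k) x : R[i]^o) @ \oo -->
      (on_Rpos (mellin_line c p) x : R[i]^o)).
Proof.
move=> ip SE; split=> [k k0|x x0].
  exact: mellin_line_smooth c0 (rapid_gamma_dilate k ip) (fun y => SE k y k0).
rewrite on_RposE //; exact: (euler_inversion c1 ip SE x0).
Qed.

Lemma lambert_series_cvg p k x : cintegrable setT p -> (0 < k)%N -> 0 < x ->
  ccvg (fun N => \sum_(1 <= n < N)
    lambert_term (lambert (on_Rpos (mellin_line c p))) k x n) (gamma_dilate p k x).
Proof.
move=> ip k0 x0; have k0' : 0 < k%:R :> R by rewrite ltr0n.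
have h := moebius_dilations c1 (cintegrable_GammaZeta c1 ip) (mulr_gt0 x0 k0').
have E : gamma_dilate p k x = mellin_line c
    (fun t => (zetac (s_ t))^-1 * (Gammac (s_ t) * zetac (s_ t) * p t)) (x * k%:R).
  rewrite mellin_line_scale //; apply: eq_mellin_line => t.
  by congr (_ * _); have z0 := zetac_neq0 c1 t; field.
rewrite E; apply: (eq_ccvg 0 _ _ h) => N _; apply: eq_big_nat => n /andP[n0 _].
have xkn : 0 < x * k%:R * n%:R by rewrite !mulr_gt0 ?ltr0n.
by rewrite /lambert_term; have [_ ->] := lambert_mellin c1 xkn ip.
Qed.

Notation ratio t := (2 * mpow (s_ t) 2).

(** The inner sum of index m divides by zeta only; the factor 1 - ratio of the
    multiplier makes the layers telescope in m. *)
Definition widder_layer p k m x : R[i] :=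
  mellin_line c (fun t => ratio t ^+ m * (1 - ratio t) *
    (mpow (s_ t) k%:R * (Gammac (s_ t) * p t))) x.

Lemma cmeas_ratio : cmeas setT (fun t => ratio t).
Proof. by apply: cmeasM; [exact: cmeas_cst|exact: cmeas_mpow_line]. Qed.

Definition ratio_abs : R := 2 * expR (- (c * ln 2)).

Lemma cabs_ratio t : cabs (ratio t) = ratio_abs.
Proof. by rewrite cabsM cabs_mpow cabs_nat. Qed.

Lemma ratio_abs_ge0 : 0 <= ratio_abs.
Proof. by rewrite mulr_ge0 ?expR_ge0. Qed.

Lemma ratio_abs_lt1 : ratio_abs < 1.
Proof.
rewrite /ratio_abs -[X in X * _]lnK ?posrE // -expRD expR_lt1.
have l2 : 0 < ln 2 :> R by rewrite ln_gt0 // ltr1n.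
by rewrite subr_lt0 -{1}(mul1r (ln 2)) ltr_pM2r.
Qed.

Lemma alt_factor_bounds t : 1 - ratio_abs <= cabs (alt_factor c t) <= 1 + ratio_abs.
Proof.
rewrite -(cabs_ratio t) /alt_factor; apply/andP; split.
  have := cabsD (1 - ratio t) (ratio t); rewrite subrK cabs1; lra.
by apply: le_trans (cabsD _ _) _; rewrite cabsN cabs1.
Qed.

Lemma cmeas_alt_factor : cmeas setT (alt_factor c).
Proof.
by apply: cmeasD; [exact: cmeas_cst|apply: cmeasN; exact: cmeas_ratio].
Qed.

Lemma cintegrable_alt p : cintegrable setT p ->
  cintegrable setT (fun t => alt_factor c t * p t).
Proof.
move=> ip; apply: (cintegrableM measurableT ip cmeas_alt_factor) => t _.
by have /andP[_ h] := alt_factor_bounds t; exact: h.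
Qed.

Lemma widder_inner_cvg p k m x : cintegrable setT p -> (0 < k)%N -> 0 < x ->
  ccvg (fun N => \sum_(1 <= n < N)
    widder_term (widder_lambert (on_Rpos (mellin_line c p))) k x m n)
    (widder_layer p k m x).
Proof.
move=> ip k0 x0; have k0' : 0 < k%:R :> R by rewrite ltr0n.
have xkm : 0 < x * k%:R * 2 ^+ m by rewrite !mulr_gt0.
have iap := cintegrable_alt ip.
have iq := cintegrable_GammaZeta c1 iap.
have h := ccvgZ (2 ^+ m) (moebius_dilations c1 iq xkm).
have iq' : cintegrable setT (fun t => (zetac (s_ t))^-1 *
    (Gammac (s_ t) * zetac (s_ t) * (alt_factor c t * p t))).
  apply: (eq_cintegrable measurableT _ (rapid_cintegrable (rapid_Gamma c1 iap))) => t _.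
  by have z0 := zetac_neq0 c1 t; field.
have E : widder_layer p k m x = 2 ^+ m * mellin_line c (fun t => (zetac (s_ t))^-1 *
    (Gammac (s_ t) * zetac (s_ t) * (alt_factor c t * p t))) (x * k%:R * 2 ^+ m).
  rewrite -mulrA mellin_line_scale ?mulr_gt0 // -mellin_lineZ; last exact: cintegrable_mellin.
  apply: eq_mellin_line => t; rewrite mpowM // mpowX // exprMn /alt_factor.
  by have z0 := zetac_neq0 c1 t; field.
rewrite E; apply: (eq_ccvg 0 _ _ h) => N _; rewrite mulr_sumr.
apply: eq_big_nat => n /andP[n0 _].
have xkn : 0 < x * k%:R * n%:R * 2 ^+ m by rewrite !mulr_gt0 ?ltr0n.
rewrite /widder_term; have [_ ->] := widder_mellin c1 xkn ip.
have -> : x * k%:R * n%:R * 2 ^+ m = x * k%:R * 2 ^+ m * n%:R by rewrite mulrAC.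
rewrite -[RHS]mulrA; apply: (congr1 (fun w => _ * (_ * w))).
by apply: eq_mellin_line => t; rewrite !mulrA.
Qed.

Lemma widder_layers_sum p k x M : cintegrable setT p ->
  \sum_(0 <= m < M) widder_layer p k m x =
  mellin_line c (fun t => (1 - ratio t ^+ M) *
    (mpow (s_ t) k%:R * (Gammac (s_ t) * p t))) x.
Proof.
move=> ip; have iq := rapid_cintegrable (rapid_gamma_dilate k ip).
elim: M => [|M ih].
  rewrite big_geq // -[LHS](mul0r (gamma_dilate p k x)) -mellin_lineZ //.
  by apply: eq_mellin_line => t; rewrite expr0 subrr.
have r1 := ltW ratio_abs_lt1; have r0 := ratio_abs_ge0.
have bX n t : cabs (ratio t ^+ n) <= 1.
  elim: n => [|n ihn]; first by rewrite expr0 cabs1.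
  by rewrite exprS cabsM cabs_ratio mulr_ile1 ?cabs_ge0.
have mX n : cmeas setT (fun t => ratio t ^+ n).
  elim: n => [|n ihn]; first by under eq_fun do rewrite expr0; exact: cmeas_cst.
  by under eq_fun do rewrite exprS; apply: cmeasM ihn; exact: cmeas_ratio.
have iX n : cintegrable setT (fun t => ratio t ^+ n *
    (mpow (s_ t) k%:R * (Gammac (s_ t) * p t))).
  exact: (cintegrableM measurableT iq (mX n) (fun t _ => bX n t)).
rewrite big_nat_recr //= ih /widder_layer -mellin_lineD.
- by apply: eq_mellin_line => t; rewrite exprSr; ring.
- have h := cintegrableD measurableT iq (cintegrableZ (-1) measurableT (iX M)).
  by apply: (eq_cintegrable measurableT _ h) => t _; ring.
have h := cintegrableD measurableT (iX M) (cintegrableZ (-1) measurableT (iX M.+1)).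
by apply: (eq_cintegrable measurableT _ h) => t _; rewrite exprSr; ring.
Qed.

Lemma widder_outer_cvg p k x : cintegrable setT p ->
  ccvg (fun M => \sum_(0 <= m < M) widder_layer p k m x) (gamma_dilate p k x).
Proof.
move=> ip; have iq := rapid_cintegrable (rapid_gamma_dilate k ip).
have r1 := ratio_abs_lt1; have r0 := ratio_abs_ge0.
have cX n t : cabs (ratio t ^+ n) = ratio_abs ^+ n.
  elim: n => [|n ihn]; first by rewrite !expr0 cabs1.
  by rewrite !exprS cabsM cabs_ratio ihn.
have lim : ccvg (fun M => mellin_line c (fun t => (1 - ratio t ^+ M) *
    (mpow (s_ t) k%:R * (Gammac (s_ t) * p t))) x)
    (mellin_line c (fun t => 1 * (mpow (s_ t) k%:R * (Gammac (s_ t) * p t))) x).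
  apply: (@mellin_line_cvg R c _ x (fun M t => 1 - ratio t ^+ M) (fun=> 1) 2 iq).
  - move=> n; apply: cmeasD; first exact: cmeas_cst.
    apply: cmeasN; elim: n => [|n ihn]; first by under eq_fun do rewrite expr0; exact: cmeas_cst.
    by under eq_fun do rewrite exprS; apply: cmeasM ihn; exact: cmeas_ratio.
  - move=> n t; apply: le_trans (cabsD _ _) _; rewrite cabsN cabs1 cX.
    have : ratio_abs ^+ n <= 1 by rewrite exprn_ile1 // ltW.
    lra.
  - move=> t; apply: (ccvg_squeeze (e := fun n => ratio_abs ^+ n)).
      by move=> n; rewrite addrAC subrr add0r cabsN cX.
    by apply: cvg_expr; rewrite ger0_norm.
rewrite (_ : gamma_dilate p k x = mellin_line c (fun t => 1 *
  (mpow (s_ t) k%:R * (Gammac (s_ t) * p t))) x); last first.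
  by apply: eq_mellin_line => t; rewrite mul1r.
by apply: (eq_ccvg 0 _ _ lim) => M _; rewrite widder_layers_sum.
Qed.

(** The inversion formula recovers the function from the series of its
    transform, which is why the transforms are injective. *)
Lemma gamma_dilate_injective p q (S : nat -> R -> R[i]) :
  cintegrable setT p -> cintegrable setT q ->
  (forall k x, (0 < k)%N -> 0 < x -> S k x = gamma_dilate p k x) ->
  (forall k x, (0 < k)%N -> 0 < x -> S k x = gamma_dilate q k x) ->
  on_Rpos (mellin_line c p) = on_Rpos (mellin_line c q).
Proof.
move=> ip iq Sp Sq; apply: eq_on_Rpos => x x0.
exact: (ccvg_unique (euler_inversion c1 ip Sp x0) (euler_inversion c1 iq Sq x0)).
Qed.

Lemma lambert_seriesE p k x : cintegrable setT p -> (0 < k)%N -> 0 < x ->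
  lambert_series (lambert (on_Rpos (mellin_line c p))) k x = gamma_dilate p k x.
Proof. by move=> ip k0 x0; exact: (ccvg_lim (lambert_series_cvg ip k0 x0)). Qed.

Lemma widder_innerE p k m x : cintegrable setT p -> (0 < k)%N -> 0 < x ->
  widder_inner (widder_lambert (on_Rpos (mellin_line c p))) k x m = widder_layer p k m x.
Proof. by move=> ip k0 x0; exact: (ccvg_lim (widder_inner_cvg (m := m) ip k0 x0)). Qed.

Lemma widder_series_cvg p k x : cintegrable setT p -> (0 < k)%N -> 0 < x ->
  ccvg (fun M => \sum_(0 <= m < M)
    widder_inner (widder_lambert (on_Rpos (mellin_line c p))) k x m)
    (gamma_dilate p k x).
Proof.
move=> ip k0 x0; apply: (eq_ccvg 0 _ _ (widder_outer_cvg (k := k) (x := x) ip)) => M _.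
by apply: eq_big_nat => m _; rewrite widder_innerE.
Qed.

Lemma widder_seriesE p k x : cintegrable setT p -> (0 < k)%N -> 0 < x ->
  widder_series (widder_lambert (on_Rpos (mellin_line c p))) k x = gamma_dilate p k x.
Proof. by move=> ip k0 x0; exact: (ccvg_lim (widder_series_cvg ip k0 x0)). Qed.

(** Zeta and its inverse are bounded on the line, so Stirling's formula alone
    decides which weight is comparable to the inverse of the multiplier. *)
Lemma GammaZeta_weight : exists A B, 0 < A /\ forall t,
  A <= cabs (line_weight c t * (Gammac (s_ t) * zetac (s_ t))) <= B.
Proof.
have [A [B [A0 hAB]]] := stirling_line c1.
have z0 : 0 < zetar c.
  by apply: lt_le_trans (zetac_le c1 0); rewrite cabs_gt0 zetac_neq0.
exists (A / zetar c), (B * zetar c); split; first by rewrite divr_gt0.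
move=> t; rewrite mulrA cabsM cabsM cabs_line_weight.
have /andP[lo up] := hAB t.
have zt : 0 < cabs (zetac (s_ t)) by rewrite cabs_gt0 zetac_neq0.
have zl := zetac_le c1 t; have zv := zetacV_le c1 t.
rewrite cabsV in zv.
have lz : (zetar c)^-1 <= cabs (zetac (s_ t)).
  by rewrite -[leRHS]invrK lef_pV2 ?posrE ?invr_gt0.
have w0 : 0 <= expR ((1 / 2 - c) * ln (cabs (c +i* t))) *
    expR (pi * (1 / 2) * cabs (c +i* t)) * cabs (Gammac (c +i* t)).
  by rewrite !mulr_ge0 ?expR_ge0 ?cabs_ge0.
apply/andP; split; apply: ler_pM; rewrite ?(ltW A0) ?invr_ge0 ?(ltW z0) ?cabs_ge0 //.
Qed.

Lemma cmeas_GammaZeta : cmeas setT (fun t => Gammac (s_ t) * zetac (s_ t)).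
Proof. by apply: cmeasM; [exact: cmeas_Gammac|exact: cmeas_zetac]. Qed.

Lemma lambert_bij :
  set_bij (mellin_inv c) (mellin_inv_weighted c (1 / 2) (1 / 2 - c)) lambert.
Proof.
have [A [B [A0 hAB]]] := GammaZeta_weight.
apply: (multiplier_bij c0 A0 cmeas_GammaZeta hAB).
  by move=> p ip; apply: eq_on_Rpos => x x0; have [_ <-] := lambert_mellin c1 x0 ip;
    rewrite /lambert on_RposE.
move=> f g /set_mem/mellin_invP[p ip ->] /set_mem/mellin_invP[q iq ->] fg.
apply: (gamma_dilate_injective (S := fun k => lambert_series
  (lambert (on_Rpos (mellin_line c p))) k) ip iq) => k x k0 x0.
  exact: lambert_seriesE.
rewrite fg; exact: lambert_seriesE.
Qed.

Lemma widder_lambert_bij :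
  set_bij (mellin_inv c) (mellin_inv_weighted c (1 / 2) (1 / 2 - c)) widder_lambert.
Proof.
have [A [B [A0 hAB]]] := GammaZeta_weight.
have r1 := ratio_abs_lt1.
have A'0 : 0 < A * (1 - ratio_abs) by rewrite mulr_gt0 // subr_gt0.
have hAB' t : A * (1 - ratio_abs) <=
    cabs (line_weight c t * (Gammac (s_ t) * zetac (s_ t) * alt_factor c t)) <=
    B * (1 + ratio_abs).
  have /andP[lo up] := hAB t; have /andP[lo' up'] := alt_factor_bounds t.
  rewrite mulrA cabsM; apply/andP; split; apply: ler_pM => //; rewrite ?cabs_ge0 ?(ltW A0) //.
  by rewrite subr_ge0 ltW.
have mM := cmeasM cmeas_GammaZeta cmeas_alt_factor.
apply: (multiplier_bij c0 A'0 mM hAB').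
  by move=> p ip; apply: eq_on_Rpos => x x0; have [_ <-] := widder_mellin c1 x0 ip;
    rewrite /widder_lambert on_RposE.
move=> f g /set_mem/mellin_invP[p ip ->] /set_mem/mellin_invP[q iq ->] fg.
apply: (gamma_dilate_injective (S := fun k => widder_series
  (widder_lambert (on_Rpos (mellin_line c p))) k) ip iq) => k x k0 x0.
  exact: widder_seriesE.
rewrite fg; exact: widder_seriesE.
Qed.

End Inversion.

Theorem theorem4 (R : realType) (c0 : R) (hc0 : 1 < c0) :
  [/\ (forall (f : R -> R[i]) (x : R), mellin_inv c0 f -> 0 < x ->
         cintegrable `]0, +oo[ (lambert_integrand f x)),
      set_bij (mellin_inv c0) (mellin_inv_weighted c0 (1 / 2) (1 / 2 - c0))
        lambert
    & forall f : R -> R[i], mellin_inv c0 f ->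
        [/\ (forall (k : nat) (x : R), (0 < k)%N -> 0 < x ->
               cvgn (fun N : nat =>
                       \sum_(1 <= n < N) lambert_term (lambert f) k x n)),
            (forall k : nat, (0 < k)%N ->
               derivable_upto_Rpos k.+1 (lambert_series (lambert f) k))
          & forall x : R, 0 < x ->
              (fun k : nat => euler_op k (lambert_series (lambert f) k) x)
                @ \oo --> (f x : R[i]^o)]]
  /\
  [/\ (forall (f : R -> R[i]) (x : R), mellin_inv c0 f -> 0 < x ->
         cintegrable `]0, +oo[ (widder_lambert_integrand f x)),
      set_bij (mellin_inv c0) (mellin_inv_weighted c0 (1 / 2) (1 / 2 - c0))
        widder_lambert
    & forall f : R -> R[i], mellin_inv c0 f ->
        [/\ (forall (k m : nat) (x : R), (0 < k)%N -> 0 < x ->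
               cvgn (fun N : nat =>
                       \sum_(1 <= n < N) widder_term (widder_lambert f) k x m n)),
            (forall (k : nat) (x : R), (0 < k)%N -> 0 < x ->
               cvgn (fun M : nat =>
                       \sum_(0 <= m < M) widder_inner (widder_lambert f) k x m)),
            (forall k : nat, (0 < k)%N ->
               derivable_upto_Rpos k.+1 (widder_series (widder_lambert f) k))
          & forall x : R, 0 < x ->
              (fun k : nat => euler_op k (widder_series (widder_lambert f) k) x)
                @ \oo --> (f x : R[i]^o)]].
Proof.
split; split.
- by move=> f x /mellin_invP[p ip ->] x0; have [] := lambert_mellin hc0 x0 ip.
- exact: lambert_bij.
- move=> f /mellin_invP[p ip ->].
  have [h1 h2] := gamma_dilate_inversion hc0 ip
    (fun k x k0 x0 => lambert_seriesE hc0 ip k0 x0).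
  split; [|exact: h1|exact: h2].
  by move=> k x k0 x0; exact: ccvg_cvgn (lambert_series_cvg hc0 ip k0 x0).
- by move=> f x /mellin_invP[p ip ->] x0; have [] := widder_mellin hc0 x0 ip.
- exact: widder_lambert_bij.
- move=> f /mellin_invP[p ip ->].
  have [h1 h2] := gamma_dilate_inversion hc0 ip
    (fun k x k0 x0 => widder_seriesE hc0 ip k0 x0).
  split; [| |exact: h1|exact: h2].
    by move=> k m x k0 x0; exact: ccvg_cvgn (widder_inner_cvg hc0 (m := m) ip k0 x0).
  by move=> k x k0 x0; exact: ccvg_cvgn (widder_series_cvg hc0 ip k0 x0).
Qed.
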